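(* Let $I\subset\mathbb{R}$ be a nondegenerate interval of any type, let $\gamma:I\to\mathbb{C}$ be a locally analytic curve, and fix an arc length function $s:I\to\mathbb{R}$ of $\gamma$. Then the union of all locally analytic extensions of $\gamma$, each parametrized by arc length compatibly with $s$, defines a maximal curve which is locally analytic and parametrized by arc length. That is, there exist $-\infty\le A<B\le+\infty$ and a map $\gamma^*:(A,B)\to\mathbb{C}$ such that: (i) $\gamma^*$ is locally analytic and parametrized by arc length, i.e. $|(\gamma^* )'(x)|=1$ for all $x\in(A,B)$; (ii) $\gamma^*$ extends $\gamma$: $s(I)\subset(A,B)$ and $\gamma=\gamma^*\circ s$ on $I$; (iii) $\gamma^*$ is maximal: for every locally analytic extension $(\Gamma,J,h)$ of $\gamma$, if $\sigma:J\to\mathbb{R}$ denotes the arc length function of $\Gamma$ normalized by $\sigma\circ h=s$ on $I$, then $\sigma(J)\subset(A,B)$ and $\Gamma=\gamma^*\circ\sigma$ on $J$. Moreover, $\gamma^*$ has a holomorphic extension to an open set in $\mathbb{C}$ containing $(A,B)$ which is locally conformal (and locally injective).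
   Context: A conformal mapping on an open set $V\subset\mathbb{C}$ is an injective holomorphic function $V\to\mathbb{C}$; a holomorphic function is locally conformal if every point of its domain has a neighbourhood on which it is a conformal mapping. Analytic curve: for real $a<b$, a continuous map $\gamma:[a,b]\to\mathbb{C}$ is an analytic curve if there exist an open set $V\subset\mathbb{C}$ containing $[a,b]$ and a conformal mapping $\phi:V\to\mathbb{C}$ with $\phi|_{[a,b]}=\gamma$. Locally analytic curve: let $I\subset\mathbb{R}$ be an interval of any type. A continuous map $\gamma:I\to\mathbb{C}$ is locally analytic if for every $t_0\in I$: (1) if $t_0$ is an interior point of $I$, there exist $a,b\in I$ with $a<t_0<b$ such that $\gamma|_{[a,b]}$ is an analytic curve; (2) if $t_0=\max I$, there exists $a\in I$ with $a<t_0$ such that $\gamma|_{[a,t_0]}$ is an analytic curve; (3) if $t_0=\min I$, there exists $b\in I$ with $t_0<b$ such that $\gamma|_{[t_0,b]}$ is an analytic curve. Arc length function: for a locally analytic $\gamma:I\to\mathbb{C}$, an arc length function is a function $s:I\to\mathbb{R}$ with $s'(t)=|\gamma'(t)|$ on $I$ (one-sided derivatives at endpoints belonging to $I$); it is strictly increasing and determined up to an additive real constant. Locally analytic extension of $\gamma:I\to\mathbb{C}$: a triple $(\Gamma,J,h)$ where $J\subset\mathbb{R}$ is an interval, $\Gamma:J\to\mathbb{C}$ is locally analytic, and $h:I\to J$ is a continuous strictly increasing map with $\gamma=\Gamma\circ h$ (so $\Gamma$ extends $\gamma$ possibly after reparametrization). For such an extension there is exactly one arc length function $\sigma$ of $\Gamma$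 with $\sigma\circ h=s$ on $I$. *)

(* Defs.v *)
From Stdlib Require Import Reals.
From Coquelicot Require Import Coquelicot.
Open Scope R_scope.

(* Curves on an interval and holomorphic functions on an open set are
   represented by total functions together with their domain; every notion
   below depends only on the values taken on that domain. *)

Definition is_interval (I : R -> Prop) : Prop :=
  forall x y z : R, I x -> I z -> x <= y <= z -> I y.

Definition nondegenerate (I : R -> Prop) : Prop :=
  exists x y : R, I x /\ I y /\ x < y.

Definition segment (a b : R) (t : R) : Prop := a <= t <= b.

Definition Rbar_ooint (A B : Rbar) (x : R) : Prop :=
  Rbar_lt A x /\ Rbar_lt x B.

(* Here [ex_derive] is complex differentiability (scalar field [C_AbsRing]). *)
Definition holomorphic_on (V : C -> Prop) (f : C -> C) : Prop :=
  open V /\ forall z : C, V z -> ex_derive (K := C_AbsRing) (V := C_NormedModule) f z.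

Definition injective_on (V : C -> Prop) (f : C -> C) : Prop :=
  forall z w : C, V z -> V w -> f z = f w -> z = w.

Definition conformal_on (V : C -> Prop) (f : C -> C) : Prop :=
  holomorphic_on V f /\ injective_on V f.

Definition locally_conformal_on (U : C -> Prop) (f : C -> C) : Prop :=
  holomorphic_on U f /\
  forall z : C, U z ->
    exists V : C -> Prop,
      V z /\ (forall w : C, V w -> U w) /\ conformal_on V f.

Definition locally_injective_on (U : C -> Prop) (f : C -> C) : Prop :=
  forall z : C, U z ->
    exists V : C -> Prop,
      open V /\ V z /\ (forall w : C, V w -> U w) /\ injective_on V f.

Definition analytic_curve (a b : R) (gamma : R -> C) : Prop :=
  a < b /\
  continuous_on (segment a b) gamma /\
  exists (V : C -> Prop) (phi : C -> C),
    (forall t : R, segment a b t -> V (RtoC t)) /\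
    conformal_on V phi /\
    (forall t : R, segment a b t -> phi (RtoC t) = gamma t).

Definition locally_analytic (I : R -> Prop) (gamma : R -> C) : Prop :=
  continuous_on I gamma /\
  forall t0 : R, I t0 ->
    (locally t0 I ->
       exists a b : R, I a /\ I b /\ a < t0 < b /\ analytic_curve a b gamma) /\
    ((forall t : R, I t -> t <= t0) ->
       exists a : R, I a /\ a < t0 /\ analytic_curve a t0 gamma) /\
    ((forall t : R, I t -> t0 <= t) ->
       exists b : R, I b /\ t0 < b /\ analytic_curve t0 b gamma).

(* Derivative at [t] of [f] restricted to [I]: for an interval [I] it is the
   usual derivative at interior points and the one-sided derivative at
   endpoints belonging to [I].  It is [is_derive] with the filter [locally t]
   traced on [I]. *)
Definition is_derive_on {V : NormedModule R_AbsRing}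
    (I : R -> Prop) (f : R -> V) (t : R) (l : V) : Prop :=
  filterdiff f (within I (locally t)) (fun y : R => scal y l).

Definition arc_length (I : R -> Prop) (gamma : R -> C) (s : R -> R) : Prop :=
  forall t : R, I t ->
    exists v : C,
      is_derive_on (V := C_R_NormedModule) I gamma t v /\
      is_derive_on (V := R_NormedModule) I s t (Cmod v).

Definition locally_analytic_extension (I : R -> Prop) (gamma : R -> C)
    (Gamma : R -> C) (J : R -> Prop) (h : R -> R) : Prop :=
  is_interval J /\
  locally_analytic J Gamma /\
  (forall t : R, I t -> J (h t)) /\
  continuous_on I h /\
  (forall t u : R, I t -> I u -> t < u -> h t < h u) /\
  (forall t : R, I t -> gamma t = Gamma (h t)).

(* [sigma] is the arc length function of the extension compatible with [s]. *)
Definition normalized_arc_length (I : R -> Prop) (s : R -> R)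
    (Gamma : R -> C) (J : R -> Prop) (h sigma : R -> R) : Prop :=
  arc_length J Gamma sigma /\
  (forall t : R, I t -> sigma (h t) = s t).

(* Main.v *)
Require Import Defs.
From Stdlib Require Import Reals.
From Coquelicot Require Import Coquelicot.
From Stdlib Require Import Lra Lia Psatz Classical ClassicalEpsilon.
Open Scope R_scope.

(** Arc length normalized by [s] leaves no freedom of parametrization, so two extensions of
    [gamma] can be compared point by point, and the identity theorem makes them agree wherever
    both are defined; their union is therefore a curve.  Everything rests on one local fact: near each of its points a
    locally analytic curve is [psi o sigma] with [sigma] its arc length and [psi] a conformal
    map of unit speed on the real axis ([unit_arc], [locally_analytic_unit_arc]).

    The local fact.  Let [Gamma] be the restriction of a conformal map [phi].  Its speed
    [|phi'|] on the real axis is the restriction of a holomorphic function: with [L] a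
    logarithm of [phi' / phi' t0], it equals [|phi' t0| exp (Re L)], and on the real axis
    [Re L] coincides with the average of [L] and its Schwarz reflection
    ([holomorphic_arc_length]).  A primitive [S] of that function extends arc length
    holomorphically, its derivative does not vanish, and [psi = phi o S^-1]
    ([unit_speed_reparametrization]).

    The global argument.  Replacing [Gamma] by [Gamma o sigma^-1] brings every extension to a
    normal form: a function on an interval containing [s I] that is near each point the
    restriction of a unit arc ([unit_speed_ext]).  Two normal forms agree on the intersection
    of their intervals, because the set where they agree locally is open and closed in it and
    contains an interval inside [s I] ([unit_speed_ext_unique]).  A normal form extends across
    every point of its interval along the unit arc at that point ([unit_speed_ext_enlarge]).
    Hence the union of all normal forms lives on an open interval and is locally a unit arc
    ([maximal_unit_speed_ext]).  The unit arcs themselves glue to a holomorphic function on a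
    union of discs with real centres ([locally_unit_holomorphic_extension]).

    The complex analysis used is developed from complex differentiability alone.  Goursat's
    lemma on rectangles gives primitives on discs; composed with the exponential, which maps
    rectangles to annuli, it gives Cauchy's integral formula ([cauchy_formula]).  From the
    formula follow the differentiability of derivatives ([derivative_holo_disc]) and the
    factorization of a function at a zero ([zero_order]), and from these the identity
    principle, logarithms, local inverses, and the fact that an injective holomorphic function
    has no critical point ([injective_deriv_neq_0]). *)

(** * Complex differentiability and continuity in terms of the modulus *)

Definition Cderiv (f : C -> C) (z l : C) : Prop :=
  is_derive (K := C_AbsRing) (V := C_NormedModule) f z l.

Definition Cdisc (c : C) (r : R) (z : C) : Prop := Cmod (z - c) < r.

Lemma Cderiv_eps f z l :
  Cderiv f z l <->
  forall eps : posreal, exists delta : posreal, forall w : C,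
    Cmod (w - z) < delta -> Cmod (f w - f z - l * (w - z)) <= eps * Cmod (w - z).
Proof.
  split.
  - intros [_ H] eps.
    destruct (H z (fun P HP => HP) eps) as [d Hd].
    exists d; intros w Hw.
    generalize (Hd w Hw); intro H1.
    rewrite (Cmult_comm l). exact H1.
  - intros H; split; [apply is_linear_scal_l|].
    intros x Hx eps.
    apply (is_filter_lim_locally_unique (K:=C_AbsRing) (V:=AbsRing_NormedModule C_AbsRing)) in Hx; subst x.
    destruct (H eps) as [d Hd].
    exists d; intros w Hw.
    generalize (Hd w Hw); intro H1.
    rewrite (Cmult_comm l) in H1. exact H1.
Qed.

Lemma Rderiv_eps (f : R -> C) t l :
  is_derive (K := R_AbsRing) (V := C_R_NormedModule) f t l <->
  forall eps : posreal, exists delta : posreal, forall u : R,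
    Rabs (u - t) < delta -> Cmod (f u - f t - l * (u - t)) <= eps * Rabs (u - t).
Proof.
  split.
  - intros [_ H] eps.
    destruct (H t (fun P HP => HP) eps) as [d Hd].
    exists d; intros w Hw.
    generalize (Hd w Hw); intro H1.
    rewrite scal_R_Cmult in H1. rewrite (Cmult_comm l), <- RtoC_minus.
    rewrite Cmod_norm. exact H1.
  - intros H; split; [apply is_linear_scal_l|].
    intros x Hx eps.
    apply (is_filter_lim_locally_unique (K:=R_AbsRing) (V:=R_NormedModule)) in Hx; subst x.
    destruct (H eps) as [d Hd].
    exists d; intros w Hw.
    generalize (Hd w Hw); intro H1.
    rewrite scal_R_Cmult. rewrite (Cmult_comm l), <- RtoC_minus in H1.
    rewrite Cmod_norm in H1. exact H1.
Qed.

(** Continuity is measured with [Cmod], since the balls of the product topology on [C] are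
    squares. *)
Definition ccont (f : C -> C) (z : C) : Prop :=
  forall eps, 0 < eps -> exists delta, 0 < delta /\
    forall w, Cmod (w - z) < delta -> Cmod (f w - f z) < eps.
Definition rcont (f : R -> C) (t : R) : Prop :=
  forall eps, 0 < eps -> exists delta, 0 < delta /\
    forall u, Rabs (u - t) < delta -> Cmod (f u - f t) < eps.

Lemma Cmod_le_sum (z : C) : Cmod z <= Rabs (Re z) + Rabs (Im z).
Proof.
  replace z with (RtoC (Re z) + Ci * RtoC (Im z))%C at 1.
  - eapply Rle_trans; [apply Cmod_triangle|].
    rewrite Cmod_mult, Cmod_Ci, !Cmod_R. lra.
  - destruct z as [x y]; unfold RtoC, Ci, Cplus, Cmult; simpl; f_equal; ring.
Qed.

Lemma im_le_Cmod (z : C) : Rabs (Im z) <= Cmod z.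
Proof. eapply Rle_trans; [|apply Rmax_Cmod]. apply Rmax_r. Qed.

Lemma rcont_continuous f t :
  rcont f t <-> continuous (U := C_UniformSpace) f t.
Proof.
  split.
  - intros H P [eps HP].
    destruct (H eps (cond_pos eps)) as [d [Hd H1]].
    exists (mkposreal d Hd); intros u Hu.
    apply HP. apply C_NormedModule_mixin_compat1. exact (H1 u Hu).
  - intros H eps Heps.
    assert (He : 0 < eps / sqrt 2).
    { apply Rdiv_lt_0_compat; [exact Heps|apply sqrt_lt_R0; lra]. }
    destruct (H (ball (f t) (mkposreal _ He))) as [d Hd].
    { exists (mkposreal _ He); intros y Hy; exact Hy. }
    exists d; split; [apply cond_pos|]; intros u Hu.
    generalize (C_NormedModule_mixin_compat2 _ _ _ (Hd u Hu)); simpl.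
    replace (sqrt 2 * (eps / sqrt 2)) with eps; [intro h; exact h|].
    field. apply Rgt_not_eq, sqrt_lt_R0; lra.
Qed.

Lemma rcont_RInt f a b :
  (forall t, Rmin a b <= t <= Rmax a b -> rcont f t) ->
  ex_RInt (V := C_R_NormedModule) f a b.
Proof.
  intros H.
  apply (ex_RInt_continuous (V := C_R_CompleteNormedModule)).
  intros t Ht; apply rcont_continuous, H, Ht.
Qed.

Lemma Cderiv_cont f z l : Cderiv f z l -> ccont f z.
Proof.
  intros H eps Heps.
  destruct (proj1 (Cderiv_eps f z l) H (mkposreal 1 Rlt_0_1)) as [d Hd]; simpl in Hd.
  assert (Hk : 0 < Cmod l + 1) by (generalize (Cmod_ge_0 l); lra).
  assert (Hq : 0 < eps / (Cmod l + 1)) by (apply Rdiv_lt_0_compat; lra).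
  exists (Rmin d (eps / (Cmod l + 1))); split.
  { apply Rmin_glb_lt; [apply cond_pos|exact Hq]. }
  intros w Hw.
  assert (H1 := Hd w (Rlt_le_trans _ _ _ Hw (Rmin_l _ _))).
  assert (H2 := Rlt_le_trans _ _ _ Hw (Rmin_r _ _)).
  replace (f w - f z)%C with ((f w - f z - l * (w - z)) + l * (w - z))%C by ring.
  eapply Rle_lt_trans; [apply Cmod_triangle|]. rewrite Cmod_mult.
  apply Rlt_div_r in H2; [|exact Hk]. nra.
Qed.

Lemma rcont_comp f g t : rcont g t -> ccont f (g t) -> rcont (fun u => f (g u)) t.
Proof.
  intros Hg Hf eps Heps.
  destruct (Hf eps Heps) as [d [Hd H1]].
  destruct (Hg d Hd) as [d' [Hd' H2]].
  exists d'; split; [exact Hd'|]; intros u Hu; apply H1, H2, Hu.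
Qed.

Lemma Cmult_close (x0 y0 : C) eps : 0 < eps -> exists e, 0 < e /\
  forall x y : C, Cmod (x - x0) < e -> Cmod (y - y0) < e -> Cmod (x * y - x0 * y0) < eps.
Proof.
  intros Heps.
  set (k := Cmod x0 + Cmod y0 + 1).
  assert (Hk : 0 < k) by (unfold k; generalize (Cmod_ge_0 x0) (Cmod_ge_0 y0); lra).
  assert (Hq : 0 < eps / (2 * k)) by (apply Rdiv_lt_0_compat; lra).
  exists (Rmin 1 (eps / (2 * k))).
  split; [apply Rmin_glb_lt; lra|].
  intros x y Hx Hy.
  set (e := Rmin 1 (eps / (2 * k))) in *.
  assert (He1 : e <= 1) by apply Rmin_l.
  assert (He2 : e * (2 * k) <= eps).
  { apply Rle_div_r; [lra|apply Rmin_r]. }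
  replace (x * y - x0 * y0)%C
    with ((x - x0) * (y - y0) + (x - x0) * y0 + x0 * (y - y0))%C by ring.
  eapply Rle_lt_trans; [apply Cmod_triangle|].
  eapply Rle_lt_trans; [apply Rplus_le_compat_r, Cmod_triangle|].
  rewrite !Cmod_mult. unfold k in *.
  generalize (Cmod_ge_0 x0) (Cmod_ge_0 y0) (Cmod_ge_0 (x - x0)) (Cmod_ge_0 (y - y0)).
  nra.
Qed.

Lemma ccont_mult f g z : ccont f z -> ccont g z -> ccont (fun w => f w * g w)%C z.
Proof.
  intros Hf Hg eps Heps.
  destruct (Cmult_close (f z) (g z) eps Heps) as [e [He H]].
  destruct (Hf e He) as [d1 [Hd1 H1]]. destruct (Hg e He) as [d2 [Hd2 H2]].
  exists (Rmin d1 d2); split; [apply Rmin_glb_lt; assumption|]. intros w Hw.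
  apply H; [apply H1|apply H2]; eapply Rlt_le_trans; eauto using Rmin_l, Rmin_r.
Qed.

Lemma ccont_const k z : ccont (fun _ => k) z.
Proof.
  intros eps Heps; exists 1; split; [lra|]; intros.
  replace (k - k)%C with (RtoC 0) by ring. rewrite Cmod_0; exact Heps.
Qed.

Lemma rcont_mult f g t : rcont f t -> rcont g t -> rcont (fun u => f u * g u)%C t.
Proof.
  intros Hf Hg eps Heps.
  destruct (Cmult_close (f t) (g t) eps Heps) as [e [He H]].
  destruct (Hf e He) as [d1 [Hd1 H1]]. destruct (Hg e He) as [d2 [Hd2 H2]].
  exists (Rmin d1 d2); split; [apply Rmin_glb_lt; assumption|]. intros w Hw.
  apply H; [apply H1|apply H2]; eapply Rlt_le_trans; eauto using Rmin_l, Rmin_r.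
Qed.

(** * Differentiation rules *)

Lemma Cderiv_const (k z : C) : Cderiv (fun _ => k) z 0.
Proof. exact (is_derive_const (K := C_AbsRing) (V := C_NormedModule) k z). Qed.

Lemma Cderiv_id (z : C) : Cderiv (fun w => w) z 1.
Proof. 
  apply Cderiv_eps; intros eps; exists eps; intros w _.
  replace (w - z - 1 * (w - z))%C with (RtoC 0) by ring. rewrite Cmod_0.
  apply Rmult_le_pos; [left; apply cond_pos|apply Cmod_ge_0].
Qed.

Lemma Cderiv_plus f g z a b :
  Cderiv f z a -> Cderiv g z b -> Cderiv (fun w => f w + g w)%C z (a + b)%C.
Proof. intros Hf Hg; exact (is_derive_plus (K := C_AbsRing) (V := C_NormedModule) f g z a b Hf Hg). Qed.

Lemma Cderiv_minus f g z a b :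
  Cderiv f z a -> Cderiv g z b -> Cderiv (fun w => f w - g w)%C z (a - b)%C.
Proof. intros Hf Hg; exact (is_derive_minus (K := C_AbsRing) (V := C_NormedModule) f g z a b Hf Hg). Qed.

Lemma Cderiv_eq f z a b : a = b -> Cderiv f z a -> Cderiv f z b.
Proof. intros <-; auto. Qed.

Lemma Cderiv_ext f g z a r : 0 < r -> (forall w, Cdisc z r w -> f w = g w) ->
  Cderiv f z a -> Cderiv g z a.
Proof.
  intros Hr H. apply (is_derive_ext_loc (K := C_AbsRing) (V := C_NormedModule)).
  exists (mkposreal r Hr); intros w Hw; apply H; exact Hw.
Qed.

Lemma Cderiv_comp f g z a b :
  Cderiv f (g z) a -> Cderiv g z b -> Cderiv (fun w => f (g w)) z (b * a)%C.
Proof. 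
  intros Hf Hg.
  apply Cderiv_eps; intros eps.
  set (k := Cmod b + 1 + Cmod a).
  assert (Hk : 0 < k) by (unfold k; generalize (Cmod_ge_0 a) (Cmod_ge_0 b); lra).
  set (e := Rmin 1 (eps / k)).
  assert (He : 0 < e). { apply Rmin_glb_lt; [lra|apply Rdiv_lt_0_compat; [apply cond_pos|exact Hk]]. }
  assert (He1 : e <= 1) by apply Rmin_l.
  assert (He2 : e * k <= eps). { apply Rle_div_r; [exact Hk|apply Rmin_r]. }
  destruct (proj1 (Cderiv_eps _ _ _) Hf (mkposreal e He)) as [d1 H1].
  destruct (proj1 (Cderiv_eps _ _ _) Hg (mkposreal e He)) as [d2 H2].
  destruct (Cderiv_cont _ _ _ Hg d1 (cond_pos d1)) as [d3 [Hd3 H3]].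
  simpl in *.
  assert (Hd : 0 < Rmin d2 d3) by (apply Rmin_glb_lt; [apply cond_pos|assumption]).
  exists (mkposreal _ Hd); simpl; intros w Hw.
  specialize (H2 w (Rlt_le_trans _ _ _ Hw (Rmin_l _ _))).
  specialize (H1 (g w) (H3 w (Rlt_le_trans _ _ _ Hw (Rmin_r _ _)))).
  replace (f (g w) - f (g z) - b * a * (w - z))%C
    with ((f (g w) - f (g z) - a * (g w - g z)) + a * (g w - g z - b * (w - z)))%C by ring.
  assert (H4 : Cmod (g w - g z) <= (Cmod b + 1) * Cmod (w - z)).
  { replace (g w - g z)%C with ((g w - g z - b * (w - z)) + b * (w - z))%C by ring.
    eapply Rle_trans; [apply Cmod_triangle|]. rewrite Cmod_mult.
    generalize (Cmod_ge_0 (w - z)). nra. }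
  eapply Rle_trans; [apply Cmod_triangle|]. rewrite (Cmod_mult a).
  generalize (Cmod_ge_0 (w - z)) (Cmod_ge_0 a) (Cmod_ge_0 b) (Cmod_ge_0 (g w - g z)); intros.
  apply Rle_trans with (e * ((Cmod b + 1) * Cmod (w - z)) + Cmod a * (e * Cmod (w - z))).
  - apply Rplus_le_compat; [|apply Rmult_le_compat_l; assumption].
    eapply Rle_trans; [exact H1|]. apply Rmult_le_compat_l; lra.
  - replace (e * ((Cmod b + 1) * Cmod (w - z)) + Cmod a * (e * Cmod (w - z)))
      with ((e * k) * Cmod (w - z)) by (unfold k; ring).
    apply Rmult_le_compat_r; assumption.
Qed.

Lemma Cderiv_mult f g z a b :
  Cderiv f z a -> Cderiv g z b -> Cderiv (fun w => f w * g w)%C z (a * g z + f z * b)%C.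
Proof.
  intros [_ Hf] [_ Hg].
  assert (Lf : is_derive (K := C_AbsRing) (V := AbsRing_NormedModule C_AbsRing) f z a)
    by (split; [apply is_linear_scal_l|exact Hf]).
  assert (Lg : is_derive (K := C_AbsRing) (V := AbsRing_NormedModule C_AbsRing) g z b)
    by (split; [apply is_linear_scal_l|exact Hg]).
  destruct (is_derive_mult (K := C_AbsRing) f g z a b Lf Lg Cmult_comm) as [_ H].
  split; [apply is_linear_scal_l|exact H].
Qed.

Lemma Cderiv_scal k f z a : Cderiv f z a -> Cderiv (fun w => k * f w)%C z (k * a)%C.
Proof.
  intros Hf. eapply Cderiv_eq; [|exact (Cderiv_mult _ _ _ _ _ (Cderiv_const k z) Hf)].
  cbv beta; ring.
Qed.

Lemma Cderiv_inv_id (z : C) : z <> 0 -> Cderiv Cinv z (- / (z * z))%C.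
Proof.
  intros Hz. apply Cderiv_eps; intros eps.
  assert (Hm := proj1 (Cmod_gt_0 z) Hz).
  set (m := Cmod z) in *.
  assert (Hm3 : 0 < m * m * m) by (repeat apply Rmult_lt_0_compat; exact Hm).
  assert (Hd : 0 < Rmin (m / 2) (eps * (m * m * m) / 2)).
  { apply Rmin_glb_lt; [lra|].
    apply Rdiv_lt_0_compat; [apply Rmult_lt_0_compat; [apply cond_pos|exact Hm3]|lra]. }
  exists (mkposreal _ Hd); simpl; intros w Hw.
  assert (H1 := Rlt_le_trans _ _ _ Hw (Rmin_l _ _)).
  assert (H2 := Rlt_le_trans _ _ _ Hw (Rmin_r _ _)).
  assert (Hwm : m / 2 <= Cmod w).
  { assert (m <= Cmod w + Cmod (w - z)).
    { unfold m. replace z with (w + - (w - z))%C at 1 by ring.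
      eapply Rle_trans; [apply Cmod_triangle|]. rewrite Cmod_opp. lra. }
    lra. }
  assert (Hw0 : w <> 0). { apply Cmod_gt_0; lra. }
  replace (/ w - / z - - / (z * z) * (w - z))%C
    with ((w - z) * ((w - z) / (w * z * z)))%C by (field; auto).
  assert (Hwz : (w * z * z)%C <> 0) by (repeat apply Cmult_neq_0; auto).
  rewrite Cmod_mult, Cmod_div, !Cmod_mult by exact Hwz. fold m.
  rewrite Rmult_comm. apply Rmult_le_compat_r; [apply Cmod_ge_0|].
  apply Rle_div_l.
  { repeat apply Rmult_lt_0_compat; lra. }
  assert (H3 : 0 <= eps * (m * m) * (Cmod w - m / 2)).
  { repeat apply Rmult_le_pos; try lra. left; apply cond_pos. }
  unfold Rdiv in *; lra.
Qed.

Lemma Cderiv_inv f z a : Cderiv f z a -> f z <> 0 ->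
  Cderiv (fun w => / f w)%C z (- a / (f z * f z))%C.
Proof.
  intros Hf Hz.
  eapply Cderiv_eq; [|exact (Cderiv_comp Cinv f z _ _ (Cderiv_inv_id _ Hz) Hf)].
  field; exact Hz.
Qed.

Lemma Cderiv_unique f z a b : Cderiv f z a -> Cderiv f z b -> a = b.
Proof.
  intros Ha Hb.
  rewrite <- (is_C_derive_unique f z a Ha). exact (is_C_derive_unique f z b Hb).
Qed.

(** The Schwarz reflection of [f] in the real axis. *)
Definition reflect (f : C -> C) (z : C) : C := Cconj (f (Cconj z)).

Lemma Cderiv_reflect f z a :
  Cderiv f (Cconj z) a -> Cderiv (reflect f) z (Cconj a).
Proof.
  intros H. apply Cderiv_eps; intros eps.
  destruct (proj1 (Cderiv_eps _ _ _) H eps) as [d Hd].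
  exists d; intros w Hw.
  unfold reflect.
  replace (Cconj (f (Cconj w)) - Cconj (f (Cconj z)) - Cconj a * (w - z))%C
    with (Cconj (f (Cconj w) - f (Cconj z) - a * (Cconj w - Cconj z))).
  - rewrite Cmod_conj.
    replace (Cmod (w - z)) with (Cmod (Cconj w - Cconj z)).
    + apply Hd. rewrite <- Cminus_conj, Cmod_conj; exact Hw.
    + rewrite <- Cminus_conj, Cmod_conj; reflexivity.
  - rewrite !Cminus_conj, Cmult_conj, Cminus_conj, !Cconj_conj. reflexivity.
Qed.

Lemma Rderiv_comp f (g : R -> C) t a b :
  Cderiv f (g t) a -> is_derive (K := R_AbsRing) (V := C_R_NormedModule) g t b ->
  is_derive (K := R_AbsRing) (V := C_R_NormedModule) (fun u => f (g u)) t (a * b)%C.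
Proof. 
  intros Hf Hg.
  apply Rderiv_eps; intros eps.
  set (k := Cmod b + 1 + Cmod a).
  assert (Hk : 0 < k) by (unfold k; generalize (Cmod_ge_0 a) (Cmod_ge_0 b); lra).
  set (e := Rmin 1 (eps / k)).
  assert (He : 0 < e). { apply Rmin_glb_lt; [lra|apply Rdiv_lt_0_compat; [apply cond_pos|exact Hk]]. }
  assert (He1 : e <= 1) by apply Rmin_l.
  assert (He2 : e * k <= eps). { apply Rle_div_r; [exact Hk|apply Rmin_r]. }
  destruct (proj1 (Cderiv_eps _ _ _) Hf (mkposreal e He)) as [d1 H1].
  destruct (proj1 (Rderiv_eps _ _ _) Hg (mkposreal e He)) as [d2 H2].
  simpl in *.
  assert (Hk1 : 0 < Cmod b + 1) by (generalize (Cmod_ge_0 b); lra).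
  assert (Hd : 0 < Rmin d2 (d1 / (Cmod b + 1))).
  { apply Rmin_glb_lt; [apply cond_pos|apply Rdiv_lt_0_compat; [apply cond_pos|exact Hk1]]. }
  exists (mkposreal _ Hd); simpl; intros w Hw.
  specialize (H2 w (Rlt_le_trans _ _ _ Hw (Rmin_l _ _))).
  assert (H3 := Rlt_le_trans _ _ _ Hw (Rmin_r _ _)).
  apply Rlt_div_r in H3; [|exact Hk1].
  assert (Hwt : Cmod (RtoC w - RtoC t) = Rabs (w - t)) by (rewrite <- RtoC_minus; apply Cmod_R).
  assert (H4 : Cmod (g w - g t) <= (Cmod b + 1) * Rabs (w - t)).
  { replace (g w - g t)%C with ((g w - g t - b * (w - t)) + b * (w - t))%C by ring.
    eapply Rle_trans; [apply Cmod_triangle|]. rewrite Cmod_mult, Hwt.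
    generalize (Rabs_pos (w - t)). nra. }
  assert (H5 := H1 (g w)).
  assert (H6 : Cmod (g w - g t) < d1) by lra. specialize (H5 H6).
  replace (f (g w) - f (g t) - a * b * (w - t))%C
    with ((f (g w) - f (g t) - a * (g w - g t)) + a * (g w - g t - b * (w - t)))%C by ring.
  eapply Rle_trans; [apply Cmod_triangle|]. rewrite (Cmod_mult a).
  generalize (Rabs_pos (w - t)) (Cmod_ge_0 a) (Cmod_ge_0 b) (Cmod_ge_0 (g w - g t)); intros.
  apply Rle_trans with (e * ((Cmod b + 1) * Rabs (w - t)) + Cmod a * (e * Rabs (w - t))).
  - apply Rplus_le_compat; [|apply Rmult_le_compat_l; assumption].
    eapply Rle_trans; [exact H5|]. apply Rmult_le_compat_l; lra.
  - replace (e * ((Cmod b + 1) * Rabs (w - t)) + Cmod a * (e * Rabs (w - t)))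
      with ((e * k) * Rabs (w - t)) by (unfold k; ring).
    apply Rmult_le_compat_r; assumption.
Qed.

Lemma Rderiv_Re (f : R -> C) t l :
  is_derive (K := R_AbsRing) (V := C_R_NormedModule) f t l ->
  is_derive (fun u => Re (f u)) t (Re l).
Proof.
  intros H.
  refine (filterdiff_comp' (K := R_AbsRing) (U := R_NormedModule) (V := C_R_NormedModule)
    (W := R_NormedModule) f fst t _ fst H _).
  apply filterdiff_linear, (is_linear_fst (K := R_AbsRing) (U := R_NormedModule) (V := R_NormedModule)).
Qed.

Lemma Rderiv_Im (f : R -> C) t l :
  is_derive (K := R_AbsRing) (V := C_R_NormedModule) f t l ->
  is_derive (fun u => Im (f u)) t (Im l).
Proof.
  intros H.
  refine (filterdiff_comp' (K := R_AbsRing) (U := R_NormedModule) (V := C_R_NormedModule)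
    (W := R_NormedModule) f snd t _ snd H _).
  apply filterdiff_linear, (is_linear_snd (K := R_AbsRing) (U := R_NormedModule) (V := R_NormedModule)).
Qed.

Lemma Rderiv_cont (f : R -> C) t l :
  is_derive (K := R_AbsRing) (V := C_R_NormedModule) f t l -> rcont f t.
Proof.
  intros H. apply rcont_continuous.
  apply (ex_derive_continuous (K := R_AbsRing) (V := C_R_NormedModule)). exists l; exact H.
Qed.

Lemma Rderiv_line (p q : C) t :
  is_derive (K := R_AbsRing) (V := C_R_NormedModule) (fun u => p + RtoC u * q)%C t q.
Proof.
  apply Rderiv_eps; intros eps; exists eps; intros u _.
  replace (p + u * q - (p + t * q) - q * (u - t))%C with (RtoC 0) by ring.
  rewrite Cmod_0. apply Rmult_le_pos; [left; apply cond_pos|apply Rabs_pos].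
Qed.

(** * Integrals of complex valued functions of a real variable *)

Definition ex_CInt (f : R -> C) a b := ex_RInt (V := C_R_NormedModule) f a b.
Definition CInt (f : R -> C) a b : C := RInt (V := C_R_CompleteNormedModule) f a b.

(** Scalars are complex here, whereas integration is linear over the reals by construction;
    multiplication by [k] acts on the two components by real linear combinations. *)
Lemma is_CInt_scal (k : C) f a b l :
  is_RInt (V := C_R_NormedModule) f a b l ->
  is_RInt (V := C_R_NormedModule) (fun t => k * f t)%C a b (k * l)%C.
Proof.
  intros H.
  assert (Hx := is_RInt_fct_extend_fst (U := R_NormedModule) (V := R_NormedModule) f a b l H).
  assert (Hy := is_RInt_fct_extend_snd (U := R_NormedModule) (V := R_NormedModule) f a b l H).
  destruct k as [k1 k2], l as [l1 l2].
  apply (is_RInt_fct_extend_pair (U := R_NormedModule) (V := R_NormedModule)); simpl in *.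
  - apply (is_RInt_minus (V := R_NormedModule)); apply (is_RInt_scal (V := R_NormedModule)); assumption.
  - apply (is_RInt_plus (V := R_NormedModule)); apply (is_RInt_scal (V := R_NormedModule)); assumption.
Qed.

Lemma CInt_correct f a b : ex_CInt f a b -> is_RInt (V := C_R_NormedModule) f a b (CInt f a b).
Proof. apply (RInt_correct (V := C_R_CompleteNormedModule)). Qed.

Lemma CInt_unique f a b l : is_RInt (V := C_R_NormedModule) f a b l -> CInt f a b = l.
Proof. apply (is_RInt_unique (V := C_R_CompleteNormedModule)). Qed.

Lemma ex_CInt_scal k f a b : ex_CInt f a b -> ex_CInt (fun t => k * f t)%C a b.
Proof. intros H; eexists; apply is_CInt_scal, CInt_correct, H. Qed.

Lemma CInt_scal k f a b : ex_CInt f a b -> CInt (fun t => k * f t)%C a b = (k * CInt f a b)%C.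
Proof. intros H; apply CInt_unique, is_CInt_scal, CInt_correct, H. Qed.

Lemma ex_CInt_minus f g a b : ex_CInt f a b -> ex_CInt g a b -> ex_CInt (fun t => f t - g t)%C a b.
Proof. apply (ex_RInt_minus (V := C_R_NormedModule)). Qed.

Lemma CInt_plus f g a b : ex_CInt f a b -> ex_CInt g a b ->
  CInt (fun t => f t + g t)%C a b = (CInt f a b + CInt g a b)%C.
Proof. apply (RInt_plus (V := C_R_CompleteNormedModule)). Qed.

Lemma CInt_minus f g a b : ex_CInt f a b -> ex_CInt g a b ->
  CInt (fun t => f t - g t)%C a b = (CInt f a b - CInt g a b)%C.
Proof. apply (RInt_minus (V := C_R_CompleteNormedModule)). Qed.

Lemma CInt_Chasles f a b c : ex_CInt f a b -> ex_CInt f b c ->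
  (CInt f a b + CInt f b c)%C = CInt f a c.
Proof. apply (RInt_Chasles (V := C_R_CompleteNormedModule)). Qed.

Lemma CInt_swap f a b : ex_CInt f a b -> CInt f b a = (- CInt f a b)%C.
Proof. intros H. symmetry. apply (opp_RInt_swap (V := C_R_CompleteNormedModule)). exact H. Qed.

Lemma CInt_ext f g a b : (forall t, Rmin a b < t < Rmax a b -> f t = g t) -> CInt f a b = CInt g a b.
Proof. apply (RInt_ext (V := C_R_CompleteNormedModule)). Qed.

Lemma is_CInt_const (k : C) a b : is_RInt (V := C_R_NormedModule) (fun _ => k) a b ((b - a) * k)%C.
Proof.
  rewrite <- RtoC_minus, <- scal_R_Cmult.
  apply (is_RInt_const (V := C_R_NormedModule)).
Qed.

Lemma ex_CInt_const k a b : ex_CInt (fun _ => k) a b.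
Proof. eexists; apply is_CInt_const. Qed.

Lemma CInt_const (k : C) a b : CInt (fun _ => k) a b = ((b - a) * k)%C.
Proof. apply CInt_unique, is_CInt_const. Qed.

Lemma CInt_bound f a b M : ex_CInt f a b ->
  (forall t, Rmin a b <= t <= Rmax a b -> Cmod (f t) <= M) ->
  Cmod (CInt f a b) <= M * Rabs (b - a).
Proof.
  intros H HM.
  assert (main : forall a b, a <= b -> ex_CInt f a b -> (forall t, a <= t <= b -> Cmod (f t) <= M) ->
    Cmod (CInt f a b) <= M * Rabs (b - a)).
  { clear. intros a b Hab H HM. rewrite Rabs_pos_eq by lra. rewrite Rmult_comm.
    rewrite Cmod_norm.
    apply (norm_RInt_le_const (V := C_R_NormedModule) f a b); [exact Hab| |apply CInt_correct, H].
    intros t Ht. rewrite <- Cmod_norm. apply HM, Ht. }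
  destruct (Rle_dec a b) as [Hab|Hab].
  - rewrite Rmin_left, Rmax_right in HM by lra. apply main; auto.
  - rewrite Rmin_right, Rmax_left in HM by lra.
    assert (H' : ex_CInt f b a) by (apply ex_RInt_swap, H).
    rewrite (CInt_swap f b a H'), Cmod_opp, Rabs_minus_sym.
    apply main; auto; lra.
Qed.

(** * Goursat's lemma for rectangles *)

Definition between a b x := Rmin a b <= x <= Rmax a b.

Lemma between_intro a b x : a <= x <= b -> between a b x.
Proof. intros H; unfold between; rewrite Rmin_left, Rmax_right; lra. Qed.

Lemma between_elim a b x : a <= b -> between a b x -> a <= x <= b.
Proof. intros H; unfold between; rewrite Rmin_left, Rmax_right; lra. Qed.

(** The integral of [g dz] along the boundary of a rectangle.  Opposite sides are paired
    because an affine [g] then contributes two constant integrands, which cancel. *)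
Definition rect_int (g : C -> C) a b c d : C :=
  (CInt (fun x => g (x, c) - g (x, d)) a b + Ci * CInt (fun y => g (b, y) - g (a, y)) c d)%C.

Definition cont_rect (g : C -> C) a b c d :=
  forall x y, between a b x -> between c d y -> ccont g (x, y).

Lemma Cmod_hor x u (y : R) : Cmod ((u, y) - (x, y)) = Rabs (u - x).
Proof.
  replace ((u, y) - (x, y))%C with (RtoC (u - x)); [apply Cmod_R|].
  unfold RtoC, Cminus, Cplus, Copp; simpl; f_equal; ring.
Qed.

Lemma Cmod_ver y v (x : R) : Cmod ((x, v) - (x, y)) = Rabs (v - y).
Proof.
  replace ((x, v) - (x, y))%C with (Ci * RtoC (v - y))%C.
  - rewrite Cmod_mult, Cmod_Ci, Cmod_R; ring.
  - unfold RtoC, Ci, Cminus, Cplus, Copp, Cmult; simpl; f_equal; ring.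
Qed.

Lemma rcont_hor g x y : ccont g (x, y) -> rcont (fun u => g (u, y)) x.
Proof.
  intros H eps Heps; destruct (H eps Heps) as [d [Hd H1]].
  exists d; split; [exact Hd|]; intros u Hu; apply H1. rewrite Cmod_hor; exact Hu.
Qed.

Lemma rcont_ver g x y : ccont g (x, y) -> rcont (fun v => g (x, v)) y.
Proof.
  intros H eps Heps; destruct (H eps Heps) as [d [Hd H1]].
  exists d; split; [exact Hd|]; intros u Hu; apply H1. rewrite Cmod_ver; exact Hu.
Qed.

Lemma ex_CInt_hor g a b y : (forall x, between a b x -> ccont g (x, y)) ->
  ex_CInt (fun x => g (x, y)) a b.
Proof. intros H; apply rcont_RInt; intros t Ht; apply rcont_hor, H, Ht. Qed.

Lemma ex_CInt_ver g c d x : (forall y, between c d y -> ccont g (x, y)) ->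
  ex_CInt (fun y => g (x, y)) c d.
Proof. intros H; apply rcont_RInt; intros t Ht; apply rcont_ver, H, Ht. Qed.

Lemma between_l a b : between a b a.
Proof. split; [apply Rmin_l|apply Rmax_l]. Qed.

Lemma between_r a b : between a b b.
Proof. split; [apply Rmin_r|apply Rmax_r]. Qed.
#[local] Hint Resolve between_l between_r : core.

Lemma rect_split_x g a m b c d : a <= m <= b -> c <= d -> cont_rect g a b c d ->
  rect_int g a b c d = (rect_int g a m c d + rect_int g m b c d)%C.
Proof.
  intros Hm Hcd H.
  assert (Hx : forall x y, a <= x <= b -> c <= y <= d -> ccont g (x, y)).
  { intros; apply H; apply between_intro; lra. }
  assert (Eh : forall p q y, a <= p <= q -> q <= b -> c <= y <= d -> ex_CInt (fun x => g (x, y)) p q).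
  { intros; apply ex_CInt_hor; intros x Hxx; apply between_elim in Hxx; [|lra]; apply Hx; lra. }
  assert (Ev : forall x, a <= x <= b -> ex_CInt (fun y => g (x, y)) c d).
  { intros; apply ex_CInt_ver; intros y Hy; apply between_elim in Hy; [|lra]; apply Hx; lra. }
  unfold rect_int.
  rewrite <- (CInt_Chasles _ a m b) by (apply ex_CInt_minus; apply Eh; lra).
  rewrite !(CInt_minus (fun y => g (_, y))) by (apply Ev; lra). ring.
Qed.

Lemma rect_split_y g a b c m d : a <= b -> c <= m <= d -> cont_rect g a b c d ->
  rect_int g a b c d = (rect_int g a b c m + rect_int g a b m d)%C.
Proof.
  intros Hab Hm H.
  assert (Hx : forall x y, a <= x <= b -> c <= y <= d -> ccont g (x, y)).
  { intros; apply H; apply between_intro; lra. }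
  assert (Eh : forall y, c <= y <= d -> ex_CInt (fun x => g (x, y)) a b).
  { intros; apply ex_CInt_hor; intros x Hxx; apply between_elim in Hxx; [|lra]; apply Hx; lra. }
  assert (Ev : forall x p q, a <= x <= b -> c <= p <= q -> q <= d -> ex_CInt (fun y => g (x, y)) p q).
  { intros; apply ex_CInt_ver; intros y Hy; apply between_elim in Hy; [|lra]; apply Hx; lra. }
  unfold rect_int.
  rewrite <- (CInt_Chasles _ c m d) by (apply ex_CInt_minus; apply Ev; lra).
  rewrite !(CInt_minus (fun x => g (x, _))) by (apply Eh; lra). ring.
Qed.

(** One step of quadrisection.  The last quarter needs no test: the four boundary integrals
    add up to that of the whole rectangle, so if three of them are small the fourth is not. *)
Definition large_quarter (g : C -> C) (w h : R) (p : R * R) : R * R :=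
  let (a, c) := p in
  let Q := Cmod (rect_int g a (a + w) c (c + h)) / 4 in
  let w2 := w / 2 in let h2 := h / 2 in
  let big a' c' := Rle_dec Q (Cmod (rect_int g a' (a' + w2) c' (c' + h2))) in
  if big a c then (a, c) else
  if big (a + w2) c then (a + w2, c) else
  if big a (c + h2) then (a, c + h2) else (a + w2, c + h2).

Lemma large_quarter_spec g w h a c : 0 <= w -> 0 <= h ->
  cont_rect g a (a + w) c (c + h) ->
  let (a', c') := large_quarter g w h (a, c) in
  a <= a' /\ a' + w / 2 <= a + w /\ c <= c' /\ c' + h / 2 <= c + h /\
  Cmod (rect_int g a (a + w) c (c + h)) <=
  4 * Cmod (rect_int g a' (a' + w / 2) c' (c' + h / 2)).
Proof.
  intros Hw Hh H. unfold large_quarter.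
  assert (Hx : forall p q r s, a <= p <= q -> q <= a + w -> c <= r <= s -> s <= c + h ->
     cont_rect g p q r s).
  { intros p q r s Hp Hq Hr Hs x y Hxx Hyy.
    apply between_elim in Hxx; [|lra]. apply between_elim in Hyy; [|lra].
    apply H; apply between_intro; lra. }
  assert (Hsum : Cmod (rect_int g a (a + w) c (c + h)) <=
    Cmod (rect_int g a (a + w / 2) c (c + h / 2)) +
    Cmod (rect_int g (a + w / 2) (a + w / 2 + w / 2) c (c + h / 2)) +
    Cmod (rect_int g a (a + w / 2) (c + h / 2) (c + h / 2 + h / 2)) +
    Cmod (rect_int g (a + w / 2) (a + w / 2 + w / 2) (c + h / 2) (c + h / 2 + h / 2))).
  { replace (a + w / 2 + w / 2) with (a + w) by field.
    replace (c + h / 2 + h / 2) with (c + h) by field.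
    rewrite (rect_split_x g a (a + w / 2) (a + w)) by (try apply Hx; lra).
    rewrite (rect_split_y g a (a + w / 2) c (c + h / 2)) by (try apply Hx; lra).
    rewrite (rect_split_y g (a + w / 2) (a + w) c (c + h / 2)) by (try apply Hx; lra).
    eapply Rle_trans; [apply Cmod_triangle|].
    eapply Rle_trans; [apply Rplus_le_compat; apply Cmod_triangle|]. lra. }
  repeat destruct Rle_dec; repeat split; try lra.
Qed.

Fixpoint nested_quarter (g : C -> C) (w h : R) (p : R * R) (n : nat) : R * R :=
  match n with
  | O => p
  | S n => large_quarter g (w / 2 ^ n) (h / 2 ^ n) (nested_quarter g w h p n)
  end.

Lemma nested_quarter_spec g w h a c : 0 <= w -> 0 <= h -> cont_rect g a (a + w) c (c + h) ->
  forall n, let p := nested_quarter g w h (a, c) n in let q := nested_quarter g w h (a, c) (S n) in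
  (a <= fst p /\ fst p + w / 2 ^ n <= a + w /\ c <= snd p /\ snd p + h / 2 ^ n <= c + h /\
   Cmod (rect_int g a (a + w) c (c + h)) <=
   4 ^ n * Cmod (rect_int g (fst p) (fst p + w / 2 ^ n) (snd p) (snd p + h / 2 ^ n))) /\
  (fst p <= fst q /\ fst q + w / 2 ^ S n <= fst p + w / 2 ^ n /\
   snd p <= snd q /\ snd q + h / 2 ^ S n <= snd p + h / 2 ^ n).
Proof.
  intros Hw Hh H.
  assert (P2 : forall n, 0 < 2 ^ n) by (intros; apply pow_lt; lra).
  assert (P4 : forall n, 0 < 4 ^ n) by (intros; apply pow_lt; lra).
  assert (Hs : forall k n, k / 2 ^ S n = k / 2 ^ n / 2).
  { intros; simpl; field; apply Rgt_not_eq, P2. }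
  assert (step : forall n, let p := nested_quarter g w h (a, c) n in let q := nested_quarter g w h (a, c) (S n) in
    (a <= fst p /\ fst p + w / 2 ^ n <= a + w /\ c <= snd p /\ snd p + h / 2 ^ n <= c + h) ->
  fst p <= fst q /\ fst q + w / 2 ^ S n <= fst p + w / 2 ^ n /\
   snd p <= snd q /\ snd q + h / 2 ^ S n <= snd p + h / 2 ^ n /\
   Cmod (rect_int g (fst p) (fst p + w / 2 ^ n) (snd p) (snd p + h / 2 ^ n)) <=
   4 * Cmod (rect_int g (fst q) (fst q + w / 2 ^ S n) (snd q) (snd q + h / 2 ^ S n))).
  { intros n p q (I1 & I2 & I3 & I4).
    rewrite !Hs. subst q. simpl nested_quarter. fold p.
    destruct p as [a' c']; cbn [fst snd] in *.
    assert (W0 : 0 <= w / 2 ^ n) by (apply Rdiv_le_0_compat; auto).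
    assert (H0 : 0 <= h / 2 ^ n) by (apply Rdiv_le_0_compat; auto).
    assert (S := large_quarter_spec g (w / 2 ^ n) (h / 2 ^ n) a' c' W0 H0).
    destruct (large_quarter g (w / 2 ^ n) (h / 2 ^ n) (a', c')) as [a'' c'']; cbn [fst snd].
    destruct S as (S1 & S2 & S3 & S4 & S5); [|repeat split; lra].
    intros x y Hxx Hyy.
    apply between_elim in Hxx; [|lra]. apply between_elim in Hyy; [|lra].
    apply H; apply between_intro; lra. }
  assert (inv : forall n, let p := nested_quarter g w h (a, c) n in
     a <= fst p /\ fst p + w / 2 ^ n <= a + w /\ c <= snd p /\ snd p + h / 2 ^ n <= c + h /\
   Cmod (rect_int g a (a + w) c (c + h)) <=
   4 ^ n * Cmod (rect_int g (fst p) (fst p + w / 2 ^ n) (snd p) (snd p + h / 2 ^ n))).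
  { induction n as [|n (I1 & I2 & I3 & I4 & I5)].
    - simpl. unfold Rdiv; rewrite !Rinv_1, !Rmult_1_r. repeat split; try lra.
    - destruct (step n) as (S1 & S2 & S3 & S4 & S5); [repeat split; lra|].
      repeat split; try lra.
      eapply Rle_trans; [exact I5|].
      change (4 ^ S n) with (4 * 4 ^ n).
      rewrite (Rmult_comm 4), Rmult_assoc.
      apply Rmult_le_compat_l; [left; apply P4|exact S5]. }
  intros n p q. specialize (inv n). specialize (step n). cbv zeta in *. fold p q in step, inv.
  destruct inv as (I1 & I2 & I3 & I4 & I5).
  destruct step as (S1 & S2 & S3 & S4 & S5); [repeat split; lra|].
  repeat split; lra.
Qed.

(** The left endpoints increase and stay below every right endpoint, so their supremum lies
    in all the intervals. *)
Lemma nested_point (u : nat -> R) (w : R) : 0 <= w ->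
  (forall n, u n <= u (S n) /\ u (S n) + w / 2 ^ S n <= u n + w / 2 ^ n) ->
  exists l, forall n, u n <= l <= u n + w / 2 ^ n.
Proof.
  intros Hw H.
  assert (P : forall n, 0 <= w / 2 ^ n) by (intros; apply Rdiv_le_0_compat; [exact Hw|apply pow_lt; lra]).
  assert (M1 : forall n k, u n <= u (n + k)%nat).
  { intros n; induction k; [rewrite Nat.add_0_r; lra|].
    rewrite Nat.add_succ_r. destruct (H (n + k)%nat); lra. }
  assert (M2 : forall n k, u (n + k)%nat + w / 2 ^ (n + k) <= u n + w / 2 ^ n).
  { intros n; induction k; [rewrite Nat.add_0_r; lra|].
    rewrite Nat.add_succ_r. destruct (H (n + k)%nat); lra. }
  assert (M : forall n m, u n <= u m + w / 2 ^ m).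
  { intros n m. destruct (Nat.le_ge_cases n m) as [L|L].
    - replace m with (n + (m - n))%nat by lia. generalize (M1 n (m - n)%nat) (P (n + (m - n))%nat); lra.
    - replace n with (m + (n - m))%nat by lia. generalize (M2 m (n - m)%nat) (P (m + (n - m))%nat); lra. }
  destruct (completeness (fun x => exists n, x = u n)) as [l [L1 L2]].
  - exists (u O + w / 2 ^ 0). intros x [n ->]; apply M.
  - exists (u O), O; reflexivity.
  - exists l; intros n; split; [apply L1; exists n; reflexivity|].
    apply L2; intros x [m ->]; apply M.
Qed.

(** The boundary integral does not see the affine part of [g]; only the remainder has to be
    estimated on the four sides. *)
Lemma rect_int_affine_remainder g p l eps a b c d : a <= b -> c <= d ->
  cont_rect g a b c d -> 0 <= eps ->
  (forall x y, a <= x <= b -> c <= y <= d ->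
     Cmod (g (x, y) - g p - l * ((x, y) - p)) <= eps) ->
  Cmod (rect_int g a b c d) <= 2 * eps * (b - a) + 2 * eps * (d - c).
Proof.
  intros Hab Hcd Hg Heps H.
  assert (Hx : forall x y, a <= x <= b -> c <= y <= d -> ccont g (x, y)).
  { intros; apply Hg; apply between_intro; lra. }
  assert (Eh : forall y, c <= y <= d -> ex_CInt (fun x => g (x, y)) a b).
  { intros; apply ex_CInt_hor; intros x Hxx; apply between_elim in Hxx; [|lra]; apply Hx; lra. }
  assert (Ev : forall x, a <= x <= b -> ex_CInt (fun y => g (x, y)) c d).
  { intros; apply ex_CInt_ver; intros y Hy; apply between_elim in Hy; [|lra]; apply Hx; lra. }
  assert (E1 : ex_CInt (fun x => g (x, c) - g (x, d))%C a b) by (apply ex_CInt_minus; apply Eh; lra).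
  assert (E2 : ex_CInt (fun y => g (b, y) - g (a, y))%C c d) by (apply ex_CInt_minus; apply Ev; lra).
  set (k1 := (l * (Ci * (RtoC c - d)))%C). set (k2 := (l * (RtoC b - a))%C).
  assert (R : rect_int g a b c d =
    (CInt (fun x => g (x, c) - g (x, d) - k1) a b + Ci * CInt (fun y => g (b, y) - g (a, y) - k2) c d)%C).
  { rewrite (CInt_minus _ _ _ _ E1) by apply ex_CInt_const.
    rewrite (CInt_minus _ _ _ _ E2) by apply ex_CInt_const.
    rewrite !CInt_const. unfold rect_int, k1, k2. ring. }
  rewrite R.
  assert (E1' := ex_CInt_minus _ _ _ _ E1 (ex_CInt_const k1 a b)).
  assert (E2' := ex_CInt_minus _ _ _ _ E2 (ex_CInt_const k2 c d)).
  eapply Rle_trans; [apply Cmod_triangle|].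
  rewrite Cmod_mult, Cmod_Ci, Rmult_1_l.
  apply Rplus_le_compat.
  - rewrite <- (Rabs_pos_eq (b - a)) by lra.
    apply CInt_bound; [exact E1'|].
    intros x Hxx; apply between_elim in Hxx; [|lra].
    replace (g (x, c) - g (x, d) - k1)%C
      with ((g (x, c) - g p - l * ((x, c) - p)) - (g (x, d) - g p - l * ((x, d) - p)))%C.
    + unfold Cminus at 1. eapply Rle_trans; [apply Cmod_triangle|]. rewrite Cmod_opp.
      assert (A1 := H x c Hxx ltac:(lra)). assert (A2 := H x d Hxx ltac:(lra)). lra.
    + unfold k1. replace (Ci * (RtoC c - d))%C with ((x, c) - (x, d))%C; [ring|].
      unfold RtoC, Ci, Cminus, Cplus, Copp, Cmult; simpl; f_equal; ring.
  - rewrite <- (Rabs_pos_eq (d - c)) by lra.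
    apply CInt_bound; [exact E2'|].
    intros y Hy; apply between_elim in Hy; [|lra].
    replace (g (b, y) - g (a, y) - k2)%C
      with ((g (b, y) - g p - l * ((b, y) - p)) - (g (a, y) - g p - l * ((a, y) - p)))%C.
    + unfold Cminus at 1. eapply Rle_trans; [apply Cmod_triangle|]. rewrite Cmod_opp.
      assert (A1 := H b y ltac:(lra) Hy). assert (A2 := H a y ltac:(lra) Hy). lra.
    + unfold k2. replace (RtoC b - a)%C with ((b, y) - (a, y))%C; [ring|].
      unfold RtoC, Ci, Cminus, Cplus, Copp, Cmult; simpl; f_equal; ring.
Qed.

(** The boundary integral over the [n]-th nested rectangle is at least [4 ^ -n] times the one
    over the whole.  At the common point of the rectangles the remainder of the first order
    expansion of [g] is at most [eps] times the diameter, of order [2 ^ -n], and the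
    perimeter is of the same order; so the whole integral is at most a constant times [eps]. *)
Lemma goursat_le g a b c d : a <= b -> c <= d ->
  (forall x y, a <= x <= b -> c <= y <= d -> exists l, Cderiv g (x, y) l) ->
  rect_int g a b c d = 0.
Proof.
  intros Hab Hcd Hg.
  assert (Hc : forall x y, a <= x <= b -> c <= y <= d -> ccont g (x, y)).
  { intros x y Hx Hy; destruct (Hg x y Hx Hy) as [l Hl]; exact (Cderiv_cont _ _ _ Hl). }
  set (w := b - a). set (h := d - c).
  replace b with (a + w) in * by (unfold w; ring).
  replace d with (c + h) in * by (unfold h; ring).
  assert (Hw : 0 <= w) by lra. assert (Hh : 0 <= h) by lra.
  clearbody w h.
  assert (CR : cont_rect g a (a + w) c (c + h)).
  { intros x y Hx Hy; apply between_elim in Hx; [|lra]; apply between_elim in Hy; [|lra]. auto. }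
  assert (N := nested_quarter_spec g w h a c Hw Hh CR).
  destruct (nested_point (fun n => fst (nested_quarter g w h (a, c) n)) w Hw) as [X HX].
  { intros n. destruct (N n) as [_ (S1 & S2 & S3 & S4)]. split; assumption. }
  destruct (nested_point (fun n => snd (nested_quarter g w h (a, c) n)) h Hh) as [Y HY].
  { intros n. destruct (N n) as [_ (S1 & S2 & S3 & S4)]. split; assumption. }
  assert (XY : a <= X <= a + w /\ c <= Y <= c + h).
  { specialize (HX O). specialize (HY O). simpl in HX, HY.
    unfold Rdiv in HX, HY. rewrite Rinv_1 in HX, HY. lra. }
  destruct (Hg X Y (proj1 XY) (proj2 XY)) as [l Hl].
  assert (T : forall eps, 0 < eps ->
     Cmod (rect_int g a (a + w) c (c + h)) <= 2 * (w + h) * (w + h) * eps).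
  { intros eps Heps.
    destruct (proj1 (Cderiv_eps _ _ _) Hl (mkposreal eps Heps)) as [dl Hdl]; simpl in Hdl.
    assert (LL : is_lim_seq (fun n => (w + h) * (/ 2) ^ n) 0).
    { replace (Finite 0) with (Rbar_mult (w + h) 0) by (simpl; f_equal; ring).
      apply is_lim_seq_scal_l, is_lim_seq_geom. rewrite Rabs_pos_eq; lra. }
    apply is_lim_seq_spec in LL. destruct (LL dl) as [n Hn].
    specialize (Hn n (le_n n)).
    rewrite Rminus_0_r, Rabs_pos_eq in Hn.
    2: { apply Rmult_le_pos; [lra|apply pow_le; lra]. }
    rewrite pow_inv in Hn.
    assert (P2 : 0 < 2 ^ n) by (apply pow_lt; lra).
    destruct (N n) as [(I1 & I2 & I3 & I4 & I5) _]. specialize (HX n). specialize (HY n).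
    cbv beta in HX, HY.
    set (a' := fst (nested_quarter g w h (a, c) n)) in *. set (c' := snd (nested_quarter g w h (a, c) n)) in *.
    assert (W0 : 0 <= w / 2 ^ n) by (apply Rdiv_le_0_compat; auto).
    assert (H0 : 0 <= h / 2 ^ n) by (apply Rdiv_le_0_compat; auto).
    assert (S0 : (w + h) * / 2 ^ n = w / 2 ^ n + h / 2 ^ n) by (unfold Rdiv; ring).
    eapply Rle_trans; [exact I5|].
    apply Rle_trans with (4 ^ n * (2 * (eps * (w / 2 ^ n + h / 2 ^ n)) * (w / 2 ^ n)
                                   + 2 * (eps * (w / 2 ^ n + h / 2 ^ n)) * (h / 2 ^ n))).
    - apply Rmult_le_compat_l; [apply pow_le; lra|].
      replace (w / 2 ^ n) with (a' + w / 2 ^ n - a') at 3 by ring.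
      replace (h / 2 ^ n) with (c' + h / 2 ^ n - c') at 4 by ring.
      apply (rect_int_affine_remainder g (X, Y) l); try lra.
      + intros x y Hx Hy; apply between_elim in Hx; [|lra]; apply between_elim in Hy; [|lra].
        apply Hc; lra.
      + apply Rmult_le_pos; lra.
      + intros x y Hx Hy.
        assert (B : Cmod ((x, y) - (X, Y)) <= w / 2 ^ n + h / 2 ^ n).
        { eapply Rle_trans; [apply Cmod_le_sum|]. simpl.
          apply Rplus_le_compat; apply Rabs_le; lra. }
        eapply Rle_trans; [apply Hdl; lra|]. apply Rmult_le_compat_l; lra.
    - right.
      replace (4 ^ n) with (2 ^ n * 2 ^ n) by (rewrite <- Rpow_mult_distr; f_equal; lra).
      field. lra. }
  apply Cmod_eq_0. apply Rle_antisym; [|apply Cmod_ge_0].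
  apply le_epsilon; intros eps Heps.
  assert (K : 0 < 2 * (w + h) * (w + h) + 1) by nra.
  eapply Rle_trans; [apply (T (eps / (2 * (w + h) * (w + h) + 1)))|].
  - apply Rdiv_lt_0_compat; assumption.
  - rewrite Rplus_0_l. unfold Rdiv. rewrite (Rmult_comm eps), <- Rmult_assoc.
    rewrite <- (Rmult_1_l eps) at 2. apply Rmult_le_compat_r; [lra|].
    apply Rle_div_l; lra.
Qed.

Lemma rect_int_swap_x g a b c d : ex_CInt (fun x => g (x, c)) a b -> ex_CInt (fun x => g (x, d)) a b ->
  ex_CInt (fun y => g (a, y)) c d -> ex_CInt (fun y => g (b, y)) c d ->
  rect_int g b a c d = (- rect_int g a b c d)%C.
Proof.
  intros. unfold rect_int.
  rewrite CInt_swap by (apply ex_CInt_minus; assumption).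
  rewrite !(CInt_minus (fun y => g (_, y))) by assumption. ring.
Qed.

Lemma rect_int_swap_y g a b c d : ex_CInt (fun x => g (x, c)) a b -> ex_CInt (fun x => g (x, d)) a b ->
  ex_CInt (fun y => g (a, y)) c d -> ex_CInt (fun y => g (b, y)) c d ->
  rect_int g a b d c = (- rect_int g a b c d)%C.
Proof.
  intros. unfold rect_int.
  rewrite (CInt_swap _ c d) by (apply ex_CInt_minus; assumption).
  rewrite !(CInt_minus (fun x => g (x, _))) by assumption. ring.
Qed.

(** Reversing an interval of integration changes the sign of the boundary integral, so the
    corners of the rectangle may come in any order. *)
Lemma goursat g a b c d :
  (forall x y, between a b x -> between c d y -> exists l, Cderiv g (x, y) l) ->
  rect_int g a b c d = 0.
Proof.
  assert (sx : forall p q x, between p q x -> between q p x).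
  { intros p q x; unfold between; rewrite Rmin_comm, Rmax_comm; auto. }
  assert (half : forall a b c d, c <= d ->
    (forall x y, between a b x -> between c d y -> exists l, Cderiv g (x, y) l) ->
    rect_int g a b c d = 0).
  { clear a b c d. intros a b c d Hcd H.
    destruct (Rle_dec a b) as [Hab|Hab].
    - apply goursat_le; try assumption. intros; apply H; apply between_intro; assumption.
    - assert (Hc : forall x y, between b a x -> between c d y -> ccont g (x, y)).
      { intros x y Hx Hy; destruct (H x y (sx _ _ _ Hx) Hy) as [l Hl]; exact (Cderiv_cont _ _ _ Hl). }
      rewrite rect_int_swap_x.
      + rewrite goursat_le; [ring|lra|lra|]. 
        intros; apply H; [apply sx|]; apply between_intro; lra.
      + apply ex_CInt_hor; intros; apply Hc; auto.
      + apply ex_CInt_hor; intros; apply Hc; auto.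
      + apply ex_CInt_ver; intros; apply Hc; auto.
      + apply ex_CInt_ver; intros; apply Hc; auto. }
  intros H.
  assert (Hc : forall x y, between a b x -> between d c y -> ccont g (x, y)).
  { intros x y Hx Hy; destruct (H x y Hx (sx _ _ _ Hy)) as [l Hl]; exact (Cderiv_cont _ _ _ Hl). }
  destruct (Rle_dec c d) as [Hcd|Hcd].
  - apply half; assumption.
  - rewrite rect_int_swap_y.
    + rewrite half; [ring|lra|]. intros; apply H; auto.
    + apply ex_CInt_hor; intros; apply Hc; auto.
    + apply ex_CInt_hor; intros; apply Hc; auto.
    + apply ex_CInt_ver; intros; apply Hc; auto.
    + apply ex_CInt_ver; intros; apply Hc; auto.
Qed.

(** * Primitives and mean value estimates on discs *)

Definition holo_disc (c : C) (r : R) (f : C -> C) : Prop :=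
  forall z, Cdisc c r z -> exists l, Cderiv f z l.

Lemma Cpair (z : C) : z = (Re z, Im z).
Proof. destruct z; reflexivity. Qed.

Lemma Cmod_pair_le x y x' y' : Rabs x <= x' -> Rabs y <= y' -> Cmod (x, y) <= Cmod (x', y').
Proof.
  intros Hx Hy. unfold Cmod; simpl. apply sqrt_le_1_alt.
  rewrite !Rmult_1_r.
  apply Rplus_le_compat; apply Rsqr_le_abs_1; eapply Rle_trans; try eassumption; apply Rle_abs.
Qed.

Lemma Cmod_abs_pair x y : Cmod (Rabs x, Rabs y) = Cmod (x, y).
Proof.
  unfold Cmod; simpl. f_equal. rewrite !Rmult_1_r.
  change (Rsqr (Rabs x) + Rsqr (Rabs y) = Rsqr x + Rsqr y).
  rewrite <- !Rsqr_abs. reflexivity.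
Qed.

(** All the paths used to construct a primitive stay in boxes of this kind: their points
    are no further from [c], coordinate by coordinate, than [|z - c| + |w - z|] allows. *)
Lemma Cdisc_box c r z w u v : Cmod (z - c) + Cmod (w - z) < r ->
  Rabs (u - Re c) <= Rabs (Re z - Re c) + Rabs (Re w - Re z) ->
  Rabs (v - Im c) <= Rabs (Im z - Im c) + Rabs (Im w - Im z) ->
  Cdisc c r (u, v).
Proof.
  intros H Hu Hv. unfold Cdisc.
  eapply Rle_lt_trans; [|exact H].
  replace ((u, v) - c)%C with (u - Re c, v - Im c)
    by (destruct c; unfold Cminus, Cplus, Copp; simpl; f_equal; ring).
  eapply Rle_trans; [apply Cmod_pair_le; eassumption|].
  replace (Rabs (Re z - Re c) + Rabs (Re w - Re z), Rabs (Im z - Im c) + Rabs (Im w - Im z))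
    with ((Rabs (Re z - Re c), Rabs (Im z - Im c)) + (Rabs (Re w - Re z), Rabs (Im w - Im z)))%C
    by reflexivity.
  eapply Rle_trans; [apply Cmod_triangle|].
  rewrite !Cmod_abs_pair. right. f_equal; f_equal; destruct z, w, c; reflexivity.
Qed.

Lemma between_abs a b t : between a b t -> Rabs (t - a) <= Rabs (b - a).
Proof.
  unfold between, Rmin, Rmax; destruct (Rle_dec a b); intros H; apply Rabs_le;
  [rewrite Rabs_pos_eq by lra | rewrite Rabs_left1 by lra]; lra.
Qed.

Lemma ccont_disc_le f z eps : ccont f z -> 0 < eps -> exists d, 0 < d /\
  forall w, Cdisc z d w -> Cmod (f w - f z) <= eps.
Proof.
  intros H He. destruct (H eps He) as [d [Hd H1]].
  exists d; split; [exact Hd|]; intros w Hw; left; apply H1, Hw.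
Qed.

(** Integrate [f] from the centre, first horizontally, then vertically.  By Goursat's lemma
    the increment from [z] to [w] is the integral over a short path from [z] to [w], on which
    [f] is close to [f z]. *)
Lemma primitive c r f : holo_disc c r f ->
  exists F, forall z, Cdisc c r z -> Cderiv F z (f z).
Proof.
  intros Hf.
  assert (Hc : forall z, Cdisc c r z -> ccont f z).
  { intros z Hz; destruct (Hf z Hz) as [l Hl]; exact (Cderiv_cont _ _ _ Hl). }
  set (x0 := Re c). set (y0 := Im c).
  exists (fun z => CInt (fun t => f (t, y0)) x0 (Re z) + Ci * CInt (fun t => f (Re z, t)) y0 (Im z))%C.
  intros z Hz. apply Cderiv_eps; intros eps.
  assert (He2 : 0 < eps / 2) by (destruct eps; simpl; lra).
  destruct (ccont_disc_le f z (eps / 2) (Hc z Hz) He2) as [d [Hd H1]].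
  assert (Hdd : 0 < Rmin d (r - Cmod (z - c))).
  { apply Rmin_glb_lt; [exact Hd|]. unfold Cdisc in Hz; lra. }
  exists (mkposreal _ Hdd); simpl; intros w Hw.
  assert (Hw1 := Rlt_le_trans _ _ _ Hw (Rmin_l _ _)).
  assert (Hw2 := Rlt_le_trans _ _ _ Hw (Rmin_r _ _)).
  set (x := Re z). set (y := Im z). set (x' := Re w). set (y' := Im w).
  assert (box : forall u v, Rabs (u - x0) <= Rabs (x - x0) + Rabs (x' - x) ->
     Rabs (v - y0) <= Rabs (y - y0) + Rabs (y' - y) -> Cdisc c r (u, v)).
  { intros u v Hu Hv. apply (Cdisc_box c r z w); [lra|exact Hu|exact Hv]. }
  assert (B1 : forall a b e t, between a b t -> Rabs (t - a) <= Rabs (b - a) + Rabs e).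
  { intros a b e t Ht. generalize (between_abs _ _ _ Ht) (Rabs_pos e); lra. }
  assert (B2 : forall o a b t, between a b t -> Rabs (t - o) <= Rabs (a - o) + Rabs (b - a)).
  { intros o a b t Ht. replace (t - o) with ((a - o) + (t - a)) by ring.
    eapply Rle_trans; [apply Rabs_triang|]. generalize (between_abs _ _ _ Ht); lra. }
  assert (B3 : forall o a b, Rabs (b - o) <= Rabs (a - o) + Rabs (b - a)).
  { intros; apply B2, between_r. }
  assert (B4 : forall o a b, Rabs (a - o) <= Rabs (a - o) + Rabs (b - a)).
  { intros; apply B2, between_l. }
  assert (B5 : forall o a b, Rabs (o - o) <= Rabs (a - o) + Rabs (b - a)).
  { intros; rewrite Rminus_diag, Rabs_R0. generalize (Rabs_pos (a - o)) (Rabs_pos (b - a)); lra. }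
  assert (Eh0 : ex_CInt (fun t => f (t, y0)) x0 x) by (apply ex_CInt_hor; intros; apply Hc, box; auto).
  assert (Eh1 : ex_CInt (fun t => f (t, y0)) x x') by (apply ex_CInt_hor; intros; apply Hc, box; auto).
  assert (Eh2 : ex_CInt (fun t => f (t, y)) x x') by (apply ex_CInt_hor; intros; apply Hc, box; auto).
  assert (Ev0 : ex_CInt (fun t => f (x, t)) y0 y) by (apply ex_CInt_ver; intros; apply Hc, box; auto).
  assert (Ev1 : ex_CInt (fun t => f (x', t)) y0 y) by (apply ex_CInt_ver; intros; apply Hc, box; auto).
  assert (Ev2 : ex_CInt (fun t => f (x', t)) y y') by (apply ex_CInt_ver; intros; apply Hc, box; auto).
  assert (G := goursat f x x' y0 y (fun u v Hu Hv => Hf _ (box _ _ (B2 _ _ _ _ Hu) (B1 _ _ _ _ Hv)))).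
  unfold rect_int in G.
  rewrite !CInt_minus in G by assumption.
  rewrite <- (CInt_Chasles _ x0 x x') by assumption.
  rewrite <- (CInt_Chasles _ y0 y y') by assumption.
  set (k := f z).
  replace (CInt (fun t => f (t, y0)) x0 x + CInt (fun t => f (t, y0)) x x'
    + Ci * (CInt (fun t => f (x', t)) y0 y + CInt (fun t => f (x', t)) y y')
    - (CInt (fun t => f (t, y0)) x0 x + Ci * CInt (fun t => f (x, t)) y0 y) - k * (w - z))%C
  with (CInt (fun t => f (t, y) - k) x x' + Ci * CInt (fun t => f (x', t) - k) y y')%C.
  2: { rewrite !CInt_minus by (assumption || apply ex_CInt_const). rewrite !CInt_const.
    replace (w - z)%C with ((RtoC x' - x) + Ci * (RtoC y' - y))%C.
    2: { unfold x, y, x', y'; destruct z, w; unfold RtoC, Ci, Cminus, Cplus, Copp, Cmult; simpl; f_equal; ring. }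
    rewrite <- (Cplus_0_r (CInt (fun t => f (t, y)) x x' - _ + _)%C).
    rewrite <- G. ring. }
  eapply Rle_trans; [apply Cmod_triangle|]. rewrite Cmod_mult, Cmod_Ci, Rmult_1_l.
  assert (Wx : Rabs (x' - x) <= Cmod (w - z)).
  { replace (x' - x) with (Re (w - z)%C) by reflexivity. apply re_le_Cmod. }
  assert (Wy : Rabs (y' - y) <= Cmod (w - z)).
  { replace (y' - y) with (Im (w - z)%C) by reflexivity. apply im_le_Cmod. }
  apply Rle_trans with (eps / 2 * Rabs (x' - x) + eps / 2 * Rabs (y' - y)); [|nra].
  apply Rplus_le_compat; apply CInt_bound.
  - apply ex_CInt_minus; [assumption|apply ex_CInt_const].
  - intros t Ht. apply H1. unfold Cdisc. rewrite (Cpair z); fold x y. rewrite Cmod_hor.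
    eapply Rle_lt_trans; [apply between_abs, Ht|]. lra.
  - apply ex_CInt_minus; [assumption|apply ex_CInt_const].
  - intros t Ht. apply H1. unfold Cdisc.
    eapply Rle_lt_trans; [|exact Hw1].
    replace ((x', t) - z)%C with (x' - x, t - y) by reflexivity.
    replace (w - z)%C with (x' - x, y' - y) by reflexivity.
    rewrite <- (Cmod_abs_pair (x' - x) (y' - y)).
    apply Cmod_pair_le; [lra|apply between_abs, Ht].
Qed.

Lemma Cdisc_convex c r p q t : Cdisc c r p -> Cdisc c r q -> 0 <= t <= 1 ->
  Cdisc c r (p + RtoC t * (q - p))%C.
Proof.
  unfold Cdisc; intros Hp Hq Ht.
  replace (p + t * (q - p) - c)%C with (RtoC (1 - t) * (p - c) + RtoC t * (q - c))%C
    by (rewrite RtoC_minus; ring).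
  eapply Rle_lt_trans; [apply Cmod_triangle|]. rewrite !Cmod_mult, !Cmod_R.
  rewrite !Rabs_pos_eq by lra.
  destruct (Req_dec t 0) as [->|Ht0]; [lra|]. nra.
Qed.

(** The mean value theorem holds for the real and the imaginary part separately, at different
    points of the segment; this is where the factor 2 comes from. *)
Lemma mean_value_segment f l (p q a : C) M :
  (forall t, 0 <= t <= 1 -> Cderiv f (p + RtoC t * (q - p))%C (l t) /\ Cmod (l t - a) <= M) ->
  Cmod (f q - f p - a * (q - p)) <= 2 * M * Cmod (q - p).
Proof.
  intros H.
  set (g := fun t : R => (f (p + RtoC t * (q - p)) - a * (p + RtoC t * (q - p)))%C).
  assert (D : forall t, 0 <= t <= 1 ->
     is_derive (K := R_AbsRing) (V := C_R_NormedModule) g t ((l t - a) * (q - p))%C).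
  { intros t Ht. destruct (H t Ht) as [H1 _].
    apply (Rderiv_comp (fun w => f w - a * w)%C (fun u => p + RtoC u * (q - p))%C t).
    - eapply Cderiv_eq; [|apply Cderiv_minus; [exact H1|apply Cderiv_scal, Cderiv_id]]. ring.
    - apply Rderiv_line. }
  assert (E : (f q - f p - a * (q - p))%C = (g 1 - g 0)%C).
  { unfold g. replace (p + 1 * (q - p))%C with q by ring. replace (p + 0 * (q - p))%C with p by ring. ring. }
  assert (B : forall t, 0 <= t <= 1 -> Cmod ((l t - a) * (q - p)) <= M * Cmod (q - p)).
  { intros t Ht. rewrite Cmod_mult. apply Rmult_le_compat_r; [apply Cmod_ge_0|apply H, Ht]. }
  rewrite E. eapply Rle_trans; [apply Cmod_le_sum|].
  assert (R1 : Rmin 0 1 = 0) by (apply Rmin_left; lra).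
  assert (R2 : Rmax 0 1 = 1) by (apply Rmax_right; lra).
  destruct (MVT_gen (fun t => Re (g t)) 0 1 (fun t => Re ((l t - a) * (q - p))%C)) as [t1 [T1 E1]].
  { rewrite R1, R2. intros t Ht; apply Rderiv_Re, D; lra. }
  { rewrite R1, R2. intros t Ht. apply continuity_pt_filterlim.
    apply (ex_derive_continuous (K := R_AbsRing) (V := R_NormedModule)).
    eexists; apply Rderiv_Re, D, Ht. }
  destruct (MVT_gen (fun t => Im (g t)) 0 1 (fun t => Im ((l t - a) * (q - p))%C)) as [t2 [T2 E2]].
  { rewrite R1, R2. intros t Ht; apply Rderiv_Im, D; lra. }
  { rewrite R1, R2. intros t Ht. apply continuity_pt_filterlim.
    apply (ex_derive_continuous (K := R_AbsRing) (V := R_NormedModule)).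
    eexists; apply Rderiv_Im, D, Ht. }
  rewrite R1, R2 in *.
  replace (Re (g 1 - g 0)%C) with (Re (g 1) - Re (g 0)) by reflexivity.
  replace (Im (g 1 - g 0)%C) with (Im (g 1) - Im (g 0)) by reflexivity.
  rewrite E1, E2, Rminus_0_r, !Rmult_1_r.
  assert (A1 := Rle_trans _ _ _ (re_le_Cmod _) (B t1 T1)).
  assert (A2 := Rle_trans _ _ _ (im_le_Cmod _) (B t2 T2)).
  lra.
Qed.

Lemma Cdisc_const c r f : (forall z, Cdisc c r z -> Cderiv f z 0) ->
  forall p q, Cdisc c r p -> Cdisc c r q -> f p = f q.
Proof.
  intros H p q Hp Hq.
  assert (B := mean_value_segment f (fun _ => RtoC 0) p q 0 0).
  rewrite Rmult_0_r, Rmult_0_l in B.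
  assert (E : (f q - f p - 0 * (q - p))%C = 0).
  { apply Cmod_eq_0, Rle_antisym; [apply B|apply Cmod_ge_0].
    intros t Ht; split; [apply H, Cdisc_convex; assumption|].
    replace (0 - 0)%C with (RtoC 0) by ring. rewrite Cmod_0; lra. }
  symmetry; apply Ceq_minus. rewrite <- E. ring.
Qed.

(** * The complex exponential *)

Definition Cexp (z : C) : C := (exp (Re z) * cos (Im z), exp (Re z) * sin (Im z)).

Lemma Cexp_plus z w : Cexp (z + w) = (Cexp z * Cexp w)%C.
Proof.
  unfold Cexp. rewrite re_plus, im_plus, exp_plus, cos_plus, sin_plus.
  unfold Cmult; simpl. f_equal; ring.
Qed.

Lemma Cexp_0 : Cexp 0 = 1.
Proof. unfold Cexp; simpl. rewrite exp_0, cos_0, sin_0. unfold RtoC; f_equal; ring. Qed.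

Lemma Cmod_Cexp z : Cmod (Cexp z) = exp (Re z).
Proof.
  unfold Cexp, Cmod; simpl.
  replace (_ + _) with (Rsqr (exp (Re z)) * (Rsqr (sin (Im z)) + Rsqr (cos (Im z)))) by (unfold Rsqr; ring).
  rewrite sin2_cos2, Rmult_1_r. apply sqrt_Rsqr. left; apply exp_pos.
Qed.

Lemma Cexp_neq_0 z : Cexp z <> 0.
Proof. apply Cmod_gt_0. rewrite Cmod_Cexp. apply exp_pos. Qed.

(** Both components are differentiable as functions of two real variables, and their partial
    derivatives satisfy the Cauchy-Riemann equations. *)
Lemma Cderiv_Cexp z : Cderiv Cexp z (Cexp z).
Proof.
  set (x := Re z). set (y := Im z).
  assert (D1 : filterdiff (fun u : R * R => exp (fst u) * cos (snd u)) (locally (x, y))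
     (fun u : R * R => plus (scal (fst u) (exp x * cos y)) (scal (snd u) (- (exp x * sin y))))).
  { apply (is_derive_filterdiff (fun a b => exp a * cos b) x y (fun a b => exp a * cos b)).
    - exists (mkposreal 1 Rlt_0_1); intros u _. auto_derive; trivial; ring.
    - auto_derive; trivial; ring.
    - apply (continuous_mult (K := R_AbsRing)); simpl.
      + apply continuous_comp; [apply continuous_fst|apply continuous_exp].
      + apply continuous_comp; [apply continuous_snd|apply continuous_cos]. }
  assert (D2 : filterdiff (fun u : R * R => exp (fst u) * sin (snd u)) (locally (x, y))
     (fun u : R * R => plus (scal (fst u) (exp x * sin y)) (scal (snd u) (exp x * cos y)))).
  { apply (is_derive_filterdiff (fun a b => exp a * sin b) x y (fun a b => exp a * sin b)).
    - exists (mkposreal 1 Rlt_0_1); intros u _. auto_derive; trivial; ring.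
    - auto_derive; trivial; ring.
    - apply (continuous_mult (K := R_AbsRing)); simpl.
      + apply continuous_comp; [apply continuous_fst|apply continuous_exp].
      + apply continuous_comp; [apply continuous_snd|apply continuous_sin]. }
  apply Cderiv_eps; intros eps.
  assert (He : 0 < eps / 2) by (destruct eps; simpl; lra).
  destruct D1 as [_ D1]. destruct D2 as [_ D2].
  destruct (D1 (x, y) (fun P HP => HP) (mkposreal _ He)) as [d1 H1].
  destruct (D2 (x, y) (fun P HP => HP) (mkposreal _ He)) as [d2 H2].
  assert (Hd : 0 < Rmin d1 d2) by (apply Rmin_glb_lt; apply cond_pos).
  exists (mkposreal _ Hd); simpl; intros w Hw.
  assert (N : norm (K := R_AbsRing) (V := prod_NormedModule R_AbsRing R_NormedModule R_NormedModule)
    (minus (G := prod_NormedModule R_AbsRing R_NormedModule R_NormedModule) w (x, y)) = Cmod (w - z)).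
  { rewrite (Cpair z); fold x y. symmetry. exact (Cmod_norm (w - (x, y))%C). }
  assert (Bl : forall d : posreal, Cmod (w - z) < d -> ball (x, y) d w).
  { intros d Hdw. apply C_NormedModule_mixin_compat1.
    rewrite (Cpair z) in Hdw; fold x y in Hdw. exact Hdw. }
  specialize (H1 w (Bl d1 (Rlt_le_trans _ _ _ Hw (Rmin_l _ _)))).
  specialize (H2 w (Bl d2 (Rlt_le_trans _ _ _ Hw (Rmin_r _ _)))).
  rewrite N in H1, H2. simpl in H1, H2.
  eapply Rle_trans; [apply Cmod_le_sum|].
  replace (pos eps * Cmod (w - z)) with (eps / 2 * Cmod (w - z) + eps / 2 * Cmod (w - z)) by field.
  apply Rplus_le_compat.
  - eapply Rle_trans; [|exact H1]. right. 
    unfold norm, minus, plus, opp, scal; simpl. unfold abs, mult; simpl.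
    f_equal. unfold x, y, Re, Im. ring.
  - eapply Rle_trans; [|exact H2]. right. 
    unfold norm, minus, plus, opp, scal; simpl. unfold abs, mult; simpl.
    f_equal. unfold x, y, Re, Im. ring.
Qed.

(** * Cauchy's integral formula *)

Lemma Czero_small (K : R) (A : C) : (forall eps, 0 < eps -> Cmod A <= K * eps) -> A = 0.
Proof.
  intros H. apply Cmod_eq_0, Rle_antisym; [|apply Cmod_ge_0].
  apply le_epsilon; intros eps Heps. rewrite Rplus_0_l.
  assert (HK : 0 < Rabs K + 1) by (generalize (Rabs_pos K); lra).
  eapply Rle_trans; [apply (H (eps / (Rabs K + 1))); apply Rdiv_lt_0_compat; assumption|].
  unfold Rdiv. rewrite (Rmult_comm eps), <- Rmult_assoc.
  rewrite <- (Rmult_1_l eps) at 2. apply Rmult_le_compat_r; [lra|].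
  apply Rle_div_l; [assumption|]. generalize (Rle_abs K); lra.
Qed.

(** Up to a factor [i] this is the integral of [g(w) dw / w] over the circle of radius
    [exp s]; the radius is logarithmic because the exponential maps rectangles to annuli. *)
Definition circle_int (g : C -> C) (s : R) : C := CInt (fun t => g (Cexp (s, t))) 0 (2 * PI).

Lemma Cmod_Cexp_pair s t : Cmod (Cexp (s, t)) = exp s.
Proof. apply Cmod_Cexp. Qed.

Lemma rcont_circle g s t : ccont g (Cexp (s, t)) -> rcont (fun t => g (Cexp (s, t))) t.
Proof.
  intros H. apply (rcont_comp g (fun t => Cexp (s, t)) t); [|exact H].
  apply rcont_ver. exact (Cderiv_cont _ _ _ (Cderiv_Cexp _)).
Qed.

Lemma ex_CInt_circle g s : (forall t, ccont g (Cexp (s, t))) ->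
  ex_CInt (fun t => g (Cexp (s, t))) 0 (2 * PI).
Proof. intros H; apply rcont_RInt; intros t _; apply rcont_circle, H. Qed.

(** Goursat's lemma for [g o exp] on [[s0, s1] x [0, 2 pi]]: the two horizontal sides cancel
    by periodicity of the exponential. *)
Lemma circle_int_annulus g s0 s1 :
  (forall s t, between s0 s1 s -> exists l, Cderiv g (Cexp (s, t)) l) ->
  circle_int g s0 = circle_int g s1.
Proof.
  intros H.
  assert (Hc : forall s t, between s0 s1 s -> ccont g (Cexp (s, t))).
  { intros s t Hs; destruct (H s t Hs) as [l Hl]; exact (Cderiv_cont _ _ _ Hl). }
  assert (G := goursat (fun z => g (Cexp z)) s0 s1 0 (2 * PI)).
  unfold rect_int in G.
  rewrite (CInt_minus (fun y => g (Cexp (s1, y)))) in G by (apply ex_CInt_circle; intros; apply Hc; auto using between_l, between_r).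
  rewrite (CInt_ext _ (fun _ => RtoC 0)), CInt_const in G.
  - symmetry. apply Ceq_minus. apply Cmod_eq_0. 
    assert (E : (Ci * (circle_int g s1 - circle_int g s0))%C = 0).
    { rewrite <- G; [unfold circle_int; ring|].
      intros x y Hx _. destruct (H x y Hx) as [l Hl].
      eexists; exact (Cderiv_comp _ _ _ _ _ Hl (Cderiv_Cexp _)). }
    rewrite <- (Rmult_1_l (Cmod _)), <- Cmod_Ci, <- Cmod_mult, E, Cmod_0. reflexivity.
  - intros t _. unfold Cexp; simpl. rewrite cos_0, sin_0, cos_2PI, sin_2PI. ring.
Qed.

Lemma two_PI_pos : 0 < 2 * PI.
Proof. generalize PI_RGT_0; lra. Qed.

Lemma circle_int_bound g s M : (forall t, ccont g (Cexp (s, t))) ->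
  (forall w, Cmod w = exp s -> Cmod (g w) <= M) -> Cmod (circle_int g s) <= 2 * PI * M.
Proof.
  intros Hc HM. unfold circle_int.
  replace (2 * PI * M) with (M * Rabs (2 * PI - 0)).
  - apply CInt_bound; [apply ex_CInt_circle, Hc|]. intros; apply HM, Cmod_Cexp_pair.
  - rewrite Rminus_0_r, Rabs_pos_eq by (generalize two_PI_pos; lra). ring.
Qed.

(** By compactness of the circle, continuity at each of its points is uniform along it; [g]
    need not be continuous anywhere else. *)
Lemma circle_tube g s0 eps : 0 < eps -> (forall t, ccont g (Cexp (s0, t))) ->
  exists d, 0 < d /\ forall s t, Rabs (s - s0) < d -> 0 <= t <= 2 * PI ->
    Cmod (g (Cexp (s, t)) - g (Cexp (s0, t))) <= eps.
Proof.
  intros Heps Hc.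
  assert (L : forall t0, exists d : posreal, forall s t, Rabs (s - s0) < d -> Rabs (t - t0) < d ->
     Cmod (g (Cexp (s, t)) - g (Cexp (s0, t0))) < eps / 2).
  { intros t0.
    destruct (Hc t0 (eps / 2)) as [d1 [Hd1 H1]]; [lra|].
    destruct (Cderiv_cont _ _ _ (Cderiv_Cexp (s0, t0)) d1 Hd1) as [d2 [Hd2 H2]].
    assert (Hd : 0 < d2 / 2) by lra.
    exists (mkposreal _ Hd); simpl; intros s t Hs Ht. apply H1, H2.
    eapply Rle_lt_trans; [apply Cmod_le_sum|]. simpl. unfold Rminus in *. lra. }
  set (dl := fun t0 => proj1_sig (constructive_indefinite_description _ (L t0))).
  assert (Hdl : forall t0 s t, Rabs (s - s0) < dl t0 -> Rabs (t - t0) < dl t0 ->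
     Cmod (g (Cexp (s, t)) - g (Cexp (s0, t0))) < eps / 2).
  { intros t0. exact (proj2_sig (constructive_indefinite_description _ (L t0))). }
  destruct (compactness_value_1d 0 (2 * PI) dl) as [d Hd].
  exists d; split; [apply cond_pos|]. intros s t Hs Ht.
  apply NNPP; intros N. apply (Hd t Ht). intros [t0 [Ht0 [H1 H2]]]. apply N.
  assert (A1 := Hdl t0 s t ltac:(lra) H1).
  assert (A2 := Hdl t0 s0 t). rewrite Rminus_diag, Rabs_R0 in A2.
  specialize (A2 (cond_pos _) H1).
  replace (g (Cexp (s, t)) - g (Cexp (s0, t)))%C
    with ((g (Cexp (s, t)) - g (Cexp (s0, t0))) + - (g (Cexp (s0, t)) - g (Cexp (s0, t0))))%C by ring.
  eapply Rle_trans; [apply Cmod_triangle|]. rewrite Cmod_opp. lra.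
Qed.

(** The difference quotient of [f] at [z], completed by the derivative [l]. *)
Definition dquot (f : C -> C) (z l w : C) : C :=
  if Ceq_dec w z then l else ((f w - f z) / (w - z))%C.

Lemma dquot_cont f z l : Cderiv f z l -> ccont (dquot f z l) z.
Proof.
  intros H eps Heps.
  assert (He : 0 < eps / 2) by lra.
  destruct (proj1 (Cderiv_eps _ _ _) H (mkposreal _ He)) as [d Hd]; simpl in Hd.
  exists d; split; [apply cond_pos|]; intros w Hw.
  unfold dquot. destruct (Ceq_dec z z) as [_|N]; [|congruence].
  destruct (Ceq_dec w z) as [->|N].
  { replace (l - l)%C with (RtoC 0) by ring. rewrite Cmod_0; exact Heps. }
  assert (N' : (w - z)%C <> 0) by (apply Cminus_eq_contra; exact N).
  replace ((f w - f z) / (w - z) - l)%C with ((f w - f z - l * (w - z)) / (w - z))%C by (field; exact N').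
  rewrite Cmod_div by exact N'.
  apply Rle_lt_trans with (eps / 2); [|lra].
  apply Rle_div_l; [apply Cmod_gt_0; exact N'|]. apply Hd, Hw.
Qed.

Lemma dquot_diff f z l w a : w <> z -> Cderiv f w a -> exists b, Cderiv (dquot f z l) w b.
Proof.
  intros N H.
  assert (N' : (w - z)%C <> 0) by (apply Cminus_eq_contra; exact N).
  eexists.
  apply (Cderiv_ext (fun u => (f u - f z) * / (u - z))%C _ _ _ (Cmod (w - z))).
  - apply Cmod_gt_0; exact N'.
  - intros u Hu. unfold dquot. destruct (Ceq_dec u z) as [->|_]; [|reflexivity].
    exfalso. unfold Cdisc in Hu.
    replace (z - w)%C with (- (w - z))%C in Hu by ring. rewrite Cmod_opp in Hu. lra.
  - apply Cderiv_mult.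
    + apply Cderiv_minus; [exact H|apply Cderiv_const].
    + apply (Cderiv_inv (fun u => u - z)%C); [|exact N'].
      apply Cderiv_minus; [apply Cderiv_id|apply Cderiv_const].
Qed.

Lemma Cdisc_0 r z : Cdisc 0 r z = (Cmod z < r).
Proof. unfold Cdisc. replace (z - 0)%C with z by ring. reflexivity. Qed.

(** As a function of the logarithmic radius, the integral is constant on either side of
    [ln |z|], where the integrand is holomorphic.  It is continuous across [ln |z|] since the
    difference quotient is continuous at [z], and it tends to 0 at minus infinity since the
    integrand vanishes at the centre. *)
Lemma circle_int_dquot f R s1 z l : exp s1 < R -> Cmod z < exp s1 -> holo_disc 0 R f -> Cderiv f z l ->
  circle_int (fun w => dquot f z l w * w)%C s1 = 0.
Proof.
  intros HR Hz Hf Hl.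
  set (g := fun w => (dquot f z l w * w)%C).
  assert (gd : forall w, Cmod w < R -> w <> z -> exists b, Cderiv g w b).
  { intros w Hw N. destruct (Hf w) as [a Ha]; [rewrite Cdisc_0; exact Hw|].
    destruct (dquot_diff f z l w a N Ha) as [b Hb].
    eexists; apply Cderiv_mult; [exact Hb|apply Cderiv_id]. }
  assert (gz : ccont g z).
  { apply ccont_mult; [apply dquot_cont, Hl|exact (Cderiv_cont _ _ _ (Cderiv_id z))]. }
  assert (gc : forall w, Cmod w < R -> ccont g w).
  { intros w Hw. destruct (classic (w = z)) as [->|N]; [exact gz|].
    destruct (gd w Hw N) as [b Hb]; exact (Cderiv_cont _ _ _ Hb). }
  assert (gcc : forall s t, s <= s1 -> ccont g (Cexp (s, t))).
  { intros s t Hs. apply gc. rewrite Cmod_Cexp_pair.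
    destruct Hs as [Hs| ->]; [apply exp_increasing in Hs|]; lra. }
  assert (ann : forall s s', s <= s' <= s1 -> (exp s' < Cmod z \/ Cmod z < exp s) ->
     circle_int g s = circle_int g s').
  { intros s s' Hs Hd. apply circle_int_annulus. intros u t Hu.
    apply between_elim in Hu; [|lra].
    assert (E1 : exp s <= exp u) by (destruct (proj1 Hu) as [h| ->]; [apply exp_increasing in h|]; lra).
    assert (E2 : exp u <= exp s') by (destruct (proj2 Hu) as [h| ->]; [apply exp_increasing in h|]; lra).
    assert (E3 : exp s' <= exp s1) by (destruct (proj2 Hs) as [h| ->]; [apply exp_increasing in h|]; lra).
    apply gd.
    - rewrite Cmod_Cexp_pair. lra.
    - intros E. rewrite <- E, Cmod_Cexp_pair in Hd. lra. }
  (* the factor w makes g vanish at 0, so its integrals over small circles are small *)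
  assert (small : forall eps, 0 < eps -> exists s2, s2 <= s1 /\ forall s, s <= s2 ->
      Cmod (circle_int g s) <= 2 * PI * eps).
  { intros eps Heps.
    assert (R0 : 0 < R) by (generalize (exp_pos s1); lra).
    assert (g0 : g 0 = 0) by (unfold g; ring).
    destruct (gc 0 ltac:(rewrite Cmod_0; exact R0) eps Heps) as [d [Hd H1]].
    exists (Rmin s1 (ln (d / 2))); split; [apply Rmin_l|].
    intros s Hs.
    assert (Hs1 := Rle_trans _ _ _ Hs (Rmin_l _ _)).
    assert (Hs2 := Rle_trans _ _ _ Hs (Rmin_r _ _)).
    apply circle_int_bound; [intros; apply gcc, Hs1|].
    intros w Hw. specialize (H1 w). rewrite g0 in H1.
    replace (w - 0)%C with w in H1 by ring. replace (g w - 0)%C with (g w) in H1 by ring.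
    left; apply H1. rewrite Hw.
    assert (exp s <= d / 2); [|lra].
    rewrite <- (exp_ln (d / 2)) by lra.
    destruct Hs2 as [h| ->]; [apply exp_increasing in h|]; lra. }
  destruct (Ceq_dec z 0) as [Ez|Nz].
  - apply (Czero_small (2 * PI)). intros eps Heps.
    destruct (small eps Heps) as [s2 [Hs2 H2]].
    rewrite <- (ann s2 s1).
    + apply H2; lra.
    + lra.
    + right. rewrite Ez, Cmod_0. apply exp_pos.
  - assert (Pz : 0 < Cmod z) by (apply Cmod_gt_0; exact Nz).
    set (s0 := ln (Cmod z)).
    assert (E0 : exp s0 = Cmod z) by (apply exp_ln; exact Pz).
    assert (L01 : s0 < s1) by (apply exp_lt_inv; lra).
    assert (low : forall s, s < s0 -> circle_int g s = 0).
    { intros s Hs. apply (Czero_small (2 * PI)). intros eps Heps.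
      destruct (small eps Heps) as [s2 [Hs2 H2]].
      rewrite <- (ann (Rmin s s2) s).
      - apply H2, Rmin_r.
      - split; [apply Rmin_l|lra].
      - left. rewrite <- E0. apply exp_increasing; lra. }
    apply (Czero_small (4 * PI)). intros eps Heps.
    destruct (circle_tube g s0 eps Heps) as [d [Hd H1]]; [intros; apply gcc; lra|].
    assert (close : forall s, Rabs (s - s0) < d -> s <= s1 ->
      Cmod (circle_int g s - circle_int g s0) <= 2 * PI * eps).
    { intros s Hs Hs1. unfold circle_int.
      rewrite <- CInt_minus by (apply ex_CInt_circle; intros; apply gcc; lra).
      replace (2 * PI * eps) with (eps * Rabs (2 * PI - 0)).
      2: { rewrite Rminus_0_r, Rabs_pos_eq by (generalize two_PI_pos; lra). ring. }
      apply CInt_bound.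
      - apply ex_CInt_minus; apply ex_CInt_circle; intros; apply gcc; lra.
      - intros t Ht. apply H1; [exact Hs|]. 
        apply between_elim in Ht; [exact Ht|generalize two_PI_pos; lra]. }
    set (e := Rmin (d / 2) (s1 - s0)).
    assert (He : 0 < e) by (apply Rmin_glb_lt; lra).
    assert (He1 : e <= d / 2) by apply Rmin_l.
    assert (He2 : e <= s1 - s0) by apply Rmin_r.
    assert (A1 := close (s0 + e)). assert (A2 := close (s0 - e)).
    rewrite <- (ann (s0 + e) s1).
    2: lra.
    2: { right. rewrite <- E0. apply exp_increasing; lra. }
    rewrite (low (s0 - e)) in A2 by lra.
    replace (s0 + e - s0) with e in A1 by ring.
    replace (s0 - e - s0) with (- e) in A2 by ring.
    rewrite Rabs_Ropp in A2. rewrite Rabs_pos_eq in A1, A2 by lra.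
    replace (0 - circle_int g s0)%C with (- circle_int g s0)%C in A2 by ring. rewrite Cmod_opp in A2.
    replace (circle_int g (s0 + e)) with ((circle_int g (s0 + e) - circle_int g s0) + circle_int g s0)%C by ring.
    eapply Rle_trans; [apply Cmod_triangle|].
    specialize (A1 ltac:(lra) ltac:(lra)). specialize (A2 ltac:(lra) ltac:(lra)). lra.
Qed.

Lemma Cmod_triangle_inv w z : Cmod w - Cmod z <= Cmod (w - z).
Proof.
  assert (H : Cmod w <= Cmod (w - z) + Cmod z); [|lra].
  replace w with ((w - z) + z)%C at 1 by ring. apply Cmod_triangle.
Qed.

(** [w / (w - z) = 1 + z / (w - z)], and the integral of the second term does not depend on
    the radius, by holomorphy outside the circle, and tends to 0 as the radius grows. *)
Lemma circle_int_kernel s1 z : Cmod z < exp s1 -> circle_int (fun w => w / (w - z))%C s1 = RtoC (2 * PI).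
Proof.
  intros Hz.
  set (g := fun w => (z * / (w - z))%C).
  assert (N : forall s t, s1 <= s -> (Cexp (s, t) - z)%C <> 0).
  { intros s t Hs. apply Cmod_gt_0. generalize (Cmod_triangle_inv (Cexp (s, t)) z).
    rewrite Cmod_Cexp_pair. destruct Hs as [h| <-]; [apply exp_increasing in h|]; lra. }
  assert (gd : forall s t, s1 <= s -> exists b, Cderiv g (Cexp (s, t)) b).
  { intros s t Hs. eexists. apply Cderiv_scal.
    apply (Cderiv_inv (fun w => w - z)%C); [|apply N, Hs].
    apply Cderiv_minus; [apply Cderiv_id|apply Cderiv_const]. }
  assert (gc : forall s t, s1 <= s -> ccont g (Cexp (s, t))).
  { intros s t Hs; destruct (gd s t Hs) as [b Hb]; exact (Cderiv_cont _ _ _ Hb). }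
  assert (Z : circle_int g s1 = 0).
  { apply (Czero_small (2 * PI)). intros eps Heps.
    (* a radius k with |z| / (k - |z|) <= eps *)
    set (k := Cmod z * (1 + / eps) + exp s1).
    assert (Hz0 := Cmod_ge_0 z).
    assert (He : 0 < / eps) by (apply Rinv_0_lt_compat, Heps).
    assert (Hk0 : 0 <= Cmod z * (1 + / eps)) by (apply Rmult_le_pos; lra).
    assert (Hk : exp s1 <= k) by (unfold k; lra).
    assert (Pk : 0 < k) by (generalize (exp_pos s1); lra).
    assert (Es : exp (ln k) = k) by (apply exp_ln, Pk).
    assert (Hs : s1 <= ln k).
    { rewrite <- (ln_exp s1). destruct Hk as [h|h]; [|rewrite h; lra]. left; apply ln_increasing; [apply exp_pos|exact h]. }
    rewrite (circle_int_annulus g s1 (ln k)).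
    2: { intros s t Hs'. apply between_elim in Hs'; [|exact Hs]. apply gd; lra. }
    apply circle_int_bound; [intros; apply gc, Hs|].
    intros w Hw. rewrite Es in Hw. unfold g.
    assert (L := Cmod_triangle_inv w z). rewrite Hw in L.
    assert (P : 0 < Cmod (w - z)).
    { unfold k in L. assert (0 <= Cmod z * / eps) by (apply Rmult_le_pos; lra).
      generalize (exp_pos s1); lra. }
    rewrite Cmod_mult, Cmod_inv by (apply Cmod_gt_0; exact P).
    apply Rle_div_l; [exact P|].
    apply Rle_trans with (eps * (k - Cmod z)); [|apply Rmult_le_compat_l; lra].
    unfold k. replace (eps * (Cmod z * (1 + / eps) + exp s1 - Cmod z)) with
      (Cmod z + eps * exp s1) by (field; lra).
    generalize (Rmult_lt_0_compat _ _ Heps (exp_pos s1)); lra. }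
  unfold circle_int. rewrite (CInt_ext _ (fun t => 1 + g (Cexp (s1, t)))%C).
  - rewrite CInt_plus; [|apply ex_CInt_const|apply ex_CInt_circle; intros; apply gc; lra].
    fold (circle_int g s1). rewrite Z, CInt_const. rewrite RtoC_mult. ring.
  - intros t _. unfold g. field. apply N; lra.
Qed.

(** Multiply out the integral of the difference quotient of [f] at [z], which is 0. *)
Lemma cauchy_formula f R s1 z : exp s1 < R -> Cmod z < exp s1 -> holo_disc 0 R f ->
  circle_int (fun w => f w * (w / (w - z)))%C s1 = (RtoC (2 * PI) * f z)%C.
Proof.
  intros HR Hz Hf.
  destruct (Hf z) as [l Hl]; [rewrite Cdisc_0; lra|].
  assert (N : forall w, Cmod w = exp s1 -> (w - z)%C <> 0).
  { intros w Hw. apply Cmod_gt_0. generalize (Cmod_triangle_inv w z). lra. }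
  assert (K : forall w, Cmod w = exp s1 -> ccont (fun w => w / (w - z))%C w).
  { intros w Hw. eapply (Cderiv_cont _ _ _). unfold Cdiv. apply Cderiv_mult; [apply Cderiv_id|].
    apply (Cderiv_inv (fun w => w - z)%C); [|apply N, Hw].
    apply Cderiv_minus; [apply Cderiv_id|apply Cderiv_const]. }
  assert (Fc : forall w, Cmod w = exp s1 -> ccont f w).
  { intros w Hw. destruct (Hf w) as [a Ha]; [rewrite Cdisc_0; lra|]. exact (Cderiv_cont _ _ _ Ha). }
  rewrite <- (circle_int_kernel s1 z Hz).
  assert (Q := circle_int_dquot f R s1 z l HR Hz Hf Hl).
  unfold circle_int in *.
  rewrite (CInt_ext _ (fun t => f (Cexp (s1, t)) * (Cexp (s1, t) / (Cexp (s1, t) - z)) -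
     f z * (Cexp (s1, t) / (Cexp (s1, t) - z)))%C) in Q.
  - rewrite CInt_minus in Q.
    + rewrite CInt_scal in Q.
      * rewrite (Cmult_comm _ (f z)). apply Ceq_minus. rewrite <- Q. reflexivity.
      * apply (ex_CInt_circle (fun w => w / (w - z))%C). intros; apply K, Cmod_Cexp_pair.
    + apply (ex_CInt_circle (fun w => f w * (w / (w - z)))%C).
      intros. apply ccont_mult; [apply Fc|apply K]; apply Cmod_Cexp_pair.
    + apply ex_CInt_scal, (ex_CInt_circle (fun w => w / (w - z))%C). intros; apply K, Cmod_Cexp_pair.
  - intros t _. unfold dquot.
    destruct (Ceq_dec (Cexp (s1, t)) z) as [E|_].
    + exfalso. apply (N (Cexp (s1, t))); [apply Cmod_Cexp_pair|]. rewrite E; ring.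
    + field. apply N, Cmod_Cexp_pair.
Qed.

(** * Derivatives and zeros of holomorphic functions *)

Lemma rcont_bounded m a b : a <= b -> (forall t, a <= t <= b -> rcont m t) ->
  exists B, 0 <= B /\ forall t, a <= t <= b -> Cmod (m t) <= B.
Proof.
  intros Hab H.
  destruct (continuity_ab_maj (fun t => Cmod (m t)) a b Hab) as [x [Hx _]].
  - intros t Ht. apply continuity_pt_filterlim.
    intros P [eps HP]. destruct (H t Ht eps (cond_pos eps)) as [d [Hd H1]].
    exists (mkposreal d Hd); intros u Hu. apply HP.
    change (Rabs (Cmod (m u) - Cmod (m t)) < eps).
    eapply Rle_lt_trans; [|exact (H1 u Hu)].
    apply Rabs_le; split; [|apply Cmod_triangle_inv].
    generalize (Cmod_triangle_inv (m t) (m u)).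
    replace (m t - m u)%C with (- (m u - m t))%C by ring. rewrite Cmod_opp. lra.
  - exists (Cmod (m x)); split; [apply Cmod_ge_0|exact Hx].
Qed.

Definition circ (s t : R) : C := Cexp (s, t).

(** With [p = 1] these integrals represent a holomorphic function, with [p = 2] and [p = 3]
    its first two derivatives, up to constant factors. *)
Definition cauchy_int (s : R) (p : nat) (m : R -> C) (z : C) : C :=
  CInt (fun t => m t * (/ (circ s t - z)) ^ p)%C 0 (2 * PI).

Lemma rcont_circ s t : rcont (circ s) t.
Proof. apply rcont_ver. exact (Cderiv_cont _ _ _ (Cderiv_Cexp _)). Qed.

Lemma circ_minus_bound s z t : exp s - Cmod z <= Cmod (circ s t - z).
Proof. generalize (Cmod_triangle_inv (circ s t) z). unfold circ at 1; rewrite Cmod_Cexp_pair. auto. Qed.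

Lemma circ_minus_neq s z t : Cmod z < exp s -> (circ s t - z)%C <> 0.
Proof. intros H. apply Cmod_gt_0. generalize (circ_minus_bound s z t); lra. Qed.

Lemma ccont_pow f n z : ccont f z -> ccont (fun w => f w ^ n)%C z.
Proof.
  intros H; induction n; simpl; [apply ccont_const|apply ccont_mult; assumption].
Qed.

Lemma ex_CInt_kernel s p m z : (forall t, rcont m t) -> Cmod z < exp s ->
  ex_CInt (fun t => m t * (/ (circ s t - z)) ^ p)%C 0 (2 * PI).
Proof.
  intros Hm Hz. apply rcont_RInt; intros t _. apply rcont_mult; [apply Hm|].
  apply (rcont_comp (fun w => (/ (w - z)) ^ p)%C (circ s) t); [apply rcont_circ|].
  apply ccont_pow. eapply Cderiv_cont.
  apply (Cderiv_inv (fun w => w - z)%C); [|apply circ_minus_neq, Hz].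
  apply Cderiv_minus; [apply Cderiv_id|apply Cderiv_const].
Qed.

(** Differentiation under the integral sign: a quadratic remainder that is uniform in [t]
    survives integration. *)
Lemma CInt_diff (K : C -> R -> C) (K1 : R -> C) z0 M d a b : a <= b -> 0 < d ->
  (forall z, Cmod (z - z0) < d -> ex_CInt (K z) a b) -> ex_CInt K1 a b ->
  (forall z t, Cmod (z - z0) < d -> a <= t <= b ->
     Cmod (K z t - K z0 t - K1 t * (z - z0)) <= M * Cmod (z - z0) ^ 2) ->
  Cderiv (fun z => CInt (K z) a b) z0 (CInt K1 a b).
Proof.
  intros Hab Hd E E1 H. apply Cderiv_eps; intros eps.
  assert (H0 : Cmod (z0 - z0) < d) by (replace (z0 - z0)%C with (RtoC 0) by ring; rewrite Cmod_0; exact Hd).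
  set (L := (Rabs M + 1) * (b - a + 1)).
  assert (PL : 0 < L) by (unfold L; apply Rmult_lt_0_compat; generalize (Rabs_pos M); lra).
  assert (Hdd : 0 < Rmin d (eps / L)).
  { apply Rmin_glb_lt; [exact Hd|apply Rdiv_lt_0_compat; [apply cond_pos|exact PL]]. }
  exists (mkposreal _ Hdd); simpl; intros z Hz.
  assert (Hz1 := Rlt_le_trans _ _ _ Hz (Rmin_l _ _)).
  assert (Hz2 := Rlt_le_trans _ _ _ Hz (Rmin_r _ _)).
  apply Rlt_div_r in Hz2; [|exact PL].
  assert (Ez := E z Hz1). assert (E0 := E z0 H0).
  assert (Es := ex_CInt_scal (z - z0) _ _ _ E1). assert (Ed := ex_CInt_minus _ _ _ _ Ez E0).
  rewrite (Cmult_comm _ (z - z0)), <- (CInt_scal _ _ _ _ E1), <- (CInt_minus _ _ _ _ Ez E0),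
    <- (CInt_minus _ _ _ _ Ed Es).
  assert (Hm := Cmod_ge_0 (z - z0)). set (mz := Cmod (z - z0)) in *.
  apply Rle_trans with ((Rabs M * mz ^ 2) * Rabs (b - a)).
  - apply CInt_bound.
    + apply ex_CInt_minus; assumption.
    + intros t Ht. apply between_elim in Ht; [|exact Hab].
      rewrite (Cmult_comm (z - z0)). eapply Rle_trans; [apply H; assumption|].
      apply Rmult_le_compat_r; [apply pow2_ge_0|apply Rle_abs].
  - rewrite (Rabs_pos_eq (b - a)) by lra.
    apply Rle_trans with (mz * L * mz); [|apply Rmult_le_compat_r; lra].
    replace (Rabs M * mz ^ 2 * (b - a)) with (mz * (Rabs M * (b - a)) * mz) by ring.
    apply Rmult_le_compat_r; [lra|]. apply Rmult_le_compat_l; [lra|].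
    unfold L. generalize (Rabs_pos M); nra.
Qed.

Lemma cauchy_int_diff s p m z : (p = 1 \/ p = 2)%nat -> (forall t, rcont m t) -> Cmod z < exp s ->
  exists l, Cderiv (cauchy_int s p m) z l /\ l = (INR p * cauchy_int s (S p) m z)%C.
Proof.
  intros Hp Hm Hz.
  eexists; split; [|reflexivity].
  unfold cauchy_int at 2.
  rewrite <- CInt_scal by (apply ex_CInt_kernel; assumption).
  destruct (rcont_bounded m 0 (2 * PI)) as [B [B0 HB]]; [generalize two_PI_pos; lra|auto|].
  set (d := (exp s - Cmod z) / 2). assert (Hd : 0 < d) by (unfold d; lra).
  set (q := / d). assert (Hq : 0 < q) by (apply Rinv_0_lt_compat, Hd).
  apply (CInt_diff (fun z t => m t * (/ (circ s t - z)) ^ p)%C _ z (B * (3 * (q ^ 3 + q ^ 4))) d).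
  - generalize two_PI_pos; lra.
  - exact Hd.
  - intros z' Hz'. apply ex_CInt_kernel; [exact Hm|].
    generalize (Cmod_triangle_inv z' z). unfold d in Hz'. lra.
  - apply ex_CInt_scal, ex_CInt_kernel; assumption.
  - intros z' t Hz' Ht.
    assert (Hzz : Cmod z' < exp s) by (generalize (Cmod_triangle_inv z' z); unfold d in Hz'; lra).
    assert (N := circ_minus_neq s z t Hz). assert (N' := circ_minus_neq s z' t Hzz).
    set (u0 := (/ (circ s t - z))%C). set (u := (/ (circ s t - z'))%C).
    assert (Bu0 : Cmod u0 <= q).
    { unfold u0, q. rewrite Cmod_inv by exact N. apply Rinv_le_contravar; [exact Hd|].
      generalize (circ_minus_bound s z t). unfold d in *; lra. }
    assert (Bu : Cmod u <= q).
    { unfold u, q. rewrite Cmod_inv by exact N'. apply Rinv_le_contravar; [exact Hd|].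
      generalize (circ_minus_bound s z' t) (Cmod_triangle_inv z' z). unfold d in *; lra. }
    assert (P0 := Cmod_ge_0 u0). assert (P := Cmod_ge_0 u).
    (* u - u0 = (z' - z) u u0, so the remainder is (z' - z)^2 u u0^2 if p = 1, and this
       times u + 2 u0 if p = 2 *)
    assert (key : Cmod (u ^ p - u0 ^ p - INR p * u0 ^ S p * (z' - z)) <=
       3 * (q ^ 3 + q ^ 4) * Cmod (z' - z) ^ 2).
    { assert (Q3 : 0 < q ^ 3) by (apply pow_lt, Hq). assert (Q4 : 0 < q ^ 4) by (apply pow_lt, Hq).
      assert (D2 := pow2_ge_0 (Cmod (z' - z))).
      assert (M3 : Cmod u * (Cmod u0 * Cmod u0) <= q ^ 3).
      { replace (q ^ 3) with (q * (q * q)) by ring.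
        repeat apply Rmult_le_compat; try assumption. apply Rmult_le_pos; assumption. }
      destruct Hp as [-> | ->].
      - replace (u ^ 1 - u0 ^ 1 - INR 1 * u0 ^ 2 * (z' - z))%C
          with ((u * (u0 * u0)) * ((z' - z) * (z' - z)))%C.
        2: { unfold u, u0. simpl. field. split; assumption. }
        rewrite !Cmod_mult.
        replace (Cmod (z' - z) * Cmod (z' - z)) with (Cmod (z' - z) ^ 2) by ring.
        apply Rmult_le_compat_r; [exact D2|lra].
      - replace (u ^ 2 - u0 ^ 2 - INR 2 * u0 ^ 3 * (z' - z))%C
          with (((u * (u0 * u0)) * (u + 2 * u0)) * ((z' - z) * (z' - z)))%C.
        2: { unfold u, u0. simpl INR. replace (RtoC (1 + 1)) with (RtoC 2) by (f_equal; ring).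
             simpl. field. split; assumption. }
        rewrite !Cmod_mult.
        replace (Cmod (z' - z) * Cmod (z' - z)) with (Cmod (z' - z) ^ 2) by ring.
        apply Rmult_le_compat_r; [exact D2|].
        assert (B3 : Cmod (u + 2 * u0) <= 3 * q).
        { eapply Rle_trans; [apply Cmod_triangle|]. rewrite Cmod_mult, Cmod_R, Rabs_pos_eq by lra. lra. }
        apply Rle_trans with (q ^ 3 * (3 * q)).
        + apply Rmult_le_compat; [|apply Cmod_ge_0|assumption|assumption].
          repeat apply Rmult_le_pos; assumption.
        + replace (q ^ 3 * (3 * q)) with (3 * q ^ 4) by ring. lra. }
    replace (m t * u ^ p - m t * u0 ^ p - INR p * (m t * u0 ^ S p) * (z' - z))%C
      with (m t * (u ^ p - u0 ^ p - INR p * u0 ^ S p * (z' - z)))%C by ring.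
    rewrite Cmod_mult, Rmult_assoc.
    apply Rmult_le_compat; [apply Cmod_ge_0|apply Cmod_ge_0|apply HB, Ht|exact key].
Qed.

Lemma cauchy_formula_int f R s z : exp s < R -> Cmod z < exp s -> holo_disc 0 R f ->
  f z = (/ RtoC (2 * PI) * cauchy_int s 1 (fun t => f (circ s t) * circ s t) z)%C.
Proof.
  intros HR Hz Hf.
  assert (P := two_PI_pos).
  assert (N : RtoC (2 * PI) <> 0) by (intros E; apply RtoC_inj in E; lra).
  replace (cauchy_int s 1 (fun t => f (circ s t) * circ s t)%C z)
    with (circle_int (fun w => f w * (w / (w - z)))%C s).
  - rewrite (cauchy_formula f R s z HR Hz Hf). field. exact N.
  - apply CInt_ext; intros t _. fold (circ s t). simpl. unfold Cdiv. ring.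
Qed.

Lemma holo_disc_cont f c R z : holo_disc c R f -> Cdisc c R z -> ccont f z.
Proof. intros Hf Hz; destruct (Hf z Hz) as [l Hl]; exact (Cderiv_cont _ _ _ Hl). Qed.

Lemma rcont_weight f R s : exp s < R -> holo_disc 0 R f -> forall t, rcont (fun t => f (circ s t) * circ s t)%C t.
Proof.
  intros HR Hf t. apply rcont_mult; [|apply rcont_circ].
  apply rcont_comp; [apply rcont_circ|]. apply (holo_disc_cont f 0 R); [exact Hf|].
  rewrite Cdisc_0. unfold circ; rewrite Cmod_Cexp_pair. exact HR.
Qed.

(** By Cauchy's formula [f'] is a Cauchy integral with exponent 2, and such integrals are
    differentiable. *)
Lemma derivative_holo_disc_0 R f f' : (forall z, Cdisc 0 R z -> Cderiv f z (f' z)) -> holo_disc 0 R f'.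
Proof.
  intros H z Hz.
  assert (Hf : holo_disc 0 R f) by (intros w Hw; exists (f' w); apply H, Hw).
  rewrite Cdisc_0 in Hz.
  set (r := (Cmod z + R) / 2). assert (Hr : Cmod z < r < R) by (unfold r; lra).
  assert (Pr : 0 < r) by (generalize (Cmod_ge_0 z); lra).
  set (s := ln r). assert (Es : exp s = r) by (apply exp_ln, Pr).
  set (m := fun t => (f (circ s t) * circ s t)%C).
  assert (Hm : forall t, rcont m t) by (apply (rcont_weight f R); [lra|exact Hf]).
  assert (E : forall w, Cmod w < r -> f' w = (/ RtoC (2 * PI) * cauchy_int s 2 m w)%C).
  { intros w Hw. apply (Cderiv_unique f w); [apply H; rewrite Cdisc_0; lra|].
    apply (Cderiv_ext (fun w => / RtoC (2 * PI) * cauchy_int s 1 m w)%C _ _ _ (r - Cmod w)); [lra| |].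
    - intros v Hv. symmetry. apply (cauchy_formula_int f R); [lra| |exact Hf].
      unfold Cdisc in Hv. generalize (Cmod_triangle_inv v w); lra.
    - apply Cderiv_scal. destruct (cauchy_int_diff s 1 m w) as [l [Hl El]]; [auto|exact Hm|lra|].
      eapply Cderiv_eq; [|exact Hl]. rewrite El. simpl. ring. }
  destruct (cauchy_int_diff s 2 m z) as [l [Hl _]]; [auto|exact Hm|lra|].
  eexists. apply (Cderiv_ext (fun w => / RtoC (2 * PI) * cauchy_int s 2 m w)%C _ _ _ (r - Cmod z)); [lra| |].
  - intros v Hv. symmetry. apply E. 
    unfold Cdisc in Hv. generalize (Cmod_triangle_inv v z); lra.
  - apply Cderiv_scal, Hl.
Qed.

Lemma Cderiv_shift f c z l : Cderiv f (c + z)%C l -> Cderiv (fun w => f (c + w)%C) z l.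
Proof.
  intros H. eapply Cderiv_eq; [|apply (Cderiv_comp f (fun w => c + w)%C); [exact H|]].
  2: { apply Cderiv_plus; [apply Cderiv_const|apply Cderiv_id]. }
  ring.
Qed.

Lemma Cdisc_shift c r z : Cdisc c r (c + z)%C = Cdisc 0 r z.
Proof. unfold Cdisc. replace (c + z - c)%C with (z - 0)%C by ring. reflexivity. Qed.

Lemma Cderiv_unshift f c z l : Cderiv (fun w => f (c + w)%C) (z - c)%C l -> Cderiv f z l.
Proof.
  intros H. apply (Cderiv_ext (fun w => f (c + (w - c)))%C _ _ _ 1); [lra| |].
  - intros w _. f_equal. ring.
  - eapply Cderiv_eq; [|apply (Cderiv_comp (fun w => f (c + w)%C) (fun w => w - c)%C); [exact H|]].
    2: { apply Cderiv_minus; [apply Cderiv_id|apply Cderiv_const]. }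
    ring.
Qed.

Lemma derivative_holo_disc c R f f' : (forall z, Cdisc c R z -> Cderiv f z (f' z)) -> holo_disc c R f'.
Proof.
  intros H z Hz.
  assert (H0 : holo_disc 0 R (fun w => f' (c + w)%C)).
  { apply (derivative_holo_disc_0 R (fun w => f (c + w)%C)). intros w Hw. apply Cderiv_shift, H; rewrite Cdisc_shift; exact Hw. }
  destruct (H0 (z - c)%C) as [l Hl].
  - rewrite <- (Cdisc_shift c). replace (c + (z - c))%C with z by ring. exact Hz.
  - exists l. apply (Cderiv_unshift _ c), Hl.
Qed.

Lemma least_nat (P : nat -> Prop) : (forall n, ~ P n) \/ exists n, P n /\ forall k, (k < n)%nat -> ~ P k.
Proof.
  destruct (classic (exists n, P n)) as [[n Hn]|N].
  - right. revert Hn. induction n as [n IH] using (well_founded_induction Wf_nat.lt_wf); intros Hn.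
    destruct (classic (exists k, (k < n)%nat /\ P k)) as [[k [Hk Pk]]|M].
    + exact (IH k Hk Pk).
    + exists n; split; [exact Hn|]. intros k Hk Pk; apply M; exists k; auto.
  - left; intros n Hn; apply N; exists n; exact Hn.
Qed.

(** The identity [1 / (w - z) = 1 / w + (z / w) / (w - z)] splits a Cauchy integral into its
    value at 0 and [z] times another Cauchy integral.  Iterating, as long as these values
    vanish, [f z = z ^ n G n z] where [G n] is a Cauchy integral.  If they all vanish, the
    right-hand side is of order [(|z| / r) ^ n] and [f] is 0; otherwise the first nonzero one
    is the value at 0 of the cofactor. *)
Lemma zero_order_0 R f : 0 < R -> holo_disc 0 R f -> exists r, 0 < r <= R /\
  ((forall z, Cdisc 0 r z -> f z = 0) \/
   exists n g, holo_disc 0 r g /\ g 0 <> 0 /\ forall z, Cdisc 0 r z -> f z = (z ^ n * g z)%C).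
Proof.
  intros HR Hf.
  set (r := R / 2). assert (Hr : 0 < r < R) by (unfold r; lra).
  set (s := ln r). assert (Es : exp s = r) by (apply exp_ln; lra).
  assert (P := two_PI_pos).
  assert (NP : RtoC (2 * PI) <> 0) by (intros E; apply RtoC_inj in E; lra).
  assert (cn : forall t, circ s t <> 0).
  { intros t. unfold circ. apply Cexp_neq_0. }
  set (m := fun n t => (f (circ s t) * circ s t * (/ circ s t) ^ n)%C).
  assert (Hm : forall n t, rcont (m n) t).
  { intros n t. apply rcont_mult; [apply (rcont_weight f R); [lra|exact Hf]|].
    apply (rcont_comp (fun w => (/ w) ^ n)%C (circ s)); [apply rcont_circ|].
    apply ccont_pow. eapply Cderiv_cont, Cderiv_inv_id, cn. }
  set (G := fun n z => (/ RtoC (2 * PI) * cauchy_int s 1 (m n) z)%C).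
  assert (G0 : forall z, Cmod z < r -> f z = G O z).
  { intros z Hz. rewrite (cauchy_formula_int f R s z) by (lra || exact Hf).
    unfold G. f_equal. apply CInt_ext; intros t _. unfold m. simpl. ring. }
  assert (GS : forall n z, Cmod z < r -> G n z = (G n 0 + z * G (S n) z)%C).
  { intros n z Hz.
    assert (E : cauchy_int s 1 (m n) z = (cauchy_int s 1 (m n) 0 + z * cauchy_int s 1 (m (S n)) z)%C).
    { unfold cauchy_int.
      assert (M0 : Cmod 0 < exp s) by (rewrite Cmod_0; lra).
      rewrite <- CInt_scal by (apply ex_CInt_kernel; [apply Hm|lra]).
      rewrite <- CInt_plus; [|apply ex_CInt_kernel; [apply Hm|lra]|apply ex_CInt_scal, ex_CInt_kernel; [apply Hm|lra]].
      apply CInt_ext; intros t _. unfold m.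
      assert (N1 := circ_minus_neq s z t ltac:(lra)). assert (N2 := cn t).
      rewrite Cpow_S. simpl. field. repeat split; assumption. }
    unfold G. rewrite E. ring. }
  assert (Gh : forall n, holo_disc 0 r (G n)).
  { intros n z Hz. rewrite Cdisc_0 in Hz.
    destruct (cauchy_int_diff s 1 (m n) z) as [l [Hl _]]; [auto|apply Hm|lra|].
    eexists; apply Cderiv_scal, Hl. }
  assert (fac : forall n, (forall k, (k < n)%nat -> G k 0 = 0) ->
     forall z, Cmod z < r -> f z = (z ^ n * G n z)%C).
  { induction n as [|n IH]; intros Hk z Hz.
    - rewrite (G0 z Hz). simpl. ring.
    - rewrite IH by (auto; intros; apply Hk; lia).
      rewrite (GS n z Hz), Hk by lia. rewrite Cpow_S. ring. }
  destruct (least_nat (fun n => G n 0 <> 0)) as [Z|[n [Hn Hk]]].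
  - exists (r / 2); split; [unfold r; lra|]. left. intros z Hz. rewrite Cdisc_0 in Hz.
    destruct (rcont_bounded (fun t => f (circ s t) * circ s t)%C 0 (2 * PI)) as [B [B0 HB]];
      [lra|intros; apply (rcont_weight f R); [lra|exact Hf]|].
    assert (bound : forall n, Cmod (f z) <= (/ 2) ^ n * (B * (2 / r))).
    { intros n. rewrite (fac n) by (lra || (intros k _; apply NNPP, Z)).
      unfold G. rewrite !Cmod_mult, Cmod_pow, Cmod_inv, Cmod_R, (Rabs_pos_eq (2 * PI)) by (lra || exact NP).
      assert (K : Cmod (cauchy_int s 1 (m n) z) <= (B * (/ r) ^ n * (2 / r)) * Rabs (2 * PI - 0)).
      { apply CInt_bound; [apply ex_CInt_kernel; [apply Hm|lra]|].
        intros t Ht. apply between_elim in Ht; [|lra].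
        assert (C1 := circ_minus_bound s z t).
        unfold m. rewrite !(Cmod_mult _ (_ ^ _)), !Cmod_pow.
        rewrite (Cmod_inv (circ s t - z)) by (apply circ_minus_neq; lra).
        rewrite (Cmod_inv (circ s t)) by apply cn.
        replace (Cmod (circ s t)) with r by (unfold circ; rewrite Cmod_Cexp_pair; auto).
        rewrite pow_1.
        assert (Ir : 0 < / r) by (apply Rinv_0_lt_compat; lra).
        apply Rmult_le_compat.
        - apply Rmult_le_pos; [apply Cmod_ge_0|apply pow_le; lra].
        - left; apply Rinv_0_lt_compat; lra.
        - apply Rmult_le_compat_r; [apply pow_le; lra|apply HB, Ht].
        - replace (2 / r) with (/ (r / 2)) by (field; lra).
          apply Rinv_le_contravar; lra. }
      rewrite Rminus_0_r, Rabs_pos_eq in K by lra.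
      apply Rle_trans with (Cmod z ^ n * (/ (2 * PI) * (B * (/ r) ^ n * (2 / r) * (2 * PI)))).
      - apply Rmult_le_compat_l; [apply pow_le, Cmod_ge_0|].
        apply Rmult_le_compat_l; [left; apply Rinv_0_lt_compat, P|exact K].
      - replace (Cmod z ^ n * (/ (2 * PI) * (B * (/ r) ^ n * (2 / r) * (2 * PI))))
          with ((Cmod z * / r) ^ n * (B * (2 / r))) by (rewrite Rpow_mult_distr; field; lra).
        apply Rmult_le_compat_r.
        + apply Rmult_le_pos; [exact B0|]. left; apply Rdiv_lt_0_compat; lra.
        + apply pow_incr; split.
          * apply Rmult_le_pos; [apply Cmod_ge_0|left; apply Rinv_0_lt_compat; lra].
          * apply Rle_div_l; lra. }
    apply Cmod_eq_0, Rle_antisym; [|apply Cmod_ge_0].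
    assert (L : is_lim_seq (fun n => (/ 2) ^ n * (B * (2 / r))) 0).
    { replace (Finite 0) with (Rbar_mult 0 (B * (2 / r))) by (simpl; f_equal; ring).
      apply is_lim_seq_scal_r, is_lim_seq_geom. rewrite Rabs_pos_eq; lra. }
    exact (is_lim_seq_le _ _ _ _ bound (is_lim_seq_const _) L).
  - exists r; split; [lra|]. right. exists n, (G n). split; [apply Gh|split; [exact Hn|]].
    intros z Hz. rewrite Cdisc_0 in Hz. apply fac; [|exact Hz].
    intros k Hlt. apply NNPP, Hk, Hlt.
Qed.

Lemma zero_order c R f : 0 < R -> holo_disc c R f -> exists r, 0 < r <= R /\
  ((forall z, Cdisc c r z -> f z = 0) \/
   exists n g, holo_disc c r g /\ g c <> 0 /\ forall z, Cdisc c r z -> f z = ((z - c) ^ n * g z)%C).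
Proof.
  intros HR Hf.
  destruct (zero_order_0 R (fun w => f (c + w)%C) HR) as [r [Hr H]].
  { intros w Hw. destruct (Hf (c + w)%C) as [l Hl]; [rewrite Cdisc_shift; exact Hw|].
    exists l; apply Cderiv_shift, Hl. }
  assert (S : forall z, Cdisc c r z -> Cdisc 0 r (z - c)%C).
  { intros z Hz. rewrite <- (Cdisc_shift c). replace (c + (z - c))%C with z by ring. exact Hz. }
  assert (T : forall z, f z = f (c + (z - c))%C) by (intros; f_equal; ring).
  exists r; split; [exact Hr|]. destruct H as [Z|[n [g [G1 [G2 G3]]]]].
  - left; intros z Hz. rewrite T. apply Z, S, Hz.
  - right; exists n, (fun z => g (z - c)%C). split; [|split].
    + intros z Hz. destruct (G1 _ (S z Hz)) as [l Hl]. exists l.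
      apply (Cderiv_unshift _ c).
      apply (Cderiv_ext g _ _ _ 1); [lra| |exact Hl].
      intros w _; f_equal; ring.
    + replace (c - c)%C with (RtoC 0) by ring. exact G2.
    + intros z Hz. rewrite T. apply G3, S, Hz.
Qed.

(** * Connectedness and the identity principle *)

(** The supremum of the points up to which [P] keeps its value cannot lie before the end of
    the interval.  Equality of analytic functions is propagated with this lemma. *)
Lemma interval_connected (E P : R -> Prop) : is_interval E ->
  (forall x, E x -> exists d, 0 < d /\ forall y, E y -> Rabs (y - x) < d -> (P y <-> P x)) ->
  forall x y, E x -> E y -> P x -> P y.
Proof.
  intros HE H.
  assert (main : forall x y, E x -> E y -> x <= y -> (P x <-> P y)).
  { intros x y Hx Hy Hxy.
    set (S := fun t => x <= t <= y /\ forall u, x <= u <= t -> (P u <-> P x)).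
    assert (Sx : S x).
    { split; [lra|]. intros u Hu. replace u with x by lra. tauto. }
    destruct (completeness S) as [m [M1 M2]].
    - exists y. intros t [Ht _]; lra.
    - exists x; exact Sx.
    - assert (Hm : x <= m <= y).
      { split; [apply M1, Sx|]. apply M2. intros t [Ht _]; lra. }
      destruct (H m) as [d [Hd Hmd]]; [apply (HE x m y); auto|].
      assert (near : exists t, S t /\ m - d < t).
      { apply NNPP; intros N. assert (m <= m - d); [|lra].
        apply M2. intros t St. apply Rnot_lt_le; intros Hlt. apply N; exists t; auto. }
      destruct near as [t [[Ht1 Ht2] Ht3]].
      assert (Htm : t <= m) by (apply M1; split; assumption).
      assert (all : forall u, x <= u <= y -> u < m + d -> (P u <-> P x)).
      { intros u Hu Hud. destruct (Rle_dec u t) as [L|L]; [apply Ht2; lra|].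
        assert (Eu : E u) by (apply (HE x u y); auto).
        assert (Et : E t) by (apply (HE x t y); auto).
        assert (A1 := Hmd u Eu ltac:(apply Rabs_lt_between; lra)).
        assert (A2 := Hmd t Et ltac:(apply Rabs_lt_between; lra)).
        assert (A3 := Ht2 t ltac:(lra)). tauto. }
      assert (my : m = y).
      { apply NNPP; intros N. set (v := Rmin y (m + d / 2)).
        assert (V1 : v <= y) by apply Rmin_l. assert (V2 : v <= m + d / 2) by apply Rmin_r.
        assert (V3 : m < v) by (apply Rmin_glb_lt; lra).
        assert (v <= m); [|lra]. apply M1. split; [lra|].
        intros u Hu; apply all; lra. }
      assert (A := all y ltac:(lra) ltac:(lra)). tauto. }
  intros x y Hx Hy HP. destruct (Rle_dec x y) as [L|L].
  - apply (main x y); auto.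
  - apply (main y x); auto; lra.
Qed.

Lemma Cdisc_center c r : 0 < r -> Cdisc c r c.
Proof. intros H; unfold Cdisc. replace (c - c)%C with (RtoC 0) by ring. rewrite Cmod_0; exact H. Qed.

Lemma Cdisc_mono c r r' z : r <= r' -> Cdisc c r z -> Cdisc c r' z.
Proof. unfold Cdisc; intros; lra. Qed.

Lemma Cdisc_sub c r z w : Cdisc c r z -> Cdisc z (r - Cmod (z - c)) w -> Cdisc c r w.
Proof.
  unfold Cdisc; intros Hz Hw. replace (w - c)%C with ((w - z) + (z - c))%C by ring.
  eapply Rle_lt_trans; [apply Cmod_triangle|]. lra.
Qed.

Lemma holo_disc_mono c r r' f : r <= r' -> holo_disc c r' f -> holo_disc c r f.
Proof. intros H Hf z Hz; apply Hf. exact (Cdisc_mono _ _ _ _ H Hz). Qed.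

Lemma ccont_neq_0 g c : ccont g c -> g c <> 0 -> exists d, 0 < d /\ forall z, Cdisc c d z -> g z <> 0.
Proof.
  intros H N. destruct (H (Cmod (g c)) (proj1 (Cmod_gt_0 _) N)) as [d [Hd H1]].
  exists d; split; [exact Hd|]. intros z Hz E. specialize (H1 z Hz). rewrite E in H1.
  replace (0 - g c)%C with (- g c)%C in H1 by ring. rewrite Cmod_opp in H1. lra.
Qed.

Lemma isolated_zeros c R f : 0 < R -> holo_disc c R f -> exists r, 0 < r <= R /\
  ((forall z, Cdisc c r z -> f z = 0) \/ (forall z, Cdisc c r z -> z <> c -> f z <> 0)).
Proof.
  intros HR Hf. destruct (zero_order c R f HR Hf) as [r [Hr [Z|[n [g [G1 [G2 G3]]]]]]].
  - exists r; auto.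
  - destruct (ccont_neq_0 g c) as [d [Hd Hg]]; [|exact G2|].
    { apply (holo_disc_cont g c r); [exact G1|apply Cdisc_center; lra]. }
    exists (Rmin r d); split.
    + split; [apply Rmin_glb_lt; lra|]. eapply Rle_trans; [apply Rmin_l|lra].
    + right. intros z Hz Nz. rewrite G3 by (eapply Cdisc_mono; [apply Rmin_l|exact Hz]).
      apply Cmult_neq_0.
      * apply Cpow_nz, Cminus_eq_contra, Nz.
      * apply Hg. eapply Cdisc_mono; [apply Rmin_r|exact Hz].
Qed.

(** Vanishing near a point of the segment is a locally constant property of that point,
    because zeros are isolated or fill a neighbourhood. *)
Lemma identity_segment f p q :
  (forall t, 0 <= t <= 1 -> exists r, 0 < r /\ holo_disc (p + RtoC t * (q - p))%C r f) ->
  (exists r, 0 < r /\ forall z, Cdisc p r z -> f z = 0) -> f q = 0.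
Proof.
  intros H [r0 [Hr0 H0]].
  destruct (Ceq_dec q p) as [->|Npq]; [apply H0, Cdisc_center, Hr0|].
  assert (Nz : (q - p)%C <> 0) by (apply Cminus_eq_contra, Npq).
  assert (Pm := proj1 (Cmod_gt_0 _) Nz).
  set (pt := fun t : R => (p + RtoC t * (q - p))%C).
  assert (Dpt : forall t u, Cmod (pt u - pt t) = Rabs (u - t) * Cmod (q - p)).
  { intros t u. unfold pt. replace (p + u * (q - p) - (p + t * (q - p)))%C with (RtoC (u - t) * (q - p))%C
      by (rewrite RtoC_minus; ring). rewrite Cmod_mult, Cmod_R. reflexivity. }
  assert (conn := interval_connected (fun t => 0 <= t <= 1)
    (fun t => exists r, 0 < r /\ forall z, Cdisc (pt t) r z -> f z = 0)).
  cbv beta in conn.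
  destruct (conn ltac:(intros x y z; lra)) with (x := 0) (y := 1) as [r [Hr Hf]]; try lra.
  - intros t Ht. destruct (H t Ht) as [r [Hr Hf]].
    destruct (isolated_zeros _ _ _ Hr Hf) as [r' [Hr' D]]. fold (pt t) in D.
    exists (r' / Cmod (q - p)); split; [apply Rdiv_lt_0_compat; lra|].
    intros u Hu Hut. apply Rlt_div_r in Hut; [|exact Pm]. rewrite <- Dpt in Hut.
    destruct D as [Z|N].
    + split; intros _; [exists r'; split; [lra|exact Z]|].
      exists (r' - Cmod (pt u - pt t)). split; [lra|].
      intros z Hz. apply Z. exact (Cdisc_sub _ _ _ _ Hut Hz).
    + destruct (Req_dec u t) as [->|Nut]; [tauto|].
      assert (Npt : pt u <> pt t).
      { intros E. apply Nut. 
        assert (E2 : Cmod (pt u - pt t) = 0) by (rewrite E; replace (pt t - pt t)%C with (RtoC 0) by ring; apply Cmod_0).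
        rewrite Dpt in E2. apply Rmult_integral in E2. destruct E2 as [E2|E2]; [|lra].
        apply Rabs_eq_0 in E2; lra. }
      split; intros [r2 [Hr2 Z]]; exfalso.
      * apply (N (pt u) Hut Npt), Z, Cdisc_center, Hr2.
      * set (v := t + Rmin (r2 / 2) (r' / 2) / Cmod (q - p)).
        assert (Pmin : 0 < Rmin (r2 / 2) (r' / 2)) by (apply Rmin_glb_lt; lra).
        assert (Dv : Cmod (pt v - pt t) = Rmin (r2 / 2) (r' / 2)).
        { rewrite Dpt. unfold v. rewrite Rplus_minus_l, Rabs_pos_eq.
          - field; lra.
          - left; apply Rdiv_lt_0_compat; lra. }
        apply (N (pt v)).
        -- unfold Cdisc; rewrite Dv. generalize (Rmin_r (r2 / 2) (r' / 2)); lra.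
        -- intros E. rewrite E in Dv. replace (pt t - pt t)%C with (RtoC 0) in Dv by ring. rewrite Cmod_0 in Dv; lra.
        -- apply Z. unfold Cdisc; rewrite Dv. generalize (Rmin_l (r2 / 2) (r' / 2)); lra.
  - exists r0; split; [exact Hr0|]. unfold pt. replace (p + 0 * (q - p))%C with p by ring. exact H0.
  - apply Hf. unfold pt. replace (p + 1 * (q - p))%C with q by ring. apply Cdisc_center, Hr.
Qed.

(** * Logarithms and local inverses *)

Lemma holo_disc_derivative c r f : holo_disc c r f -> exists f', forall z, Cdisc c r z -> Cderiv f z (f' z).
Proof.
  intros Hf. exists (C_derive f). intros z Hz. destruct (Hf z Hz) as [l Hl].
  rewrite (is_C_derive_unique f z l Hl). exact Hl.
Qed.

(** [L] is the primitive of [g' / g] that vanishes at [c]; then [g exp (- L)] has derivative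
    0, so it is constant. *)
Lemma holo_log c R g : 0 < R -> holo_disc c R g -> (forall z, Cdisc c R z -> g z <> 0) ->
  exists L, holo_disc c R L /\ L c = 0 /\ forall z, Cdisc c R z -> g z = (g c * Cexp (L z))%C.
Proof.
  intros HR Hg Nz.
  destruct (holo_disc_derivative c R g Hg) as [g' Hg'].
  assert (Hg'' := derivative_holo_disc c R g g' Hg').
  destruct (primitive c R (fun z => g' z * / g z)%C) as [L0 HL0].
  { intros z Hz. destruct (Hg'' z Hz) as [l Hl].
    eexists; apply Cderiv_mult; [exact Hl|apply Cderiv_inv; [apply Hg', Hz|apply Nz, Hz]]. }
  set (L := fun z => (L0 z - L0 c)%C).
  assert (HL : forall z, Cdisc c R z -> Cderiv L z (g' z * / g z)%C).
  { intros z Hz. eapply Cderiv_eq; [|apply Cderiv_minus; [apply HL0, Hz|apply Cderiv_const]]. ring. }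
  assert (Lc : L c = 0) by (unfold L; ring).
  exists L; split; [intros z Hz; eexists; apply HL, Hz|split; [exact Lc|]].
  intros z Hz.
  assert (K : forall w, Cdisc c R w -> Cderiv (fun w => g w * / Cexp (L w))%C w 0).
  { intros w Hw. eapply Cderiv_eq; [|apply Cderiv_mult; [apply Hg', Hw|]].
    2: { apply Cderiv_inv; [|apply Cexp_neq_0]. apply Cderiv_comp; [apply Cderiv_Cexp|apply HL, Hw]. }
    cbv beta. field. split; [apply Nz, Hw|apply Cexp_neq_0]. }
  assert (E := Cdisc_const c R _ K z c Hz (Cdisc_center c R HR)).
  cbv beta in E. rewrite Lc, Cexp_0 in E.
  replace (g z) with (g z * / Cexp (L z) * Cexp (L z))%C by (field; apply Cexp_neq_0).
  rewrite E. field.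
Qed.

Lemma Ccauchy_limit (x : nat -> C) (k : R) :
  (forall n, Cmod (x (S n) - x n) <= k * (/ 2) ^ n) ->
  exists l, forall eps, 0 < eps -> exists N, forall n, (N <= n)%nat -> Cmod (x n - l) < eps.
Proof.
  intros H.
  set (a := fun n => (x (S n) - x n)%C).
  assert (Ex : ex_series (K := R_AbsRing) (V := C_R_NormedModule) a).
  { apply (ex_series_le (K := R_AbsRing) (V := C_R_CompleteNormedModule) a (fun n => k * (/ 2) ^ n)).
    - intros n. eapply Rle_trans; [|apply H]. right. symmetry. exact (Cmod_norm (a n)).
    - apply (ex_series_scal_l (K := R_AbsRing) (V := R_NormedModule) k (pow (/ 2))), ex_series_geom.
      rewrite Rabs_pos_eq; lra. }
  destruct Ex as [l Hl].
  assert (Sn : forall n, sum_n (G := C_R_NormedModule) a n = (x (S n) - x O)%C).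
  { induction n as [|n IH].
    - rewrite sum_O. reflexivity.
    - rewrite sum_Sn, IH. unfold a. change ((x (S n) - x O) + (x (S (S n)) - x (S n)) = x (S (S n)) - x O)%C. ring. }
  exists (x O + l)%C. intros eps Heps.
  assert (He : 0 < eps / sqrt 2) by (apply Rdiv_lt_0_compat; [exact Heps|apply sqrt_lt_R0; lra]).
  destruct (Hl (ball (M := C_UniformSpace) l (mkposreal _ He))) as [N HN].
  { exists (mkposreal _ He); intros y Hy; exact Hy. }
  exists (S N). intros n Hn. destruct n as [|n]; [lia|].
  specialize (HN n ltac:(lia)). rewrite Sn in HN.
  generalize (C_NormedModule_mixin_compat2 _ _ _ HN); simpl.
  replace (sqrt 2 * (eps / sqrt 2)) with eps by (field; apply Rgt_not_eq, sqrt_lt_R0; lra).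
  replace (x (S n) - (x O + l))%C with ((x (S n) - x O) - l)%C by ring. intro h; exact h.
Qed.

Lemma Cmod_limit_le (x : nat -> C) l c r :
  (forall eps, 0 < eps -> exists N, forall n, (N <= n)%nat -> Cmod (x n - l) < eps) ->
  (forall n, Cmod (x n - c) <= r) -> Cmod (l - c) <= r.
Proof.
  intros H Hr. apply le_epsilon; intros eps Heps.
  destruct (H eps Heps) as [N HN]. specialize (HN N (le_n N)). specialize (Hr N).
  replace (l - c)%C with ((x N - c) + - (x N - l))%C by ring.
  eapply Rle_trans; [apply Cmod_triangle|]. rewrite Cmod_opp. lra.
Qed.

(** Where [f'] is close to [f' c], the map [f] differs from a linear one by a function with
    Lipschitz constant [|f' c| / 2].  So [f] is expanding, hence injective with a
    differentiable inverse, and Newton's iteration with the fixed slope [f' c] is a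
    contraction, which yields preimages. *)
Lemma local_inverse c R f f' : 0 < R -> (forall z, Cdisc c R z -> Cderiv f z (f' z)) ->
  f' c <> 0 -> exists r rho T, 0 < r <= R /\ 0 < rho /\
  (forall z w, Cdisc c r z -> Cdisc c r w -> f z = f w -> z = w) /\
  (forall z, Cdisc c r z -> f' z <> 0) /\
  forall w, Cdisc (f c) rho w -> Cdisc c r (T w) /\ f (T w) = w /\ Cderiv T w (/ f' (T w))%C.
Proof.
  intros HR Hf Na.
  set (a := f' c) in *. assert (Pa := proj1 (Cmod_gt_0 a) Na).
  assert (Hc : ccont f' c).
  { apply (holo_disc_cont f' c R); [exact (derivative_holo_disc c R f f' Hf)|apply Cdisc_center, HR]. }
  destruct (Hc (Cmod a / 4)) as [d [Hd H1]]; [lra|]. fold a in H1.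
  set (r := Rmin R d).
  assert (Hr : 0 < r <= R) by (split; [apply Rmin_glb_lt; lra|apply Rmin_l]).
  assert (f1 : forall z, Cdisc c r z -> Cmod (f' z - a) < Cmod a / 4).
  { intros z Hz; apply H1. exact (Cdisc_mono _ _ _ _ (Rmin_r _ _) Hz). }
  assert (f2 : forall z, Cdisc c r z -> Cderiv f z (f' z)).
  { intros z Hz; apply Hf. exact (Cdisc_mono _ _ _ _ (Rmin_l _ _) Hz). }
  assert (mv : forall p q, Cdisc c r p -> Cdisc c r q ->
    Cmod (f q - f p - a * (q - p)) <= / 2 * Cmod a * Cmod (q - p)).
  { intros p q Hp Hq. replace (/ 2 * Cmod a) with (2 * (Cmod a / 4)) by field.
    apply (mean_value_segment f (fun t => f' (p + RtoC t * (q - p))%C)).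
    intros t Ht. assert (D := Cdisc_convex c r p q t Hp Hq Ht).
    split; [apply f2, D|left; apply f1, D]. }
  assert (lip : forall p q, Cdisc c r p -> Cdisc c r q ->
    / 2 * Cmod a * Cmod (q - p) <= Cmod (f q - f p)).
  { intros p q Hp Hq. assert (M := mv p q Hp Hq).
    assert (Cmod (a * (q - p)) <= Cmod (f q - f p) + Cmod (f q - f p - a * (q - p))).
    { replace (a * (q - p))%C with ((f q - f p) + - (f q - f p - a * (q - p)))%C at 1 by ring.
      eapply Rle_trans; [apply Cmod_triangle|]. rewrite Cmod_opp. lra. }
    rewrite Cmod_mult in H. lra. }
  (* the first Newton step from c is then at most r / 4, and all iterates stay within r / 2 of c *)
  set (rho := Cmod a * (r / 4)).
  assert (Hrho : 0 < rho) by (unfold rho; apply Rmult_lt_0_compat; lra).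
  assert (surj : forall w, Cdisc (f c) rho w -> exists z, Cdisc c r z /\ f z = w).
  { intros w Hw.
    set (N := fun z => (z - (f z - w) / a)%C).
    set (x := fix x n := match n with O => c | S n => N (x n) end).
    assert (Nl : forall p q, Cdisc c r p -> Cdisc c r q -> Cmod (N q - N p) <= / 2 * Cmod (q - p)).
    { intros p q Hp Hq. unfold N.
      replace (q - (f q - w) / a - (p - (f p - w) / a))%C with (- ((f q - f p - a * (q - p)) / a))%C by (field; exact Na).
      rewrite Cmod_opp, Cmod_div by exact Na. apply Rle_div_l; [exact Pa|].
      replace (/ 2 * Cmod (q - p) * Cmod a) with (/ 2 * Cmod a * Cmod (q - p)) by ring. apply mv; assumption. }
    assert (N0 : Cmod (N c - c) <= r / 4).
    { unfold N. replace (c - (f c - w) / a - c)%C with ((w - f c) / a)%C by (field; exact Na).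
      rewrite Cmod_div by exact Na. apply Rle_div_l; [exact Pa|].
      unfold Cdisc, rho in Hw. lra. }
    assert (hp : forall n, 0 < (/ 2) ^ n <= 1).
    { induction n; simpl; lra. }
    assert (inv : forall n, Cmod (x n - c) <= (2 - 2 * (/ 2) ^ n) * (r / 4) /\
        Cmod (x (S n) - x n) <= r / 4 * (/ 2) ^ n).
    { induction n as [|n [I1 I2]].
      - split; [|simpl in *; lra]. simpl. replace (c - c)%C with (RtoC 0) by ring. rewrite Cmod_0; lra.
      - assert (J1 : Cmod (x (S n) - c) <= (2 - 2 * (/ 2) ^ S n) * (r / 4)).
        { replace (x (S n) - c)%C with ((x (S n) - x n) + (x n - c))%C by ring.
          eapply Rle_trans; [apply Cmod_triangle|]. simpl pow. lra. }
        split; [exact J1|].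
        assert (D1 : Cdisc c r (x n)).
        { unfold Cdisc. eapply Rle_lt_trans; [exact I1|]. specialize (hp n); nra. }
        assert (D2 : Cdisc c r (x (S n))).
        { unfold Cdisc. eapply Rle_lt_trans; [exact J1|]. specialize (hp (S n)); nra. }
        change (x (S (S n)) - x (S n))%C with (N (x (S n)) - N (x n))%C.
        eapply Rle_trans; [apply Nl; assumption|]. simpl pow. lra. }
    destruct (Ccauchy_limit x (r / 4)) as [l Hl]; [intros n; apply inv|].
    assert (Dl : Cmod (l - c) <= r / 2).
    { apply (Cmod_limit_le x); [exact Hl|]. intros n.
      eapply Rle_trans; [apply inv|]. specialize (hp n); nra. }
    assert (Dl' : Cdisc c r l) by (unfold Cdisc; lra).
    assert (Dx : forall n, Cdisc c r (x n)).
    { intros n. unfold Cdisc. eapply Rle_lt_trans; [apply inv|]. specialize (hp n); nra. }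
    exists l; split; [exact Dl'|].
    assert (Nf : N l = l).
    { apply Ceq_minus, (Czero_small 3). intros eps Heps.
      destruct (Hl eps Heps) as [n Hn].
      assert (A1 := Hn n (le_n n)). assert (A2 := Hn (S n) (le_S _ _ (le_n n))).
      assert (A3 := Nl (x n) l (Dx n) Dl').
      replace (N l - l)%C with ((N l - N (x n)) + (x (S n) - l))%C by (simpl; ring).
      eapply Rle_trans; [apply Cmod_triangle|].
      replace (l - x n)%C with (- (x n - l))%C in A3 by ring. rewrite Cmod_opp in A3. lra. }
    apply Ceq_minus. 
    replace (f l - w)%C with (a * (l - N l))%C by (unfold N; field; exact Na).
    rewrite Nf. ring. }
  set (T := fun w => epsilon (inhabits c) (fun z => Cdisc c r z /\ f z = w)).
  assert (HT : forall w, Cdisc (f c) rho w -> Cdisc c r (T w) /\ f (T w) = w).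
  { intros w Hw. exact (epsilon_spec (inhabits c) _ (surj w Hw)). }
  assert (nz : forall z, Cdisc c r z -> f' z <> 0).
  { intros z Hz E. assert (F := f1 z Hz). rewrite E in F.
    replace (0 - a)%C with (- a)%C in F by ring. rewrite Cmod_opp in F. lra. }
  exists r, rho, T. split; [exact Hr|split; [exact Hrho|split; [|split; [exact nz|]]]].
  - intros z w Hz Hw E. assert (L := lip w z Hw Hz).
    rewrite E in L. replace (f w - f w)%C with (RtoC 0) in L by ring. rewrite Cmod_0 in L.
    apply Ceq_minus, Cmod_eq_0. generalize (Cmod_ge_0 (z - w)); nra.
  - intros w Hw. destruct (HT w Hw) as [T1 T2]. split; [exact T1|split; [exact T2|]].
    set (z := T w) in *. set (b := f' z). assert (Nb : b <> 0) by (apply nz, T1).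
    assert (Pb := proj1 (Cmod_gt_0 b) Nb).
    apply Cderiv_eps; intros eps.
    set (e := eps * (Cmod b * (/ 2 * Cmod a))).
    assert (He : 0 < e).
    { unfold e. apply Rmult_lt_0_compat; [apply cond_pos|]. apply Rmult_lt_0_compat; lra. }
    destruct (proj1 (Cderiv_eps _ _ _) (f2 z T1) (mkposreal e He)) as [d1 Hd1]; simpl in Hd1. fold b in Hd1.
    assert (Hdd : 0 < Rmin (rho - Cmod (w - f c)) (d1 * (/ 2 * Cmod a))).
    { apply Rmin_glb_lt; [unfold Cdisc in Hw; lra|].
      apply Rmult_lt_0_compat; [apply cond_pos|lra]. }
    exists (mkposreal _ Hdd); simpl; intros v Hv.
    assert (V1 := Rlt_le_trans _ _ _ Hv (Rmin_l _ _)).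
    assert (V2 := Rlt_le_trans _ _ _ Hv (Rmin_r _ _)).
    destruct (HT v (Cdisc_sub _ _ _ _ Hw V1)) as [S1 S2].
    set (y := T v) in *.
    assert (L := lip z y T1 S1). rewrite T2, S2 in L.
    assert (Y : Cmod (y - z) < d1).
    { apply (Rmult_lt_reg_r (/ 2 * Cmod a)); [lra|]. lra. }
    assert (F := Hd1 y Y). rewrite T2, S2 in F.
    fold z.
    replace (y - z - / b * (v - w))%C with (- ((v - w - b * (y - z)) / b))%C by (field; exact Nb).
    rewrite Cmod_opp, Cmod_div by exact Nb. apply Rle_div_l; [exact Pb|].
    eapply Rle_trans; [exact F|]. unfold e.
    replace (eps * Cmod (v - w) * Cmod b) with (eps * Cmod b * Cmod (v - w)) by ring.
    replace (eps * (Cmod b * (/ 2 * Cmod a)) * Cmod (y - z)) with (eps * Cmod b * (/ 2 * Cmod a * Cmod (y - z))) by ring.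
    apply Rmult_le_compat_l; [|exact L].
    apply Rmult_le_pos; [left; apply cond_pos|lra].
Qed.

Lemma Cexp_pow z n : (Cexp z ^ n)%C = Cexp (INR n * z).
Proof.
  induction n as [|n IH].
  - simpl. replace (0 * z)%C with (RtoC 0) by ring. rewrite Cexp_0. reflexivity.
  - rewrite Cpow_S, IH, <- Cexp_plus, S_INR, RtoC_plus. f_equal. ring.
Qed.

Lemma root_of_unity n : (2 <= n)%nat -> exists w, (w ^ n)%C = 1 /\ w <> 1 /\ Cmod w = 1.
Proof.
  intros Hn.
  assert (Pn : 2 <= INR n) by (apply (le_INR 2 n), Hn).
  set (th := 2 * PI / INR n).
  assert (Pth : 0 < th <= PI).
  { unfold th. split; [apply Rdiv_lt_0_compat; [exact two_PI_pos|lra]|].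
    apply Rle_div_l; [lra|]. generalize PI_RGT_0; nra. }
  exists (Cexp (0, th)); split; [|split].
  - rewrite Cexp_pow.
    replace (INR n * (0, th))%C with ((0, 2 * PI) : C).
    + unfold Cexp; simpl. rewrite exp_0, cos_2PI, sin_2PI. unfold RtoC; f_equal; ring.
    + unfold th, Cmult, RtoC; simpl; f_equal; field; lra.
  - intros E. apply (f_equal fst) in E. unfold Cexp in E; simpl in E.
    rewrite exp_0, Rmult_1_l in E. 
    assert (L : cos th < cos 0) by (apply cos_decreasing_1; lra).
    rewrite cos_0 in L. lra.
  - rewrite Cmod_Cexp. simpl. apply exp_0.
Qed.

(** If [f' c = 0], then [f z = f c + (z - c) ^ m g z] with [m >= 2] and [g c <> 0].  With
    [L] a logarithm of [g / g c] and [h z = (z - c) exp (L z / m)] this reads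
    [f = f c + g c h ^ m].  As [h' c = 1], the function [h] takes near [c] two distinct values
    that differ by an [m]-th root of unity, and [f] has the same value at these two points. *)
Lemma injective_deriv_neq_0 c R f l : 0 < R -> holo_disc c R f ->
  (forall z w, Cdisc c R z -> Cdisc c R w -> f z = f w -> z = w) ->
  Cderiv f c l -> l <> 0.
Proof.
  intros HR Hf inj Hl El. subst l.
  destruct (zero_order c R (fun z => f z - f c)%C HR) as [r [Hr D]].
  { intros z Hz. destruct (Hf z Hz) as [b Hb].
    eexists; apply Cderiv_minus; [exact Hb|apply Cderiv_const]. }
  assert (sub : forall r' z, r' <= r -> Cdisc c r' z -> Cdisc c R z).
  { intros r' z Hr' Hz. apply (Cdisc_mono c r'); [lra|exact Hz]. }
  destruct D as [Z|[n [g [G1 [G2 G3]]]]].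
  - assert (D : Cdisc c r (c + RtoC (r / 2))%C).
    { unfold Cdisc. replace (c + RtoC (r / 2) - c)%C with (RtoC (r / 2)) by ring.
      rewrite Cmod_R, Rabs_pos_eq; lra. }
    assert (E : (c + RtoC (r / 2))%C = c).
    { apply inj; [exact (sub r _ (Rle_refl r) D)|apply Cdisc_center, HR|].
      apply Ceq_minus, Z, D. }
    assert (E2 : RtoC (r / 2) = 0) by (rewrite <- (Cplus_opp_r c), <- E at 1; ring).
    apply RtoC_inj in E2; lra.
  - destruct (ccont_neq_0 g c) as [d [Hd Hg]]; [|exact G2|].
    { apply (holo_disc_cont g c r); [exact G1|apply Cdisc_center; lra]. }
    set (r1 := Rmin r d).
    assert (Hr1 : 0 < r1 <= r) by (split; [apply Rmin_glb_lt; lra|apply Rmin_l]).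
    destruct (holo_log c r1 g) as [L [L1 [L2 L3]]]; [lra| | |].
    { exact (holo_disc_mono _ _ _ _ (proj2 Hr1) G1). }
    { intros z Hz. apply Hg. exact (Cdisc_mono _ _ _ _ (Rmin_r _ _) Hz). }
    assert (Fc : (f c - f c)%C = ((c - c) ^ n * g c)%C) by (apply G3, Cdisc_center; lra).
    (* evaluation at c excludes order 0, and f' c = g c excludes order 1 *)
    destruct n as [|[|n]].
    + apply G2. simpl in Fc. rewrite Cmult_1_l in Fc. rewrite <- Fc. ring.
    + apply G2. destruct (G1 c) as [b Hb]; [apply Cdisc_center; lra|].
      apply (Cderiv_unique (fun z => f c + (z - c) ^ 1 * g z)%C c).
      * simpl. eapply Cderiv_eq; [|apply Cderiv_plus; [apply Cderiv_const|]].
        2: { apply Cderiv_mult; [|exact Hb]. apply Cderiv_mult; [|apply Cderiv_const].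
             apply Cderiv_minus; [apply Cderiv_id|apply Cderiv_const]. }
        cbv beta. ring.
      * apply (Cderiv_ext f _ _ _ r); [lra| |exact Hl].
        intros z Hz. rewrite <- G3 by exact Hz. ring.
    + set (m := S (S n)) in *.
      assert (Pm : 2 <= INR m) by (apply (le_INR 2), le_n_S, le_n_S, Nat.le_0_l).
      assert (Nm : RtoC (INR m) <> 0) by (intros E; apply RtoC_inj in E; lra).
      set (h := fun z => ((z - c) * Cexp (/ INR m * L z))%C).
      destruct (holo_disc_derivative c r1 h) as [h' Hh'].
      { intros z Hz. destruct (L1 z Hz) as [b Hb]. eexists; apply Cderiv_mult.
        - apply Cderiv_minus; [apply Cderiv_id|apply Cderiv_const].
        - apply (Cderiv_comp Cexp (fun z => / INR m * L z)%C); [apply Cderiv_Cexp|apply Cderiv_scal, Hb]. }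
      assert (Dc : Cdisc c r1 c) by (apply Cdisc_center; lra).
      assert (Nh : h' c <> 0).
      { destruct (L1 c Dc) as [b Hb].
        rewrite (Cderiv_unique h c (h' c) 1).
        - intros E; apply RtoC_inj in E; lra.
        - apply Hh', Dc.
        - eapply Cderiv_eq; [|apply Cderiv_mult].
          2: { apply Cderiv_minus; [apply Cderiv_id|apply Cderiv_const]. }
          2: { apply (Cderiv_comp Cexp (fun z => / INR m * L z)%C); [apply Cderiv_Cexp|apply Cderiv_scal, Hb]. }
          cbv beta. rewrite L2. replace (/ INR m * 0)%C with (RtoC 0) by ring. rewrite Cexp_0. ring. }
      destruct (local_inverse c r1 h h') as [r2 [rho [T [Hr2 [Hrho [_ [_ HT]]]]]]]; [lra|exact Hh'|exact Nh|].
      assert (hc : h c = 0) by (unfold h; ring).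
      destruct (root_of_unity m) as [w [W1 [W2 W3]]]; [unfold m; lia|].
      assert (fh : forall z, Cdisc c r1 z -> f z = (f c + g c * h z ^ m)%C).
      { intros z Hz. unfold h. rewrite Cpow_mult_l, Cexp_pow.
        replace (INR m * (/ INR m * L z))%C with (L z) by (field; exact Nm).
        replace (g c * ((z - c) ^ m * Cexp (L z)))%C with ((z - c) ^ m * (g c * Cexp (L z)))%C by ring.
        rewrite <- L3 by exact Hz. rewrite <- G3 by (apply (Cdisc_mono c r1); [lra|exact Hz]). ring. }
      set (u := RtoC (rho / 2)).
      assert (mu : Cmod u = rho / 2) by (unfold u; rewrite Cmod_R, Rabs_pos_eq; lra).
      destruct (HT u) as [A1 [A2 _]].
      { unfold Cdisc. rewrite hc. replace (u - 0)%C with u by ring. lra. }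
      destruct (HT (u * w)%C) as [B1 [B2 _]].
      { unfold Cdisc. rewrite hc. replace (u * w - 0)%C with (u * w)%C by ring. rewrite Cmod_mult; nra. }
      assert (A1' := Cdisc_mono _ _ _ _ (proj2 Hr2) A1).
      assert (B1' := Cdisc_mono _ _ _ _ (proj2 Hr2) B1).
      assert (E : T u = T (u * w)%C).
      { apply inj; [exact (sub r1 _ (proj2 Hr1) A1')|exact (sub r1 _ (proj2 Hr1) B1')|].
        rewrite (fh _ A1'), (fh _ B1'). rewrite A2, B2, Cpow_mult_l, W1. ring. }
      apply W2.
      assert (E2 : u = (u * w)%C) by (rewrite <- A2, E at 1; exact B2).
      assert (Nu : u <> 0) by (apply Cmod_gt_0; lra).
      apply Ceq_minus.
      replace (w - 1)%C with (/ u * (u * w - u))%C by (field; exact Nu).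
      rewrite <- E2. ring.
Qed.

(** * Unit speed reparametrization of an analytic arc *)

(** Averaging with the Schwarz reflection keeps holomorphy on discs with real centre, and on
    the real axis it produces the real part of [f]. *)
Definition symmetrize (f : C -> C) (z : C) : C := ((f z + reflect f z) / 2)%C.

Lemma Cconj_R (t : R) : Cconj (RtoC t) = RtoC t.
Proof. unfold Cconj, RtoC; simpl; f_equal; ring. Qed.

Lemma symmetrize_real f (t : R) : symmetrize f t = RtoC (Re (f t)).
Proof. unfold symmetrize, reflect. rewrite Cconj_R, re_alt. reflexivity. Qed.

Lemma C2_neq_0 : RtoC 2 <> 0.
Proof. intros E; apply RtoC_inj in E; lra. Qed.

Lemma symmetrize_conj f z : symmetrize f (Cconj z) = Cconj (symmetrize f z).
Proof.
  unfold symmetrize, reflect. rewrite Cdiv_conj by exact C2_neq_0.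
  rewrite Cplus_conj, !Cconj_conj, Cconj_R. f_equal. ring.
Qed.

Lemma Cdisc_conj (c r : R) z : Cdisc c r z -> Cdisc c r (Cconj z).
Proof. unfold Cdisc. rewrite <- (Cconj_R c) at 2. rewrite <- Cminus_conj, Cmod_conj. auto. Qed.

Lemma Cderiv_symmetrize f f' z : Cderiv f z (f' z) -> Cderiv f (Cconj z) (f' (Cconj z)) ->
  Cderiv (symmetrize f) z (symmetrize f' z).
Proof.
  intros H1 H2.
  eapply Cderiv_eq; [|apply (Cderiv_mult (fun z => f z + reflect f z)%C (fun _ => / 2)%C)].
  2: { apply Cderiv_plus; [exact H1|apply Cderiv_reflect, H2]. }
  2: apply Cderiv_const.
  unfold symmetrize, reflect, Cdiv. cbv beta. ring.
Qed.

Lemma injective_on_disc_deriv_neq_0 c R f : holo_disc c R f ->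
  (forall z w, Cdisc c R z -> Cdisc c R w -> f z = f w -> z = w) ->
  forall z l, Cdisc c R z -> Cderiv f z l -> l <> 0.
Proof.
  intros Hf inj z l Hz Hl.
  apply (injective_deriv_neq_0 z (R - Cmod (z - c)) f l); [unfold Cdisc in Hz; lra| | |exact Hl].
  - intros w Hw. apply Hf, (Cdisc_sub _ _ _ _ Hz Hw).
  - intros v w Hv Hw. apply inj; apply (Cdisc_sub _ _ _ _ Hz); assumption.
Qed.

(** On the real axis [|phi'| = |phi' t0| exp (Re L)] with [L] a logarithm of
    [phi' / phi' t0], and there [Re L] is the symmetrization of [L]; so the speed extends
    holomorphically.  Its primitive is symmetrized once more, which makes it commute with
    conjugation, hence real on the real axis. *)
Lemma holomorphic_arc_length (t0 s0 Rd : R) phi phi' : 0 < Rd ->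
  (forall z, Cdisc t0 Rd z -> Cderiv phi z (phi' z)) ->
  (forall z, Cdisc t0 Rd z -> phi' z <> 0) ->
  exists S e, (forall z, Cdisc t0 Rd z -> Cderiv S z (e z)) /\
    (forall z, S (Cconj z) = Cconj (S z)) /\ S t0 = RtoC s0 /\
    forall t : R, Cdisc t0 Rd t -> e t = RtoC (Cmod (phi' t)).
Proof.
  intros HR Hphi Nz.
  assert (Dc := Cdisc_center t0 Rd HR).
  destruct (holo_log t0 Rd phi' HR (derivative_holo_disc _ _ _ _ Hphi) Nz) as [L [L1 [L2 L3]]].
  set (e0 := fun z => (RtoC (Cmod (phi' t0)) * Cexp (symmetrize L z))%C).
  destruct (holo_disc_derivative _ _ _ L1) as [L' HL'].
  destruct (primitive t0 Rd e0) as [S0 HS0].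
  { intros z Hz. eexists. apply Cderiv_scal.
    apply Cderiv_comp; [apply Cderiv_Cexp|].
    apply (Cderiv_symmetrize _ L'); apply HL'; [|apply Cdisc_conj]; exact Hz. }
  exists (fun z => symmetrize S0 z - symmetrize S0 t0 + RtoC s0)%C, (symmetrize e0).
  split; [|split; [|split]].
  - intros z Hz. eapply Cderiv_eq; [|apply Cderiv_plus; [apply Cderiv_minus|]].
    2: apply (Cderiv_symmetrize _ e0); apply HS0; [|apply Cdisc_conj]; exact Hz.
    2, 3: apply Cderiv_const.
    ring.
  - intros z. rewrite symmetrize_conj, Cplus_conj, Cminus_conj, (symmetrize_real S0 t0), !Cconj_R. reflexivity.
  - ring.
  - intros t Ht. rewrite symmetrize_real. unfold e0. rewrite symmetrize_real.
    rewrite (L3 t Ht), Cmod_mult, Cmod_Cexp.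
    rewrite re_scal_l. f_equal. f_equal. unfold Cexp; simpl. rewrite cos_0. ring.
Qed.

(** The local model of a curve parametrized by arc length, with its holomorphic extension. *)
Definition unit_arc (psi : C -> C) (x rho : R) : Prop :=
  0 < rho /\ holo_disc x rho psi /\
  (forall z w, Cdisc x rho z -> Cdisc x rho w -> psi z = psi w -> z = w) /\
  forall t : R, Rabs (t - x) < rho -> exists v, Cderiv psi t v /\ Cmod v = 1.

Lemma Cdisc_R (x r t : R) : Cdisc x r t = (Rabs (t - x) < r).
Proof. unfold Cdisc. rewrite <- RtoC_minus, Cmod_R. reflexivity. Qed.

Lemma Cderiv_Rderiv f (t : R) l : Cderiv f t l ->
  is_derive (K := R_AbsRing) (V := C_R_NormedModule) (fun u => f (RtoC u)) t l.
Proof.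
  intros H. replace l with (l * 1)%C by ring.
  apply (Rderiv_comp f RtoC t l (RtoC 1) H).
  apply (is_derive_ext (K := R_AbsRing) (V := C_R_NormedModule) (fun u => 0 + RtoC u * 1)%C).
  - intros u. change ((0 + u * 1)%C = RtoC u). ring.
  - apply Rderiv_line.
Qed.

(** [psi = phi o T] with [T] the local inverse of the holomorphic arc length [S].  At a real
    point [T] is real: [S] commutes with conjugation and is injective, so a preimage of a real
    number is its own conjugate.  There [|psi'| = |phi'| / S'] is 1. *)
Lemma unit_speed_reparametrization (t0 s0 Rd : R) phi : 0 < Rd -> holo_disc t0 Rd phi ->
  (forall z w, Cdisc t0 Rd z -> Cdisc t0 Rd w -> phi z = phi w -> z = w) ->
  exists r rho psi (S : R -> R), 0 < r <= Rd /\ unit_arc psi s0 rho /\ S t0 = s0 /\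
    forall t : R, Rabs (t - t0) < r -> Rabs (S t - s0) < rho /\ phi t = psi (S t) /\
      exists v, Cderiv phi t v /\ v <> 0 /\ is_derive S t (Cmod v).
Proof.
  intros HR Hphi inj.
  assert (Nz0 := injective_on_disc_deriv_neq_0 t0 Rd phi Hphi inj).
  destruct (holo_disc_derivative _ _ _ Hphi) as [phi' Hphi'].
  assert (Nz : forall z, Cdisc t0 Rd z -> phi' z <> 0).
  { intros z Hz. exact (Nz0 z _ Hz (Hphi' z Hz)). }
  destruct (holomorphic_arc_length t0 s0 Rd phi phi' HR Hphi' Nz) as [S [e [S1 [S2 [S3 S4]]]]].
  assert (Dc := Cdisc_center t0 Rd HR).
  destruct (local_inverse t0 Rd S e HR S1) as [r [rho [T [Hr [Hrho [Sinj [Sn HT]]]]]]].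
  { rewrite (S4 t0 Dc). intros E; apply RtoC_inj, Cmod_eq_0 in E. exact (Nz _ Dc E). }
  rewrite S3 in HT.
  assert (sub : forall z, Cdisc t0 r z -> Cdisc t0 Rd z).
  { intros z; apply Cdisc_mono, Hr. }
  assert (Sreal : forall t : R, S t = RtoC (Re (S t))).
  { intros t. assert (E := S2 t). rewrite Cconj_R in E.
    rewrite re_alt, <- E. field. }
  destruct (Cderiv_cont _ _ _ (S1 t0 Dc) rho Hrho) as [d [Hd Hcont]]. rewrite S3 in Hcont.
  exists (Rmin r d), rho, (fun w => phi (T w)), (fun t => Re (S t)).
  split; [|split; [|split]].
  - split; [apply Rmin_glb_lt; lra|]. generalize (Rmin_l r d); lra.
  - assert (D : forall w, Cdisc s0 rho w -> Cderiv (fun w => phi (T w)) w (/ e (T w) * phi' (T w))%C).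
    { intros w Hw. destruct (HT w Hw) as [T1 [T2 T3]].
      apply Cderiv_comp; [apply Hphi', sub, T1|exact T3]. }
    split; [exact Hrho|split; [|split]].
    + intros w Hw. eexists; apply D, Hw.
    + intros z w Hz Hw E.
      destruct (HT z Hz) as [T1 [T2 _]]. destruct (HT w Hw) as [U1 [U2 _]].
      rewrite <- T2, <- U2. f_equal. apply inj; auto.
    + intros t Ht. rewrite <- Cdisc_R in Ht. eexists; split; [apply D, Ht|].
      destruct (HT t Ht) as [T1 [T2 _]].
      assert (Tr : T t = RtoC (Re (T t))).
      { assert (E : Cconj (T t) = T t).
        { apply Sinj; [apply Cdisc_conj, T1|exact T1|]. rewrite S2, T2, Cconj_R. reflexivity. }
        rewrite re_alt, E. field. }
      assert (Ne := Sn _ T1).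
      rewrite Cmod_mult, Cmod_inv by exact Ne.
      rewrite Tr, (S4 (Re (T t))) by (rewrite <- Tr; auto).
      rewrite Cmod_R, Rabs_pos_eq by apply Cmod_ge_0.
      field. apply Rgt_not_eq, Cmod_gt_0, Nz. rewrite <- Tr. auto.
  - rewrite S3. reflexivity.
  - intros t Ht.
    assert (H1 := Rlt_le_trans _ _ _ Ht (Rmin_l _ _)).
    assert (H2 := Rlt_le_trans _ _ _ Ht (Rmin_r _ _)).
    rewrite <- Cdisc_R in H1.
    assert (St : Cdisc s0 rho (S t)).
    { apply Hcont. rewrite <- RtoC_minus, Cmod_R. exact H2. }
    split; [|split].
    + rewrite Sreal, Cdisc_R in St. exact St.
    + rewrite <- Sreal. f_equal. destruct (HT (S t) St) as [T1 [T2 _]].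
      apply Sinj; auto.
    + exists (phi' t). split; [apply Hphi', sub, H1|split; [apply Nz, sub, H1|]].
      assert (Ds := Rderiv_Re _ _ _ (Cderiv_Rderiv _ _ _ (S1 t (sub _ H1)))).
      rewrite (S4 t (sub _ H1)), re_RtoC in Ds. exact Ds.
Qed.

(** * One-sided derivatives on segments *)

Definition seg_deriv (a b : R) (f : R -> R) (t l : R) : Prop :=
  forall eps, 0 < eps -> exists d, 0 < d /\ forall u, a <= u <= b -> Rabs (u - t) < d ->
    Rabs (f u - f t - l * (u - t)) <= eps * Rabs (u - t).

(** Composing with the projection of the line onto [[a, b]] turns a function on the segment
    into a continuous function on the line, to which the theorems of calculus apply. *)
Definition clamp a b t := Rmax a (Rmin b t).

Lemma clamp_in a b t : a <= b -> a <= clamp a b t <= b.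
Proof. intros H; unfold clamp, Rmax, Rmin; repeat destruct Rle_dec; lra. Qed.

Lemma clamp_id a b t : a <= t <= b -> clamp a b t = t.
Proof. intros H; unfold clamp, Rmax, Rmin; repeat destruct Rle_dec; lra. Qed.

Lemma clamp_lip a b t u : a <= b -> Rabs (clamp a b u - clamp a b t) <= Rabs (u - t).
Proof.
  intros H; unfold clamp, Rmax, Rmin, Rabs; repeat destruct Rle_dec; repeat destruct Rcase_abs; lra.
Qed.

Lemma clamp_continuity a b f l : a <= b -> (forall t, a <= t <= b -> seg_deriv a b f t (l t)) ->
  continuity (fun t => f (clamp a b t)).
Proof.
  intros Hab H t.
  assert (Ht := clamp_in a b t Hab). set (t' := clamp a b t) in *.
  intros eps Heps.
  destruct (H t' Ht 1 Rlt_0_1) as [d [Hd H1]].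
  assert (K : 0 < Rabs (l t') + 1) by (generalize (Rabs_pos (l t')); lra).
  exists (Rmin d (eps / (Rabs (l t') + 1))). split.
  { apply Rmin_glb_lt; [exact Hd|apply Rdiv_lt_0_compat; lra]. }
  intros u [_ Hu]. simpl in *. unfold R_dist in *. fold t'.
  assert (Hl := clamp_lip a b t u Hab). fold t' in Hl.
  assert (Hin := clamp_in a b u Hab). set (u' := clamp a b u) in *.
  assert (U1 := Rlt_le_trans _ _ _ Hu (Rmin_l _ _)).
  assert (U2 := Rlt_le_trans _ _ _ Hu (Rmin_r _ _)).
  apply Rlt_div_r in U2; [|exact K].
  assert (H2 := H1 u' Hin ltac:(lra)).
  replace (f u' - f t') with ((f u' - f t' - l t' * (u' - t')) + l t' * (u' - t')) by ring.
  eapply Rle_lt_trans; [apply Rabs_triang|]. rewrite Rabs_mult.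
  generalize (Rabs_pos (l t')) (Rabs_pos (u' - t')); nra.
Qed.

Lemma seg_MVT a b f l : a < b -> (forall t, a <= t <= b -> seg_deriv a b f t (l t)) ->
  exists c, a <= c <= b /\ f b - f a = l c * (b - a).
Proof.
  intros Hab H.
  destruct (MVT_gen (fun t => f (clamp a b t)) a b l) as [c [Hc E]].
  - rewrite Rmin_left, Rmax_right by lra. intros t Ht.
    apply is_derive_Reals. intros eps Heps.
    destruct (H t ltac:(lra) (eps / 2)) as [d [Hd H1]]; [lra|].
    assert (Hdd : 0 < Rmin d (Rmin (t - a) (b - t))) by (repeat apply Rmin_glb_lt; lra).
    exists (mkposreal _ Hdd); simpl; intros h Nh Hh.
    assert (h1 := Rlt_le_trans _ _ _ Hh (Rmin_l _ _)).
    assert (h2 := Rlt_le_trans _ _ _ Hh (Rmin_r _ _)).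
    assert (h3 := Rlt_le_trans _ _ _ h2 (Rmin_l _ _)).
    assert (h4 := Rlt_le_trans _ _ _ h2 (Rmin_r _ _)).
    apply Rabs_lt_between in h3. apply Rabs_lt_between in h4.
    rewrite !clamp_id by lra.
    assert (H2 := H1 (t + h) ltac:(lra)). replace (t + h - t) with h in H2 by ring.
    specialize (H2 h1).
    replace ((f (t + h) - f t) / h - l t) with ((f (t + h) - f t - l t * h) / h) by (field; exact Nh).
    unfold Rdiv. rewrite Rabs_mult, Rabs_inv.
    assert (Ph : 0 < Rabs h) by (apply Rabs_pos_lt, Nh).
    apply Rle_lt_trans with (eps / 2); [|lra]. apply Rle_div_l; [exact Ph|exact H2].
  - intros t _. apply (clamp_continuity a b f l); [lra|exact H].
  - rewrite Rmin_left, Rmax_right in Hc by lra. exists c; split; [exact Hc|].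
    rewrite !clamp_id in E by lra. exact E.
Qed.

Lemma seg_IVT a b f l y : a <= b -> (forall t, a <= t <= b -> seg_deriv a b f t (l t)) ->
  f a <= y <= f b -> exists c, a <= c <= b /\ f c = y.
Proof.
  intros Hab H Hy.
  destruct (IVT_gen (fun t => f (clamp a b t)) a b y) as [c [Hc E]].
  - apply (clamp_continuity a b f l); assumption.
  - rewrite !clamp_id by lra. rewrite Rmin_left, Rmax_right; lra.
  - rewrite Rmin_left, Rmax_right in Hc by lra. exists c; split; [exact Hc|].
    rewrite clamp_id in E by exact Hc. exact E.
Qed.

Lemma is_derive_on_R I (f : R -> R) t l : is_derive_on (V := R_NormedModule) I f t l ->
  forall eps, 0 < eps -> exists d, 0 < d /\ forall u, I u -> Rabs (u - t) < d ->
    Rabs (f u - f t - l * (u - t)) <= eps * Rabs (u - t).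
Proof.
  intros [_ H] eps Heps.
  destruct (H t) with (eps := mkposreal eps Heps) as [d Hd].
  { intros P [e HP]. exists e. intros y Hy _. apply HP, Hy. }
  exists d; split; [apply cond_pos|]. intros u Iu Hu.
  generalize (Hd u Hu Iu). unfold norm, minus, plus, opp, scal; simpl. unfold abs, mult; simpl.
  replace (f u + - f t + - ((u + - t) * l)) with (f u - f t - l * (u - t)) by ring. auto.
Qed.

Lemma is_derive_on_C I (f : R -> C) t l : is_derive_on (V := C_R_NormedModule) I f t l ->
  forall eps, 0 < eps -> exists d, 0 < d /\ forall u, I u -> Rabs (u - t) < d ->
    Cmod (f u - f t - l * (u - t)) <= eps * Rabs (u - t).
Proof.
  intros [_ H] eps Heps.
  destruct (H t) with (eps := mkposreal eps Heps) as [d Hd].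
  { intros P [e HP]. exists e. intros y Hy _. apply HP, Hy. }
  exists d; split; [apply cond_pos|]. intros u Iu Hu.
  generalize (Hd u Hu Iu). rewrite scal_R_Cmult, (Cmult_comm l), <- RtoC_minus, Cmod_norm. auto.
Qed.

(** * Arc length of locally analytic curves *)

Lemma open_Cdisc V (z : C) : open (T := C_UniformSpace) V -> V z ->
  exists r, 0 < r /\ forall w, Cdisc z r w -> V w.
Proof.
  intros HV Vz. destruct (HV z Vz) as [eps H]. exists eps; split; [apply cond_pos|].
  intros w Hw. apply H, C_NormedModule_mixin_compat1, Hw.
Qed.

Lemma Cdisc_open c r : open (T := C_UniformSpace) (Cdisc c r).
Proof.
  intros z Hz.
  assert (P : 0 < r - Cmod (z - c)) by (unfold Cdisc in Hz; lra).
  assert (Hs : 0 < sqrt 2) by (apply sqrt_lt_R0; lra).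
  assert (He : 0 < (r - Cmod (z - c)) / sqrt 2) by (apply Rdiv_lt_0_compat; assumption).
  exists (mkposreal _ He). intros w Hw. apply (Cdisc_sub c r z w Hz).
  generalize (C_NormedModule_mixin_compat2 _ _ _ Hw); simpl.
  replace (sqrt 2 * ((r - Cmod (z - c)) / sqrt 2)) with (r - Cmod (z - c)) by (field; lra).
  intro h; exact h.
Qed.

(** [sigma] and the arc length [S] of the reparametrization have the same derivative
    [|phi'|] along the segment and the same value at [t0], so they coincide near [t0] on the
    segment, and [psi o S = phi] becomes [psi o sigma = Gamma]. *)
Lemma analytic_curve_arc_length a b Gamma sigma t0 : analytic_curve a b Gamma ->
  arc_length (segment a b) Gamma sigma -> a <= t0 <= b ->
  (exists l, 0 < l /\ is_derive_on (V := R_NormedModule) (segment a b) sigma t0 l) /\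
  exists rho psi eta, unit_arc psi (sigma t0) rho /\ 0 < eta /\
    forall t, a <= t <= b -> Rabs (t - t0) < eta ->
      Rabs (sigma t - sigma t0) < rho /\ Gamma t = psi (sigma t).
Proof.
  intros (Hab & _ & V & phi & HV & [[oV hV] iV] & Hphi) Hs Ht0.
  destruct (open_Cdisc V t0 oV (HV t0 Ht0)) as [R [HR HRV]].
  destruct (unit_speed_reparametrization t0 (sigma t0) R phi) as
    (r & rho & psi & S & Hr & Hpsi & S0 & HS); [exact HR| | |].
  { intros z Hz. exact (hV z (HRV z Hz)). }
  { intros z w Hz Hw. apply iV; auto. }
  (* the derivative of Gamma relative to the segment is unique, so it is that of phi *)
  assert (speed : forall t v, a <= t <= b -> Cderiv phi t v ->
     is_derive_on (V := R_NormedModule) (segment a b) sigma t (Cmod v)).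
  { intros t v Ht Hv. destruct (Hs t Ht) as [w [Hw1 Hw2]].
    replace v with w; [exact Hw2|].
    apply Ceq_minus, (Czero_small 2). intros eps Heps.
    destruct (is_derive_on_C _ _ _ _ Hw1 eps Heps) as [d1 [Hd1 H1]].
    destruct (proj1 (Rderiv_eps _ _ _) (Cderiv_Rderiv _ _ _ Hv) (mkposreal eps Heps)) as [d2 H2].
    simpl in H2.
    set (d := Rmin (Rmin d1 d2) (b - a) / 2).
    assert (M : 0 < Rmin (Rmin d1 d2) (b - a)).
    { repeat apply Rmin_glb_lt; [exact Hd1|apply cond_pos|lra]. }
    assert (M1 : Rmin (Rmin d1 d2) (b - a) <= b - a) by apply Rmin_r.
    assert (M2 : Rmin (Rmin d1 d2) (b - a) <= d1) by (eapply Rle_trans; [apply Rmin_l|apply Rmin_l]).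
    assert (M3 : Rmin (Rmin d1 d2) (b - a) <= d2) by (eapply Rle_trans; [apply Rmin_l|apply Rmin_r]).
    assert (Hu : exists u, a <= u <= b /\ Rabs (u - t) = d).
    { destruct (Rle_dec t ((a + b) / 2)).
      - exists (t + d); split; [unfold d; lra|]. rewrite Rabs_pos_eq; unfold d; lra.
      - exists (t - d); split; [unfold d; lra|]. rewrite Rabs_left; unfold d; lra. }
    destruct Hu as [u [Hu1 Hu2]].
    assert (Pd : 0 < d) by (unfold d; lra).
    specialize (H1 u Hu1 ltac:(rewrite Hu2; unfold d; lra)).
    specialize (H2 u ltac:(rewrite Hu2; unfold d; lra)).
    rewrite !Hphi in H2 by assumption.
    apply (Rmult_le_reg_r (Rabs (u - t))); [lra|].
    rewrite <- (Cmod_R (u - t)), <- Cmod_mult, RtoC_minus at 1.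
    replace ((w - v) * (u - t))%C with
      ((Gamma u - Gamma t - v * (u - t)) + - (Gamma u - Gamma t - w * (u - t)))%C by ring.
    eapply Rle_trans; [apply Cmod_triangle|]. rewrite Cmod_opp. lra. }
  split.
  - destruct (HS t0) as (_ & _ & v & Hv & Nv & _).
    { rewrite Rminus_diag, Rabs_R0. lra. }
    exists (Cmod v); split; [apply Cmod_gt_0, Nv|]. apply speed; assumption.
  - exists rho, psi, r. split; [exact Hpsi|split; [lra|]].
    assert (eqS : forall t, a <= t <= b -> Rabs (t - t0) < r -> sigma t = S t).
    { assert (zero : forall p q, a <= p -> p < q -> q <= b -> Rabs (p - t0) < r -> Rabs (q - t0) < r ->
        sigma q - S q = sigma p - S p).
      { intros p q Hp Hpq Hq Rp Rq.
        apply Rabs_lt_between in Rp. apply Rabs_lt_between in Rq.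
        destruct (seg_MVT p q (fun t => sigma t - S t) (fun _ => 0) Hpq) as [c [_ E]]; [|lra].
        intros t Ht eps Heps.
        destruct (HS t) as (_ & _ & v & Hv & _ & Dv); [apply Rabs_lt_between; lra|].
        assert (He : 0 < eps / 2) by lra.
        destruct (is_derive_on_R _ _ _ _ (speed t v ltac:(lra) Hv) (eps / 2) He) as [d1 [Hd1 H1]].
        destruct Dv as [_ Dv].
        destruct (Dv t (fun P HP => HP) (mkposreal _ He)) as [d2 H2].
        exists (Rmin d1 d2); split; [apply Rmin_glb_lt; [exact Hd1|apply cond_pos]|].
        intros u Hu Hut.
        specialize (H1 u ltac:(unfold segment; lra) (Rlt_le_trans _ _ _ Hut (Rmin_l _ _))).
        specialize (H2 u (Rlt_le_trans _ _ _ Hut (Rmin_r _ _))).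
        unfold norm, minus, plus, opp, scal in H2; simpl in H2. unfold abs, mult in H2; simpl in H2.
        replace (sigma u - S u - (sigma t - S t) - 0 * (u - t)) with
          ((sigma u - sigma t - Cmod v * (u - t)) + - (S u + - S t + - ((u + - t) * Cmod v))) by ring.
        eapply Rle_trans; [apply Rabs_triang|]. rewrite Rabs_Ropp.
        unfold Rminus in *; lra. }
      intros t Ht Rt.
      assert (R0 : Rabs (t0 - t0) < r) by (rewrite Rminus_diag, Rabs_R0; lra).
      destruct (Rtotal_order t t0) as [L|[->|L]].
      - assert (Z := zero t t0 ltac:(lra) L ltac:(lra) Rt R0). lra.
      - lra.
      - assert (Z := zero t0 t ltac:(lra) L ltac:(lra) R0 Rt). lra. }
    intros t Ht Rt. destruct (HS t Rt) as (H1 & H2 & _).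
    rewrite (eqS t Ht Rt). split; [exact H1|]. rewrite <- Hphi by exact Ht. exact H2.
Qed.

(** The derivative along a filter quantifies over all limits of the filter; this reduces them
    to the point itself and makes derivatives relative to a set monotone in that set. *)
Lemma within_lim_eq (I : R -> Prop) (t x : R) : I t ->
  is_filter_lim (within I (locally t)) x -> x = t.
Proof.
  intros It H. apply NNPP; intros N.
  assert (P : 0 < Rabs (t - x)) by (apply Rabs_pos_lt; lra).
  destruct (H (ball x (mkposreal _ P))) as [e He].
  { exists (mkposreal _ P); auto. }
  assert (B := He t (ball_center t e) It).
  change (Rabs (t - x) < Rabs (t - x)) in B. lra.
Qed.

Lemma is_derive_on_mono {V : NormedModule R_AbsRing} (I I' : R -> Prop) (f : R -> V) t l :
  (forall u, I' u -> I u) -> I' t -> is_derive_on I f t l -> is_derive_on I' f t l.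
Proof.
  intros Hsub It [L H]. split; [exact L|]. intros x Hx.
  apply within_lim_eq in Hx; [|exact It]. subst x.
  intros eps. destruct (H t) with (eps := eps) as [d Hd].
  { intros P [e HP]. exists e. intros y Hy _. apply HP, Hy. }
  exists d. intros u Hu Iu. apply Hd; auto.
Qed.

Lemma is_derive_on_intro_C (I : R -> Prop) (f : R -> C) t l : I t ->
  is_derive (K := R_AbsRing) (V := C_R_NormedModule) f t l ->
  is_derive_on (V := C_R_NormedModule) I f t l.
Proof.
  intros It [L H]. split; [exact L|]. intros x Hx.
  apply within_lim_eq in Hx; [|exact It]. subst x.
  intros eps. destruct (H t (fun P HP => HP) eps) as [d Hd].
  exists d. intros u Hu _. apply Hd, Hu.
Qed.

Lemma is_derive_on_id (I : R -> Prop) t : I t ->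
  is_derive_on (V := R_NormedModule) I (fun x => x) t 1.
Proof.
  intros It. split; [apply (is_linear_scal_l (K := R_AbsRing) (V := R_NormedModule) 1)|]. intros x Hx.
  apply within_lim_eq in Hx; [|exact It]. subst x.
  intros eps. exists eps. intros u _ _.
  change (Rabs ((u - t) - (u - t) * 1) <= eps * Rabs (u - t)).
  rewrite Rmult_1_r, Rminus_diag, Rabs_R0.
  apply Rmult_le_pos; [left; apply cond_pos|apply Rabs_pos].
Qed.

(** The three cases of local analyticity have a common form: some segment that contains a
    neighbourhood of [u] in [J] carries an analytic curve. *)
Lemma locally_analytic_segment J Gamma u : is_interval J -> nondegenerate J ->
  locally_analytic J Gamma -> J u -> exists a b eta, J a /\ J b /\ a <= u <= b /\
    analytic_curve a b Gamma /\ 0 < eta /\ forall t, J t -> Rabs (t - u) < eta -> a <= t <= b.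
Proof.
  intros HJ [p [q [Jp [Jq Hpq]]]] [_ H] Ju.
  destruct (H u Ju) as [H1 [H2 H3]].
  destruct (classic (exists x, J x /\ x < u)) as [[x [Jx Hx]]|Nmin].
  - destruct (classic (exists y, J y /\ u < y)) as [[y [Jy Hy]]|Nmax].
    + destruct H1 as (a & b & Ja & Jb & Hab & Hc).
      { assert (P : 0 < Rmin (u - x) (y - u)) by (apply Rmin_glb_lt; lra).
        exists (mkposreal _ P). intros t Ht. change (Rabs (t - u) < Rmin (u - x) (y - u)) in Ht.
        apply (HJ x t y Jx Jy).
        assert (A1 := Rlt_le_trans _ _ _ Ht (Rmin_l _ _)). assert (A2 := Rlt_le_trans _ _ _ Ht (Rmin_r _ _)).
        apply Rabs_lt_between in A1. apply Rabs_lt_between in A2. lra. }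
      exists a, b, (Rmin (u - a) (b - u)).
      refine (conj Ja (conj Jb (conj _ (conj Hc (conj _ _))))); [lra|apply Rmin_glb_lt; lra|].
      intros t _ Ht.
      assert (A1 := Rlt_le_trans _ _ _ Ht (Rmin_l _ _)). assert (A2 := Rlt_le_trans _ _ _ Ht (Rmin_r _ _)).
      apply Rabs_lt_between in A1. apply Rabs_lt_between in A2. lra.
    + assert (M : forall t, J t -> t <= u).
      { intros t Jt. apply Rnot_lt_le; intros L; apply Nmax; exists t; auto. }
      destruct (H2 M) as (a & Ja & Hau & Hc).
      exists a, u, (u - a).
      refine (conj Ja (conj Ju (conj _ (conj Hc (conj _ _))))); [lra|lra|].
      intros t Jt Ht. assert (L := M t Jt). apply Rabs_lt_between in Ht. lra.
  - assert (M : forall t, J t -> u <= t).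
    { intros t Jt. apply Rnot_lt_le; intros L; apply Nmin; exists t; auto. }
    destruct (H3 M) as (b & Jb & Hub & Hc).
    exists u, b, (b - u).
    refine (conj Ju (conj Jb (conj _ (conj Hc (conj _ _))))); [lra|lra|].
    intros t Jt Ht. assert (L := M t Jt). apply Rabs_lt_between in Ht. lra.
Qed.

Lemma locally_analytic_unit_arc J Gamma sigma u : is_interval J -> nondegenerate J ->
  locally_analytic J Gamma -> arc_length J Gamma sigma -> J u ->
  (exists l, 0 < l /\ forall eps, 0 < eps -> exists d, 0 < d /\ forall t, J t -> Rabs (t - u) < d ->
    Rabs (sigma t - sigma u - l * (t - u)) <= eps * Rabs (t - u)) /\
  exists rho psi eta, unit_arc psi (sigma u) rho /\ 0 < eta /\
    forall t, J t -> Rabs (t - u) < eta -> Rabs (sigma t - sigma u) < rho /\ Gamma t = psi (sigma t).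
Proof.
  intros HJ HN HG Hs Ju.
  destruct (locally_analytic_segment J Gamma u HJ HN HG Ju) as (a & b & eta & Ja & Jb & Hu & Hc & Heta & Hnear).
  assert (sub : forall t, segment a b t -> J t).
  { intros t Ht. exact (HJ a t b Ja Jb Ht). }
  destruct (analytic_curve_arc_length a b Gamma sigma u Hc) as [[l [Hl Dl]] (rho & psi & eta' & Hpsi & Heta' & H)].
  { intros t Ht. destruct (Hs t (sub t Ht)) as [v [V1 V2]]. exists v; split;
    apply (is_derive_on_mono J); assumption. }
  { exact Hu. }
  split.
  - exists l; split; [exact Hl|]. intros eps Heps.
    destruct (is_derive_on_R _ _ _ _ Dl eps Heps) as [d [Hd H1]].
    exists (Rmin d eta); split; [apply Rmin_glb_lt; assumption|].
    intros t Jt Ht. apply H1.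
    + apply Hnear; [exact Jt|]. eapply Rlt_le_trans; [exact Ht|apply Rmin_r].
    + eapply Rlt_le_trans; [exact Ht|apply Rmin_l].
  - exists rho, psi, (Rmin eta' eta). split; [exact Hpsi|split; [apply Rmin_glb_lt; assumption|]].
    intros t Jt Ht. apply H.
    + apply Hnear; [exact Jt|]. eapply Rlt_le_trans; [exact Ht|apply Rmin_r].
    + eapply Rlt_le_trans; [exact Ht|apply Rmin_l].
Qed.

(** The speed is positive because conformal maps have no critical points; monotonicity and
    the intermediate value property follow as for functions on segments. *)
Lemma arc_length_monotone J Gamma sigma : is_interval J -> nondegenerate J ->
  locally_analytic J Gamma -> arc_length J Gamma sigma ->
  (forall t u, J t -> J u -> t < u -> sigma t < sigma u) /\
  is_interval (fun x => exists u, J u /\ sigma u = x).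
Proof.
  intros HJ HN HG Hs.
  set (l := fun t => epsilon (inhabits 0) (fun l => 0 < l /\ forall eps, 0 < eps -> exists d, 0 < d /\
    forall u, J u -> Rabs (u - t) < d -> Rabs (sigma u - sigma t - l * (u - t)) <= eps * Rabs (u - t))).
  assert (Hl : forall t, J t -> 0 < l t /\ forall eps, 0 < eps -> exists d, 0 < d /\
    forall u, J u -> Rabs (u - t) < d -> Rabs (sigma u - sigma t - l t * (u - t)) <= eps * Rabs (u - t)).
  { intros t Jt. apply epsilon_spec. apply (locally_analytic_unit_arc J Gamma); assumption. }
  assert (Dl : forall p q t, J p -> J q -> p <= t <= q -> seg_deriv p q sigma t (l t)).
  { intros p q t Jp Jq Ht eps Heps.
    destruct (Hl t (HJ p t q Jp Jq Ht)) as [_ H]. destruct (H eps Heps) as [d [Hd H1]].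
    exists d; split; [exact Hd|]. intros u Hu Hut. apply H1; [exact (HJ p u q Jp Jq Hu)|exact Hut]. }
  assert (mono : forall t u, J t -> J u -> t < u -> sigma t < sigma u).
  { intros t u Jt Ju Htu.
    destruct (seg_MVT t u sigma l Htu) as [c [Hc E]]; [intros; apply Dl; assumption|].
    destruct (Hl c (HJ t c u Jt Ju Hc)) as [Pc _].
    assert (0 < l c * (u - t)) by (apply Rmult_lt_0_compat; lra). lra. }
  split; [exact mono|].
  intros x y z [p [Jp Ep]] [q [Jq Eq]] Hy.
  destruct (Rtotal_order p q) as [L|[L|L]].
  - destruct (seg_IVT p q sigma l y) as [c [Hc E]]; [lra|intros; apply Dl; assumption|lra|].
    exists c; split; [exact (HJ p c q Jp Jq Hc)|exact E].
  - subst q. exists p; split; [exact Jp|lra].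
  - assert (M := mono q p Jq Jp L). lra.
Qed.

(** * Normal form of extensions *)

Lemma unit_arc_shrink psi x rho rho' : 0 < rho' <= rho -> unit_arc psi x rho -> unit_arc psi x rho'.
Proof.
  intros Hr (H1 & H2 & H3 & H4). split; [lra|split; [|split]].
  - exact (holo_disc_mono _ _ _ _ (proj2 Hr) H2).
  - intros z w Hz Hw. apply H3; eapply Cdisc_mono; try eassumption; apply Hr.
  - intros t Ht. apply H4; lra.
Qed.

Lemma unit_arc_recenter psi x rho y : Rabs (y - x) < rho -> unit_arc psi x rho ->
  unit_arc psi y (rho - Rabs (y - x)).
Proof.
  intros Hy (H1 & H2 & H3 & H4).
  assert (sub : forall z, Cdisc y (rho - Rabs (y - x)) z -> Cdisc x rho z).
  { intros z Hz. apply (Cdisc_sub x rho y z); [rewrite Cdisc_R; exact Hy|].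
    rewrite <- RtoC_minus, Cmod_R. exact Hz. }
  split; [lra|split; [|split]].
  - intros z Hz; apply H2, sub, Hz.
  - intros z w Hz Hw; apply H3; apply sub; assumption.
  - intros t Ht. apply H4. rewrite <- Cdisc_R. apply sub. rewrite Cdisc_R. exact Ht.
Qed.

(** The normal form of an extension: [Gamma o sigma^-1] on the range of [sigma].  In this
    parametrization [h] becomes [s] and the arc length becomes the identity, so any two
    extensions can be compared pointwise. *)
Definition unit_speed_ext (I : R -> Prop) (gamma : R -> C) (s : R -> R) (E : R -> Prop) (g : R -> C) : Prop :=
  is_interval E /\
  (forall x, E x -> exists rho psi, unit_arc psi x rho /\
     forall y, E y -> Rabs (y - x) < rho -> g y = psi y) /\
  (forall t, I t -> E (s t) /\ gamma t = g (s t)).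

(** Near [u] the curve is [psi o sigma], hence [Gamma o sigma^-1] is [psi] near [sigma u]
    once points with close images under the increasing function [sigma] are close. *)
Lemma unit_speed_ext_of_extension I gamma s Gamma J h sigma : nondegenerate I ->
  locally_analytic_extension I gamma Gamma J h -> normalized_arc_length I s Gamma J h sigma ->
  exists g, unit_speed_ext I gamma s (fun x => exists u, J u /\ sigma u = x) g /\
    forall u, J u -> g (sigma u) = Gamma u.
Proof.
  intros [p [q [Ip [Iq Hpq]]]] (HJ & HG & hJ & _ & hmono & hext) [Hs norm].
  assert (HN : nondegenerate J).
  { exists (h p), (h q). auto. }
  destruct (arc_length_monotone J Gamma sigma HJ HN HG Hs) as [mono Eint].
  set (inv := fun x => epsilon (inhabits 0) (fun u => J u /\ sigma u = x)).
  assert (Hinv : forall u, J u -> inv (sigma u) = u).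
  { intros u Ju. destruct (epsilon_spec (inhabits 0) (fun v => J v /\ sigma v = sigma u)) as [E1 E2].
    { exists u; auto. }
    fold (inv (sigma u)) in E1, E2. destruct (Rtotal_order (inv (sigma u)) u) as [L|[L|L]]; [|exact L|].
    - apply mono in L; auto; lra.
    - apply mono in L; auto; lra. }
  assert (Hg : forall u, J u -> Gamma (inv (sigma u)) = Gamma u).
  { intros u Ju; rewrite Hinv; auto. }
  exists (fun x => Gamma (inv x)). split; [|exact Hg].
  split; [exact Eint|split].
  - intros x [u [Ju <-]].
    destruct (locally_analytic_unit_arc J Gamma sigma u HJ HN HG Hs Ju) as [_ (rho & psi & eta & Hpsi & Heta & H)].
    assert (Pr := proj1 Hpsi).
    assert (right : exists r, 0 < r /\ forall v, J v -> sigma v < sigma u + r -> v < u + eta).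
    { destruct (classic (J (u + eta / 2))) as [Y|N].
      - exists (sigma (u + eta / 2) - sigma u). split.
        + assert (L := mono u (u + eta / 2) Ju Y). lra.
        + intros v Jv Hv. apply Rnot_le_lt; intros L.
          assert (M := mono (u + eta / 2) v Y Jv). lra.
      - exists 1; split; [lra|]. intros v Jv _. apply Rnot_le_lt; intros L. apply N.
        apply (HJ u _ v Ju Jv); lra. }
    assert (left : exists r, 0 < r /\ forall v, J v -> sigma u - r < sigma v -> u - eta < v).
    { destruct (classic (J (u - eta / 2))) as [Y|N].
      - exists (sigma u - sigma (u - eta / 2)). split.
        + assert (L := mono (u - eta / 2) u Y Ju). lra.
        + intros v Jv Hv. apply Rnot_le_lt; intros L.
          assert (M := mono v (u - eta / 2) Jv Y). lra.
      - exists 1; split; [lra|]. intros v Jv _. apply Rnot_le_lt; intros L. apply N.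
        apply (HJ v _ u Jv Ju); lra. }
    destruct right as [r1 [Hr1 R1]]. destruct left as [r2 [Hr2 R2]].
    set (r := Rmin rho (Rmin r1 r2)).
    assert (Hr : 0 < r) by (repeat apply Rmin_glb_lt; assumption).
    assert (B1 : r <= rho) by apply Rmin_l.
    assert (B2 : r <= r1) by (eapply Rle_trans; [apply Rmin_r|apply Rmin_l]).
    assert (B3 : r <= r2) by (eapply Rle_trans; [apply Rmin_r|apply Rmin_r]).
    exists r, psi. split; [apply (unit_arc_shrink _ _ rho); auto|].
    intros y [v [Jv <-]] Hy. rewrite Hg by exact Jv. apply H; [exact Jv|].
    apply Rabs_lt_between in Hy. apply Rabs_lt_between.
    assert (A1 := R1 v Jv ltac:(lra)). assert (A2 := R2 v Jv ltac:(lra)). lra.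
  - intros t It. rewrite <- norm by exact It. split.
    + exists (h t); split; [apply hJ, It|reflexivity].
    + rewrite Hg by apply hJ, It. apply hext, It.
Qed.

(** At a point [x] of the common interval the difference of the two local unit arcs has an
    isolated zero, no zero, or vanishes identically near [x].  So agreeing near a point is a
    locally constant property on the common interval, and it holds in the middle of [[p, q]]. *)
Lemma unit_speed_ext_unique I gamma s E1 g1 E2 g2 p q : p < q ->
  (forall x, p <= x <= q -> exists t, I t /\ s t = x) ->
  unit_speed_ext I gamma s E1 g1 -> unit_speed_ext I gamma s E2 g2 ->
  forall x, E1 x -> E2 x -> g1 x = g2 x.
Proof.
  intros Hpq Hs (I1 & A1 & G1) (I2 & A2 & G2).
  set (E := fun x => E1 x /\ E2 x).
  assert (base : forall x, p <= x <= q -> E x /\ g1 x = g2 x).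
  { intros x Hx. destruct (Hs x Hx) as [t [It <-]].
    destruct (G1 t It) as [X1 Y1]. destruct (G2 t It) as [X2 Y2].
    split; [split; assumption|congruence]. }
  assert (HE : is_interval E).
  { intros x y z [X1 X2] [Z1 Z2] Hy; split; [exact (I1 x y z X1 Z1 Hy)|exact (I2 x y z X2 Z2 Hy)]. }
  (* agreement near an isolated zero x of the difference is refuted at another point of E *)
  assert (acc : forall x d, E x -> 0 < d -> exists z, E z /\ z <> x /\ Rabs (z - x) < d).
  { intros x d Ex Hd.
    destruct (Rle_dec x p) as [L|L].
    - set (z := x + Rmin (d / 2) (q - x)).
      assert (P : 0 < Rmin (d / 2) (q - x)) by (apply Rmin_glb_lt; lra).
      assert (P1 : Rmin (d / 2) (q - x) <= d / 2) by apply Rmin_l.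
      assert (P2 : Rmin (d / 2) (q - x) <= q - x) by apply Rmin_r.
      exists z; unfold z; repeat split; try (apply (HE x _ q Ex (proj1 (base q ltac:(lra)))); lra); try lra.
      rewrite Rabs_pos_eq; lra.
    - set (z := x - Rmin (d / 2) (x - p)).
      assert (P : 0 < Rmin (d / 2) (x - p)) by (apply Rmin_glb_lt; lra).
      assert (P1 : Rmin (d / 2) (x - p) <= d / 2) by apply Rmin_l.
      assert (P2 : Rmin (d / 2) (x - p) <= x - p) by apply Rmin_r.
      exists z; unfold z; repeat split; try (apply (HE p _ x (proj1 (base p ltac:(lra))) Ex); lra); try lra.
      rewrite Rabs_left; lra. }
  assert (conn := interval_connected E
    (fun y => exists d, 0 < d /\ forall z, E z -> Rabs (z - y) < d -> g1 z = g2 z) HE).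
  intros x X1 X2.
  destruct conn with (x := (p + q) / 2) (y := x) as [d [Hd Hx]].
  - clear x X1 X2. intros x Ex.
    destruct (A1 x (proj1 Ex)) as (r1 & psi1 & (P1 & H1 & _) & S1).
    destruct (A2 x (proj2 Ex)) as (r2 & psi2 & (P2 & H2 & _) & S2).
    destruct (isolated_zeros x (Rmin r1 r2) (fun z => psi1 z - psi2 z)%C) as [r [Hr Dich]].
    { apply Rmin_glb_lt; assumption. }
    { intros z Hz. 
      destruct (H1 z) as [l1 L1]; [eapply Cdisc_mono; [apply Rmin_l|exact Hz]|].
      destruct (H2 z) as [l2 L2]; [eapply Cdisc_mono; [apply Rmin_r|exact Hz]|].
      eexists; apply Cderiv_minus; eassumption. }
    assert (Rr1 : r <= r1) by (eapply Rle_trans; [apply Hr|apply Rmin_l]).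
    assert (Rr2 : r <= r2) by (eapply Rle_trans; [apply Hr|apply Rmin_r]).
    assert (diff : forall z, E z -> Rabs (z - x) < r -> (g1 z - g2 z)%C = (psi1 z - psi2 z)%C).
    { intros z [Z1 Z2] Hz. rewrite S1, S2 by (assumption || lra). reflexivity. }
    exists r; split; [apply Hr|]. intros y Ey Hy.
    destruct Dich as [Z|N].
    + assert (same : forall z, E z -> Rabs (z - x) < r -> g1 z = g2 z).
      { intros z Ez Hz. apply Ceq_minus. rewrite diff by assumption. apply Z. rewrite Cdisc_R; exact Hz. }
      split; intros _; [exists r; split; [apply Hr|exact same]|].
      exists (r - Rabs (y - x)); split; [lra|]. intros z Ez Hz. apply same; [exact Ez|].
      replace (z - x) with ((z - y) + (y - x)) by ring.
      eapply Rle_lt_trans; [apply Rabs_triang|lra].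
    + destruct (Req_dec y x) as [->|Nyx]; [tauto|].
      split; intros [d [Hd Hsame]]; exfalso.
      * apply (N y).
        -- rewrite Cdisc_R; exact Hy.
        -- intros e; apply RtoC_inj in e; auto.
        -- rewrite <- diff by assumption. apply (proj1 (Ceq_minus _ _)), Hsame; [exact Ey|].
           rewrite Rminus_diag, Rabs_R0; exact Hd.
      * destruct (acc x (Rmin d r) Ex) as (z & Ez & Nz & Hz); [apply Rmin_glb_lt; lra|].
        assert (Hz1 := Rlt_le_trans _ _ _ Hz (Rmin_l _ _)).
        assert (Hz2 := Rlt_le_trans _ _ _ Hz (Rmin_r _ _)).
        apply (N z).
        -- rewrite Cdisc_R; exact Hz2.
        -- intros e; apply RtoC_inj in e; auto.
        -- rewrite <- diff by assumption. apply (proj1 (Ceq_minus _ _)), Hsame; assumption.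
  - apply base; lra.
  - split; assumption.
  - exists ((q - p) / 2); split; [lra|]. intros z _ Hz. apply base.
    apply Rabs_lt_between in Hz. lra.
  - apply Hx; [split; assumption|]. rewrite Rminus_diag, Rabs_R0; exact Hd.
Qed.

(** Add a neighbourhood of [x] and use there the unit arc at [x].  At a point of [E] outside
    that neighbourhood nothing changes: the segment from it to [x] lies in [E], so close
    points of the larger set are already in [E]. *)
Lemma unit_speed_ext_enlarge I gamma s E g x : unit_speed_ext I gamma s E g -> E x ->
  exists rho g', 0 < rho /\ unit_speed_ext I gamma s (fun y => E y \/ Rabs (y - x) < rho) g'.
Proof.
  intros (IE & AE & GE) Ex.
  destruct (AE x Ex) as (rho & psi & Hpsi & Hg). assert (Pr := proj1 Hpsi).
  set (g' := fun y => if Rlt_dec (Rabs (y - x)) rho then psi y else g y).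
  assert (g'psi : forall y, Rabs (y - x) < rho -> g' y = psi y).
  { intros y Hy. unfold g'. destruct Rlt_dec; [reflexivity|contradiction]. }
  assert (g'g : forall y, E y -> g' y = g y).
  { intros y Ey. unfold g'. destruct Rlt_dec; [symmetry; apply Hg; assumption|reflexivity]. }
  exists rho, g'. split; [exact Pr|split; [|split]].
  - assert (ray : forall y z, (E z \/ Rabs (z - x) < rho) -> (x <= y <= z \/ z <= y <= x) ->
      E y \/ Rabs (y - x) < rho).
    { intros y z [Ez|Hz] Hy.
      - left. destruct Hy as [Hy|Hy]; [exact (IE x y z Ex Ez Hy)|exact (IE z y x Ez Ex Hy)].
      - right. apply Rabs_lt_between in Hz. apply Rabs_lt_between. lra. }
    intros y z w Hy Hw Hz. destruct (Rle_dec z x) as [L|L].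
    + apply (ray z y Hy). lra.
    + apply (ray z w Hw). lra.
  - intros y Hy. destruct (Rlt_dec (Rabs (y - x)) rho) as [L|L].
    + exists (rho - Rabs (y - x)), psi. split; [apply unit_arc_recenter; assumption|].
      intros z _ Hz. apply g'psi.
      replace (z - x) with ((z - y) + (y - x)) by ring.
      eapply Rle_lt_trans; [apply Rabs_triang|lra].
    + assert (Ey : E y) by tauto.
      destruct (AE y Ey) as (ry & psiy & Hpsiy & Hgy). assert (Pry := proj1 Hpsiy).
      exists (Rmin ry rho), psiy. split.
      * apply (unit_arc_shrink _ _ ry); [|exact Hpsiy]. split; [apply Rmin_glb_lt; assumption|apply Rmin_l].
      * intros z Hz Hzy.
        assert (Z1 := Rlt_le_trans _ _ _ Hzy (Rmin_l _ _)).
        assert (Z2 := Rlt_le_trans _ _ _ Hzy (Rmin_r _ _)).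
        assert (Ez : E z).
        { destruct Hz as [Ez|Hz]; [exact Ez|].
          apply Rabs_lt_between in Hz. apply Rabs_lt_between in Z2.
          destruct (Rle_dec x y) as [M|M].
          - rewrite Rabs_pos_eq in L by lra. apply (IE x z y Ex Ey). lra.
          - rewrite Rabs_left in L by lra. apply (IE y z x Ey Ex). lra. }
        rewrite g'g by exact Ez. apply Hgy; assumption.
  - intros t It. destruct (GE t It) as [X Y]. split; [left; exact X|]. rewrite g'g; assumption.
Qed.

(** * The maximal curve *)

Lemma open_interval_Rbar (D : R -> Prop) x0 : D x0 -> is_interval D ->
  (forall x, D x -> exists r, 0 < r /\ forall y, Rabs (y - x) < r -> D y) ->
  exists A B, Rbar_lt A B /\ forall x, Rbar_ooint A B x <-> D x.
Proof.
  intros D0 HD Hopen.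
  destruct (Glb_Rbar_correct D) as [A1 A2]. destruct (Lub_Rbar_correct D) as [B1 B2].
  set (A := Glb_Rbar D) in *. set (B := Lub_Rbar D) in *.
  assert (iff : forall x, Rbar_ooint A B x <-> D x).
  { intros x; split.
    - intros [HA HB].
      assert (lo : exists y, D y /\ y < x).
      { apply NNPP; intros N. apply Rbar_lt_not_le in HA. apply HA, A2.
        intros y Dy. apply Rnot_lt_le; intros L; apply N; exists y; auto. }
      assert (hi : exists y, D y /\ x < y).
      { apply NNPP; intros N. apply Rbar_lt_not_le in HB. apply HB, B2.
        intros y Dy. apply Rnot_lt_le; intros L; apply N; exists y; auto. }
      destruct lo as [y [Dy Hy]]. destruct hi as [z [Dz Hz]].
      apply (HD y x z Dy Dz); lra.
    - intros Dx. destruct (Hopen x Dx) as [r [Hr H]].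
      split.
      + apply (Rbar_le_lt_trans _ (Finite (x - r / 2))).
        * apply A1, H. replace (x - r / 2 - x) with (- (r / 2)) by ring.
          rewrite Rabs_Ropp, Rabs_pos_eq; lra.
        * simpl; lra.
      + apply (Rbar_lt_le_trans _ (Finite (x + r / 2))).
        * simpl; lra.
        * apply B1, H. replace (x + r / 2 - x) with (r / 2) by ring. rewrite Rabs_pos_eq; lra. }
  exists A, B. split; [|exact iff].
  apply (Rbar_lt_trans _ (Finite x0)); apply iff, D0.
Qed.

(** Unlike in the normal form, [D] contains a neighbourhood of each of its points. *)
Definition locally_unit (D : R -> Prop) (g : R -> C) : Prop :=
  forall x, D x -> exists rho psi, unit_arc psi x rho /\
    forall y, Rabs (y - x) < rho -> D y /\ g y = psi y.

(** The union of the graphs of all normal forms is a function by uniqueness; its domain is an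
    interval since all of them contain [s t0], and it is open since each normal form can be
    enlarged around each of its points. *)
Lemma maximal_unit_speed_ext I gamma s p q t0 : I t0 -> p < q ->
  (forall x, p <= x <= q -> exists t, I t /\ s t = x) ->
  (exists E g, unit_speed_ext I gamma s E g) ->
  exists A B gs, Rbar_lt A B /\ locally_unit (Rbar_ooint A B) gs /\
    forall E g, unit_speed_ext I gamma s E g -> forall x, E x -> Rbar_ooint A B x /\ g x = gs x.
Proof.
  intros It0 Hpq Hs [E0 [g0 H0]].
  set (D := fun x => exists E g, unit_speed_ext I gamma s E g /\ E x).
  set (gs := fun x => epsilon (inhabits (RtoC 0)) (fun w => exists E g, unit_speed_ext I gamma s E g /\ E x /\ g x = w)).
  assert (Hgs : forall E g, unit_speed_ext I gamma s E g -> forall x, E x -> g x = gs x).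
  { intros E g H x Ex.
    destruct (epsilon_spec (inhabits (RtoC 0)) (fun w => exists E g, unit_speed_ext I gamma s E g /\ E x /\ g x = w))
      as [E' [g' [H' [Ex' Eg']]]].
    { exists (g x), E, g; auto. }
    fold (gs x) in Eg'. rewrite <- Eg'.
    exact (unit_speed_ext_unique I gamma s E g E' g' p q Hpq Hs H H' x Ex Ex'). }
  assert (D0 : D (s t0)).
  { exists E0, g0. split; [exact H0|]. apply H0, It0. }
  assert (HD : is_interval D).
  { assert (ray : forall y z, D z -> (s t0 <= y <= z \/ z <= y <= s t0) -> D y).
    { intros y z [E [g [H Ez]]] Hy. exists E, g. split; [exact H|].
      destruct H as (IE & _ & GE). destruct (GE t0 It0) as [Et0 _].
      destruct Hy as [Hy|Hy]; [exact (IE _ y z Et0 Ez Hy)|exact (IE z y _ Ez Et0 Hy)]. }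
    intros x y z Dx Dz Hy. destruct (Rle_dec y (s t0)) as [L|L].
    - apply (ray y x Dx); lra.
    - apply (ray y z Dz); lra. }
  assert (loc : locally_unit D gs).
  { intros x [E [g [H Ex]]].
    destruct (unit_speed_ext_enlarge I gamma s E g x H Ex) as (r & g' & Hr & H').
    assert (H'' := H'). destruct H' as (_ & A' & _).
    destruct (A' x (or_introl Ex)) as (rho & psi & Hpsi & Hg).
    assert (Pr := proj1 Hpsi).
    exists (Rmin rho r), psi. split.
    - apply (unit_arc_shrink _ _ rho); [|exact Hpsi]. split; [apply Rmin_glb_lt; assumption|apply Rmin_l].
    - intros y Hy.
      assert (Y1 := Rlt_le_trans _ _ _ Hy (Rmin_l _ _)).
      assert (Y2 := Rlt_le_trans _ _ _ Hy (Rmin_r _ _)).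
      split.
      + exists (fun y => E y \/ Rabs (y - x) < r), g'. auto.
      + rewrite <- (Hgs _ _ H'' y (or_intror Y2)). apply Hg; auto. }
  destruct (open_interval_Rbar D (s t0) D0 HD) as (A & B & HAB & iff).
  { intros x Dx. destruct (loc x Dx) as (rho & psi & Hpsi & H). exists rho; split; [apply Hpsi|].
    intros y Hy; apply H, Hy. }
  exists A, B, gs. split; [exact HAB|split].
  - intros x Hx. destruct (loc x (proj1 (iff x) Hx)) as (rho & psi & Hpsi & H).
    exists rho, psi. split; [exact Hpsi|]. intros y Hy. destruct (H y Hy). split; [apply iff|]; assumption.
  - intros E g H x Ex. split; [apply iff; exists E, g; auto|exact (Hgs E g H x Ex)].
Qed.

Lemma unit_arc_conformal psi x rho : unit_arc psi x rho -> conformal_on (Cdisc x rho) psi.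
Proof.
  intros (H1 & H2 & H3 & _). split; [split; [apply Cdisc_open|exact H2]|exact H3].
Qed.

Lemma locally_unit_Rderiv D g x : locally_unit D g -> D x ->
  exists v, is_derive (K := R_AbsRing) (V := C_R_NormedModule) g x v /\ Cmod v = 1.
Proof.
  intros H Dx. destruct (H x Dx) as (rho & psi & (P & _ & _ & U) & Hg).
  destruct (U x) as [v [Hv Nv]]; [rewrite Rminus_diag, Rabs_R0; exact P|].
  exists v; split; [|exact Nv].
  apply (is_derive_ext_loc (K := R_AbsRing) (V := C_R_NormedModule) (fun u => psi (RtoC u))).
  - exists (mkposreal rho P). intros y Hy. symmetry. apply Hg, Hy.
  - apply Cderiv_Rderiv, Hv.
Qed.

Lemma rcont_continuous_on (D : R -> Prop) f : (forall x, D x -> rcont f x) ->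
  continuous_on (U := C_UniformSpace) D f.
Proof.
  intros H x Dx P HP. destruct (proj1 (rcont_continuous f x) (H x Dx) P HP) as [d Hd].
  exists d. intros y Hy _. exact (Hd y Hy).
Qed.

Lemma locally_unit_locally_analytic D g : locally_unit D g -> locally_analytic D g.
Proof.
  intros H.
  assert (Hc : forall x, D x -> rcont g x).
  { intros x Dx. destruct (locally_unit_Rderiv D g x H Dx) as [v [Hv _]]. exact (Rderiv_cont _ _ _ Hv). }
  split; [exact (rcont_continuous_on D g Hc)|].
  intros x Dx. destruct (H x Dx) as (rho & psi & Hpsi & Hg). assert (P := proj1 Hpsi).
  split; [|split].
  - intros _. exists (x - rho / 2), (x + rho / 2).
    assert (near : forall t, segment (x - rho / 2) (x + rho / 2) t -> Rabs (t - x) < rho).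
    { intros t Ht. unfold segment in Ht. apply Rabs_lt_between. lra. }
    split; [apply Hg, near; unfold segment; lra|].
    split; [apply Hg, near; unfold segment; lra|].
    split; [lra|]. split; [lra|split].
    + apply rcont_continuous_on. intros t Ht. apply Hc, Hg, near, Ht.
    + exists (Cdisc x rho), psi. split; [|split].
      * intros t Ht. rewrite Cdisc_R. apply near, Ht.
      * apply unit_arc_conformal, Hpsi.
      * intros t Ht. symmetry. apply Hg, near, Ht.
  - intros M. exfalso. assert (Dy : D (x + rho / 2)).
    { apply Hg. replace (x + rho / 2 - x) with (rho / 2) by ring. rewrite Rabs_pos_eq; lra. }
    apply M in Dy. lra.
  - intros M. exfalso. assert (Dy : D (x - rho / 2)).
    { apply Hg. replace (x - rho / 2 - x) with (- (rho / 2)) by ring. rewrite Rabs_Ropp, Rabs_pos_eq; lra. }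
    apply M in Dy. lra.
Qed.

Lemma locally_unit_arc_length D g : locally_unit D g -> arc_length D g (fun x => x).
Proof.
  intros H x Dx. destruct (locally_unit_Rderiv D g x H Dx) as [v [Hv Nv]].
  exists v; split; [apply is_derive_on_intro_C; assumption|].
  rewrite Nv. apply is_derive_on_id, Dx.
Qed.

(** The discs of the local unit arcs have real centres.  If two of them contain [z], both
    contain [Re z] and the segment from [Re z] to [z].  The two arcs equal [g] on the real axis
    near [Re z], so they agree near [Re z], and then at [z] by the identity principle.  The
    arcs thus define one function on the union of the discs. *)
Lemma locally_unit_holomorphic_extension D g : locally_unit D g ->
  exists (U : C -> Prop) (Phi : C -> C), open (T := C_UniformSpace) U /\
    (forall x : R, D x -> U x) /\ (forall x : R, D x -> Phi x = g x) /\
    locally_conformal_on U Phi /\ locally_injective_on U Phi.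
Proof.
  intros H.
  set (piece := fun z psi x rho => unit_arc psi x rho /\
    (forall y, Rabs (y - x) < rho -> D y /\ g y = psi y) /\ Cdisc (RtoC x) rho z).
  set (U := fun z => exists psi x rho, piece z psi x rho).
  assert (agree : forall z psi1 x1 r1 psi2 x2 r2, piece z psi1 x1 r1 -> piece z psi2 x2 r2 -> psi1 z = psi2 z).
  { intros z psi1 x1 r1 psi2 x2 r2 (A1 & G1 & D1) (A2 & G2 & D2).
    assert (foot : forall x r, Cdisc (RtoC x) r z -> Cdisc (RtoC x) r (RtoC (Re z))).
    { intros x r Hz. rewrite Cdisc_R. eapply Rle_lt_trans; [|exact Hz].
      replace (Re z - x) with (Re (z - x)%C) by (destruct z; reflexivity). apply re_le_Cmod. }
    assert (F1 := foot _ _ D1). assert (F2 := foot _ _ D2).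
    destruct A1 as (_ & H1 & _). destruct A2 as (_ & H2 & _).
    assert (both : forall w, Cdisc (RtoC x1) r1 w -> Cdisc (RtoC x2) r2 w ->
      exists r, 0 < r /\ holo_disc w r (fun z => psi1 z - psi2 z)%C /\
        forall v, Cdisc w r v -> Cdisc (RtoC x1) r1 v /\ Cdisc (RtoC x2) r2 v).
    { intros w W1 W2. exists (Rmin (r1 - Cmod (w - x1)) (r2 - Cmod (w - x2))).
      assert (sub : forall v, Cdisc w (Rmin (r1 - Cmod (w - x1)) (r2 - Cmod (w - x2))) v ->
         Cdisc (RtoC x1) r1 v /\ Cdisc (RtoC x2) r2 v).
      { intros v Hv. split; [apply (Cdisc_sub _ _ w _ W1)|apply (Cdisc_sub _ _ w _ W2)].
        - eapply Cdisc_mono; [apply Rmin_l|exact Hv].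
        - eapply Cdisc_mono; [apply Rmin_r|exact Hv]. }
      split; [unfold Cdisc in W1, W2; apply Rmin_glb_lt; lra|split; [|exact sub]].
      intros v Hv. destruct (sub v Hv) as [V1 V2].
      destruct (H1 v V1) as [l1 L1]. destruct (H2 v V2) as [l2 L2].
      eexists; apply Cderiv_minus; eassumption. }
    apply Ceq_minus.
    apply (identity_segment (fun z => psi1 z - psi2 z)%C (RtoC (Re z)) z).
    - intros t Ht. destruct (both (RtoC (Re z) + RtoC t * (z - RtoC (Re z)))%C) as [r [Hr [Hh _]]].
      + apply Cdisc_convex; assumption.
      + apply Cdisc_convex; assumption.
      + exists r; auto.
    - destruct (both _ F1 F2) as [r [Hr [Hh Hsub]]].
      destruct (isolated_zeros _ r _ Hr Hh) as [r' [Hr' [Z|N]]].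
      + exists r'; split; [lra|exact Z].
      + exfalso. set (y := Re z + r' / 2).
        assert (Dy : Cdisc (RtoC (Re z)) r' (RtoC y)).
        { rewrite Cdisc_R. unfold y. replace (Re z + r' / 2 - Re z) with (r' / 2) by ring.
          rewrite Rabs_pos_eq; lra. }
        apply (N (RtoC y) Dy).
        * intros e; apply RtoC_inj in e. unfold y in e; lra.
        * destruct (Hsub (RtoC y)) as [Y1 Y2]; [eapply Cdisc_mono; [|exact Dy]; lra|].
          rewrite Cdisc_R in Y1, Y2.
          rewrite <- (proj2 (G1 y Y1)), <- (proj2 (G2 y Y2)). ring. }
  set (Phi := fun z => epsilon (inhabits (RtoC 0)) (fun w => exists psi x rho, piece z psi x rho /\ psi z = w)).
  assert (HPhi : forall z psi x rho, piece z psi x rho -> Phi z = psi z).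
  { intros z psi x rho Hp.
    destruct (epsilon_spec (inhabits (RtoC 0)) (fun w => exists psi x rho, piece z psi x rho /\ psi z = w))
      as (psi' & x' & rho' & Hp' & Ez).
    { exists (psi z), psi, x, rho; auto. }
    fold (Phi z) in Ez. rewrite <- Ez. exact (agree _ _ _ _ _ _ _ Hp' Hp). }
  assert (move : forall z w psi x rho, piece z psi x rho -> Cdisc (RtoC x) rho w -> piece w psi x rho).
  { intros z w psi x rho (P1 & P2 & _) Hw; split; [exact P1|split; [exact P2|exact Hw]]. }
  assert (conf : forall z psi x rho, piece z psi x rho ->
     (forall w, Cdisc (RtoC x) rho w -> U w) /\ conformal_on (Cdisc (RtoC x) rho) Phi).
  { intros z psi x rho Hp.
    split; [intros w Hw; exists psi, x, rho; exact (move _ _ _ _ _ Hp Hw)|].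
    destruct (proj1 Hp) as (_ & H1 & H2 & _).
    split; [split; [apply Cdisc_open|]|].
    - intros w Hw. destruct (H1 w Hw) as [l Hl]. exists l.
      apply (Cderiv_ext psi _ _ _ (rho - Cmod (w - x))).
      + unfold Cdisc in Hw; lra.
      + intros v Hv. symmetry. apply (HPhi v psi x rho), (move z v); [exact Hp|].
        exact (Cdisc_sub _ _ _ _ Hw Hv).
      + exact Hl.
    - intros v w Hv Hw. rewrite (HPhi v _ _ _ (move _ _ _ _ _ Hp Hv)), (HPhi w _ _ _ (move _ _ _ _ _ Hp Hw)).
      apply H2; assumption. }
  assert (start : forall x, D x -> exists psi rho, piece (RtoC x) psi x rho /\ g x = psi x).
  { intros x Dx. destruct (H x Dx) as (rho & psi & Hpsi & Hg). assert (P := proj1 Hpsi).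
    exists psi, rho. split; [split; [exact Hpsi|split; [exact Hg|apply Cdisc_center, P]]|].
    apply Hg. rewrite Rminus_diag, Rabs_R0; exact P. }
  assert (oU : open (T := C_UniformSpace) U).
  { intros z (psi & x & rho & Hp). destruct (conf z psi x rho Hp) as [sub [[oV _] _]].
    destruct (oV z (proj2 (proj2 Hp))) as [e He]. exists e. intros w Hw. apply sub, He, Hw. }
  exists U, Phi. split; [exact oU|split; [|split; [|split; [split; [split; [exact oU|]|]|]]]].
  - intros x Dx. destruct (start x Dx) as (psi & rho & Hp & _). exists psi, x, rho; exact Hp.
  - intros x Dx. destruct (start x Dx) as (psi & rho & Hp & ->). exact (HPhi _ _ _ _ Hp).
  - intros z (psi & x & rho & Hp). apply (conf z psi x rho Hp), Hp.
  - intros z (psi & x & rho & Hp). exists (Cdisc (RtoC x) rho).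
    split; [apply Hp|]. exact (conf z psi x rho Hp).
  - intros z (psi & x & rho & Hp). exists (Cdisc (RtoC x) rho).
    destruct (conf z psi x rho Hp) as [sub [_ inj]].
    split; [apply Cdisc_open|split; [apply Hp|split; [exact sub|exact inj]]].
Qed.

Lemma arc_length_continuous I gamma s : arc_length I gamma s ->
  continuous_on (T := R_UniformSpace) (U := R_UniformSpace) I s.
Proof.
  intros H t It P [eps HP]. destruct (H t It) as [v [_ Hv]].
  destruct (is_derive_on_R _ _ _ _ Hv 1 Rlt_0_1) as [d [Hd H1]].
  assert (K : 0 < Cmod v + 1) by (generalize (Cmod_ge_0 v); lra).
  assert (Hdd : 0 < Rmin d (eps / (Cmod v + 1))).
  { apply Rmin_glb_lt; [exact Hd|apply Rdiv_lt_0_compat; [apply cond_pos|exact K]]. }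
  exists (mkposreal _ Hdd). intros u Hu Iu. apply HP.
  change (Rabs (u - t) < Rmin d (eps / (Cmod v + 1))) in Hu.
  change (Rabs (s u - s t) < eps).
  assert (U1 := Rlt_le_trans _ _ _ Hu (Rmin_l _ _)).
  assert (U2 := Rlt_le_trans _ _ _ Hu (Rmin_r _ _)).
  apply Rlt_div_r in U2; [|exact K].
  specialize (H1 u Iu U1).
  replace (s u - s t) with ((s u - s t - Cmod v * (u - t)) + Cmod v * (u - t)) by ring.
  eapply Rle_lt_trans; [apply Rabs_triang|]. rewrite Rabs_mult, (Rabs_pos_eq (Cmod v)) by apply Cmod_ge_0.
  lra.
Qed.

Theorem theorem2p5 (I : R -> Prop) (gamma : R -> C) (s : R -> R)
    (I_interval : is_interval I) (I_nondegenerate : nondegenerate I)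
    (gamma_locally_analytic : locally_analytic I gamma)
    (s_arc_length : arc_length I gamma s) :
  exists (A B : Rbar) (gs : R -> C),
    Rbar_lt A B /\
    (* the graph of gs is the union of the graphs of the arc length
       parametrizations of all locally analytic extensions of gamma *)
    (forall (x : R) (w : C),
       (Rbar_ooint A B x /\ gs x = w) <->
       (exists (Gamma : R -> C) (J : R -> Prop) (h sigma : R -> R) (u : R),
          locally_analytic_extension I gamma Gamma J h /\
          normalized_arc_length I s Gamma J h sigma /\
          J u /\ sigma u = x /\ Gamma u = w)) /\
    (* (i) *)
    (locally_analytic (Rbar_ooint A B) gs /\
     forall x : R, Rbar_ooint A B x ->
       exists v : C, is_derive (K := R_AbsRing) (V := C_R_NormedModule) gs x v /\
                     Cmod v = 1) /\
    (* (ii) *)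
    (forall t : R, I t -> Rbar_ooint A B (s t) /\ gamma t = gs (s t)) /\
    (* (iii) *)
    (forall (Gamma : R -> C) (J : R -> Prop) (h sigma : R -> R),
       locally_analytic_extension I gamma Gamma J h ->
       normalized_arc_length I s Gamma J h sigma ->
       forall u : R, J u -> Rbar_ooint A B (sigma u) /\ Gamma u = gs (sigma u)) /\
    (* holomorphic extension *)
    (exists (U : C -> Prop) (Phi : C -> C),
       open U /\
       (forall x : R, Rbar_ooint A B x -> U (RtoC x)) /\
       (forall x : R, Rbar_ooint A B x -> Phi (RtoC x) = gs x) /\
       locally_conformal_on U Phi /\
       locally_injective_on U Phi).
Proof.
  destruct (arc_length_monotone I gamma s) as [s_mono sI_interval]; try assumption.
  assert (HN := I_nondegenerate). destruct HN as [p [q [Ip [Iq Hpq]]]].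
  assert (self : locally_analytic_extension I gamma gamma I (fun t => t)).
  { split; [assumption|split; [assumption|split; [auto|split; [|split; auto]]]].
    intros x _. intros P [e He]; exists e; intros y Hy _; apply He, Hy. }
  destruct (unit_speed_ext_of_extension I gamma s gamma I (fun t => t) s) as [g0 [H0 _]];
    [assumption|exact self|split; [assumption|auto]|].
  destruct (maximal_unit_speed_ext I gamma s (s p) (s q) p Ip) as (A & B & gs & HAB & Hloc & Hmax).
  { apply s_mono; assumption. }
  { intros x Hx. apply (sI_interval (s p) x (s q)); [exists p; auto|exists q; auto|exact Hx]. }
  { eexists; exists g0; exact H0. }
  assert (ii : forall t, I t -> Rbar_ooint A B (s t) /\ gamma t = gs (s t)).
  { intros t It. destruct (proj2 (proj2 H0) t It) as [X ->]. exact (Hmax _ _ H0 _ X). }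
  assert (iii : forall (Gamma : R -> C) (J : R -> Prop) (h sigma : R -> R),
       locally_analytic_extension I gamma Gamma J h ->
       normalized_arc_length I s Gamma J h sigma ->
       forall u : R, J u -> Rbar_ooint A B (sigma u) /\ Gamma u = gs (sigma u)).
  { intros Gamma J h sigma Hext Hnorm u Ju.
    destruct (unit_speed_ext_of_extension I gamma s Gamma J h sigma) as [g [Hg1 Hg2]]; try assumption.
    rewrite <- Hg2 by exact Ju. apply (Hmax _ _ Hg1). exists u; auto. }
  assert (i := locally_unit_locally_analytic _ _ Hloc).
  exists A, B, gs. split; [exact HAB|split; [|split; [|split; [exact ii|split; [exact iii|]]]]].
  - intros x w; split.
    + intros [Hx <-]. exists gs, (Rbar_ooint A B), s, (fun x => x), x.
      split; [|split; [split; [apply locally_unit_arc_length, Hloc|auto]|auto]].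
      split; [|split; [exact i|split; [apply ii|split; [exact (arc_length_continuous _ _ _ s_arc_length)|split; [exact s_mono|apply ii]]]]].
      intros y z v [Y1 Y2] [V1 V2] Hz. split.
      * apply (Rbar_lt_le_trans _ y); [exact Y1|simpl; lra].
      * apply (Rbar_le_lt_trans _ v); [simpl; lra|exact V2].
    + intros (Gamma & J & h & sigma & u & Hext & Hnorm & Ju & <- & <-).
      destruct (iii Gamma J h sigma Hext Hnorm u Ju) as [X Y]. split; [exact X|symmetry; exact Y].
  - split; [exact i|]. intros x Hx. exact (locally_unit_Rderiv _ _ x Hloc Hx).
  - apply (locally_unit_holomorphic_extension _ _ Hloc).
Qed.
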